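(* Let $X\in\{B,C,D\}$. For strict partitions $\lambda,\mu$ define $\psi_\lambda(\mu)=GX_\lambda(b_\mu|b)\in\mathcal{R}$, i.e. $GX^{(N)}_\lambda$ evaluated at $x=(b_\mu,0,\dots,0)$ for any $N$ at least the lengths of $\lambda$ and of $b_\mu$ ($N$ even if $X=D$; the value is independent of such $N$). Then $\{\psi_\lambda\}_{\lambda\in\mathcal{SP}}$ is a family of Schubert classes, i.e.: (i) each $\psi_\lambda$ lies in $\Psi$; (ii) for every index $i$ of a simple reflection, $\pi_i\psi_\lambda=\psi_{\lambda^{(i)}}$ if $s_i\lambda<\lambda$ and $\pi_i\psi_\lambda=-\beta\psi_\lambda$ if $s_i\lambda\ge\lambda$; (iii) $\psi_\lambda(\emptyset)=\delta_{\lambda,\emptyset}$.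
   Context: $\beta$ indeterminate; $x\oplus y=x+y+\beta xy$, $x\ominus y=(x-y)/(1+\beta y)$, $\ominus y=0\ominus y$. $\mathcal{R}=\mathbb{Z}[\beta][b_1,b_2,\dots][(1+\beta b_i)^{-1},i\ge1]$, and $b_{\bar i}:=\ominus b_i$. For strict $\lambda=(\lambda_1>\dots>\lambda_r>0)$, $r\le n$: $GP_\lambda(x_1,\dots,x_n|b)=\frac1{(n-r)!}\sum_{w\in S_n}w\big[\prod_{j=1}^r\prod_{k=1}^{\lambda_j}(x_j\oplus b_k)\prod_{i=1}^r\prod_{j=i+1}^n\frac{x_i\oplus x_j}{x_i\ominus x_j}\big]$; $GQ_\lambda$ same with $\prod_{k=1}^{\lambda_j}(x_j\oplus b_k)$ replaced by $(x_j\oplus x_j)\prod_{k=1}^{\lambda_j-1}(x_j\oplus b_k)$. $GB^{(N)}_\lambda=GP_\lambda(x_1,\dots,x_N|0,b_1,b_2,\dots)$, $GC^{(N)}_\lambda=GQ_\lambda(x_1,\dots,x_N|b)$, $GD^{(N)}_\lambda=GP_\lambda(x_1,\dots,x_N|b)$ ($N$ even). $\mathcal{SP}$ = all strict partitions. Sequences $b_\mu$: for $B,C$, $b_\mu=(\ominus b_{\mu_1},\dots,\ominus b_{\mu_r})$; for $D$, $b_\mu=(\ominus b_{\mu_1+1},\dots,\ominus b_{\mu_r+1})$ if $r$ even and $(\ominus b_{\mu_1+1},\dots,\ominus b_{\mu_r+1},\ominus b_1)$ if $r$ odd ($r$ = length of $\mu$). Weyl group: a signed permutation is a bijection $w$ of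 $\mathbb{N}\cup\bar{\mathbb{N}}$ ($\bar{\mathbb{N}}=\{\bar1,\bar2,\dots\}$) with $w(\bar i)=\overline{w(i)}$ ($\bar{\bar i}=i$) fixing all but finitely many elements. For $B,C$, $W$ is the group of all signed permutations, for $D$ the subgroup generated by $s_{\hat1}$ and $s_i$ ($i\ge1$); here $s_0$ swaps $1,\bar1$; $s_i$ ($i\ge1$) swaps $i,i+1$; $s_{\hat1}$: $1\mapsto\bar2,2\mapsto\bar1$. Simple indices are $0,1,2,\dots$ for $B,C$ and $\hat1,1,2,\dots$ for $D$. $W$ acts on $\mathcal{R}$ by $w(b_i)=b_{w(i)}$, fixing $\beta$. Encode $\lambda\in\mathcal{SP}$ of length $r$ by a finite set $S_\lambda\subset\mathbb{N}$: $S_\lambda=\{\lambda_1,\dots,\lambda_r\}$ for $B,C$; $S_\lambda=\{\lambda_1+1,\dots,\lambda_r+1\}$ ($r$ even) or $\{\lambda_1+1,\dots,\lambda_r+1,1\}$ ($r$ odd) for $D$. Then $w\lambda$ is defined by $S_{w\lambda}=\{i\in\mathbb{N}:\bar i\in w(\{\bar s:s\in S_\lambda\}\cup(\mathbb{N}\setminus S_\lambda))\}$. The order $<$ on $\mathcal{SP}$ is the Bruhat order transported by this bijection; for a simple $s_i$, $s_i\lambda<\lambda$ iff $\lambda$ is $i$-removable, and then $\lambda^{(i)}:=s_i\lambda$ is $\lambda$ with one box of content $i$ removed. (Shifted diagram $\mathbb{D}(\lambda)=\{(i,j):1\le i\le r,\ i\le j\le\lambda_i+i-1\}$; content $c(i,j)=j-i$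 for $B,C$; for $D$, $c(i,j)=j-i+1$ if $i<j$, $c(i,i)=\hat1$ if $i$ odd, $1$ if $i$ even; $\lambda$ is $i$-removable if some box $\alpha$ with $c(\alpha)=i$ has $\mathbb{D}(\lambda)\setminus\{\alpha\}$ a shifted diagram.) Roots: positive roots are $t_i$ ($B$), $2t_i$ ($C$), and $t_j\pm t_i$ ($j>i\ge1$) (only the latter for $D$); $e(t_i)=b_i$, $e(2t_i)=b_i\oplus b_i$, $e(t_j-t_i)=b_j\ominus b_i$, $e(t_j+t_i)=b_j\oplus b_i$; reflections $s_{t_i}=s_{2t_i}$ swaps $i,\bar i$, $s_{t_j-t_i}$ swaps $i,j$, $s_{t_j+t_i}$: $i\mapsto\bar j,j\mapsto\bar i$. Simple roots: $\alpha_0=t_1$ ($B$), $2t_1$ ($C$), $\alpha_{\hat1}=t_1+t_2$ ($D$), $\alpha_i=t_{i+1}-t_i$ ($i\ge1$). $\Psi$ is the set of maps $\psi:\mathcal{SP}\to\mathcal{R}$ with $\psi(s_\alpha\mu)-\psi(\mu)\in e(\alpha)\mathcal{R}$ for all $\mu$ and positive roots $\alpha$. Divided differences on $\Psi$: $(\pi_i\psi)(\mu)=\big(s_i(\psi(s_i\mu))-(1+\beta e(\alpha_i))\psi(\mu)\big)/e(\alpha_i)$. *)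

(* Defs.v *)
From HB Require Import structures.
From Stdlib Require Import ClassicalEpsilon.
From mathcomp Require Import all_boot all_order all_algebra all_fingroup.
From mathcomp Require Import generic_quotient finmap.
From mathcomp.multinomials Require Import monalg.

Set Implicit Arguments.
Unset Strict Implicit.
Unset Printing Implicit Defensive.

Import Order.TTheory GRing.Theory Num.Theory.

Local Open Scope ring_scope.
Local Open Scope quotient_scope.

(* Polynomials in the countably many variables indexed by nat, over an        *)
(* integral domain R, form an integral domain.  The proof evaluates           *)
(* variable i at 'X^(B ^ i) with B larger than every exponent that occurs     *)
(* (Kronecker substitution).                                                  *)
Section InfPolyDomain.

Variable R : idomainType.

Local Notation mon := (cmonom nat).
Local Notation A := (malg mon R).

Implicit Types (m : mon) (p q : A) (B : nat).

Definition kron B m : nat := (\sum_(i <- finsupp m) m i * B ^ i)%N.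

Lemma kronEw B m (d : {fset nat}) : (finsupp m `<=` d)%fset ->
  kron B m = (\sum_(i <- d) m i * B ^ i)%N.
Proof.
move=> le; rewrite /kron (big_fset_incl _ le) // => i _.
by rewrite -cmE_neq0 negbK => /eqP ->.
Qed.

Lemma kron1 B : kron B mone = 0%N.
Proof. by rewrite /kron mdom1 big_seq_fset0. Qed.

Lemma kronM B : {morph kron B : x y / mmul x y >-> (x + y)%N}.
Proof.
move=> x y; rewrite {1}/kron mdomD.
rewrite (kronEw B (fsubsetUl _ (finsupp y))).
rewrite (kronEw B (fsubsetUr (finsupp x) _)).
by rewrite -big_split /=; apply: eq_bigr => i _; rewrite cmM mulnDl.
Qed.

Lemma kron_ord B m n : (forall i, i \in finsupp m -> (i < n)%N) ->
  kron B m = (\sum_(i < n) m i * B ^ i)%N.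
Proof.
move=> lt; rewrite (@kronEw B m [fset i in iota 0 n]%fset); last first.
  by apply/fsubsetP => i /lt i_n; rewrite inE mem_iota.
rewrite -(big_mkord xpredT (fun i => (m i * B ^ i)%N)) /index_iota subn0.
apply: perm_big; apply: uniq_perm; rewrite ?fset_uniq ?iota_uniq //.
by move=> i; rewrite inE.
Qed.

Lemma digits_inj B n (a c : nat -> nat) :
    (forall i, (a i < B)%N) -> (forall i, (c i < B)%N) ->
    (\sum_(i < n) a i * B ^ i = \sum_(i < n) c i * B ^ i)%N ->
  forall i, (i < n)%N -> a i = c i.
Proof.
elim: n a c => [|n IHn] a c ltaB ltcB //; rewrite !big_ord_recl !expn0 !muln1.
have shift (f : nat -> nat) : (\sum_(i < n) f (bump 0 i) * B ^ bump 0 i =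
    (\sum_(i < n) f i.+1 * B ^ i) * B)%N.
  by rewrite big_distrl /=; apply: eq_bigr => i _; rewrite /bump add1n expnSr mulnA.
rewrite /= !shift => eq_sum.
have B_gt0 : (0 < B)%N by apply: leq_ltn_trans (ltaB 0%N).
have a0 : a 0%N = c 0%N.
  by move/(congr1 (modn^~ B)): eq_sum; rewrite !(addnC _ (_ * _)%N) !modnMDl !modn_small.
move: eq_sum; rewrite a0 => /addnI /eqP; rewrite eqn_pmul2r // => /eqP eq_sum.
case=> [|i] // lt_i.
by apply: (IHn (a \o succn) (c \o succn)) => // j; [apply: ltaB|apply: ltcB].
Qed.

Lemma kron_inj B m1 m2 : (forall i, m1 i < B)%N -> (forall i, m2 i < B)%N ->
  kron B m1 = kron B m2 -> m1 = m2.
Proof.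
move=> lt1 lt2 eq12; pose n := (\sum_(i <- (finsupp m1 `|` finsupp m2)%fset) i).+1.
have lt_n i : i \in (finsupp m1 `|` finsupp m2)%fset -> (i < n)%N.
  by move=> im; rewrite ltnS (big_fsetD1 i) //= leq_addr.
have lt1n i : i \in finsupp m1 -> (i < n)%N.
  by move=> im; apply: lt_n; rewrite in_fsetU im.
have lt2n i : i \in finsupp m2 -> (i < n)%N.
  by move=> im; apply: lt_n; rewrite in_fsetU im orbT.
move: eq12; rewrite (kron_ord _ lt1n) (kron_ord _ lt2n) => eq12.
have {}eq12 := digits_inj lt1 lt2 eq12.
apply/eqP/cmP => i; have [/eq12 //|le_ni] := ltnP i n.
have out m : (forall j, j \in finsupp m -> (j < n)%N) -> m i = 0%N.
  move=> lt; apply/eqP; rewrite cmE_eq0; apply/negP => /lt.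
  by rewrite ltnNge le_ni.
by rewrite (out m1) // (out m2).
Qed.

Definition kronX B (m : mon) : {poly R} := 'X^(kron B m).

Fact kronX_mmorphism B : mmorphism (kronX B).
Proof.
by split=> [x y|]; rewrite /kronX ?kron1 ?expr0 // kronM exprD.
Qed.

HB.instance Definition _ B :=
  isMultiplicative.Build mon {poly R} (kronX B) (kronX_mmorphism B).

Definition keval B : A -> {poly R} := mmap (@polyC R) (kronX B).

Definition kbound p : nat := (\sum_(m <- msupp p) mdeg m).+1.

Lemma kboundP p m i : m \in msupp p -> (m i < kbound p)%N.
Proof.
move=> mp; rewrite ltnS (big_fsetD1 m) //=.
apply: leq_trans (leq_addr _ _); rewrite mdegE.
have [im|im] := boolP (i \in finsupp m).
  by rewrite (big_fsetD1 i) //= leq_addr.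
by rewrite (_ : m i = 0%N) //; apply/eqP; rewrite cmE_eq0.
Qed.

Lemma coef_keval B p m : (kbound p <= B)%N -> m \in msupp p ->
  (keval B p)`_(kron B m) = mcoeff m p.
Proof.
move=> leB mp; rewrite /keval mmapE (big_fsetD1 m) //= coefD.
rewrite coefCM coefXn eqxx mulr1 coef_sum big_seq big1 ?addr0 // => m'.
rewrite in_fsetD1 => /andP[m'm m'p]; rewrite coefCM coefXn.
case: eqP => [/kron_inj eq_m|]; last by rewrite mulr0.
have lt x i : x \in msupp p -> (x i < B)%N.
  by move=> xp; apply: leq_trans (kboundP i xp) leB.
by case/eqP: m'm; rewrite eq_m // => i; apply: lt.
Qed.

Lemma keval_neq0 B p : (kbound p <= B)%N -> p != 0 -> keval B p != 0.
Proof.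
move=> leB p0; have [m mp] : exists m, m \in msupp p.
  by apply/fset0Pn; rewrite msupp_eq0.
apply/negP => /eqP e0; have := mp.
by rewrite -mcoeff_neq0 -(coef_keval leB mp) e0 coef0 eqxx.
Qed.

Fact infpoly_domain : GRing.integral_domain_axiom A.
Proof.
move=> p q pq0; rewrite -[_ || _]negbK negb_or; apply/negP => /andP[p0 q0].
pose B := (kbound p + kbound q)%N.
have ep : keval B p != 0 by apply: keval_neq0 => //; apply: leq_addr.
have eq : keval B q != 0 by apply: keval_neq0 => //; apply: leq_addl.
have := mulf_neq0 ep eq; rewrite /keval -rmorphM pq0 rmorph0.
by rewrite eqxx.
Qed.

Definition infpoly_unit : pred A :=
  fun p => (p == malgC (mcoeff mone p)) && (mcoeff mone p \is a GRing.unit).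

Definition infpoly_inv p : A :=
  if infpoly_unit p then malgC (mcoeff mone p)^-1 else p.

Lemma infpoly_const_inv (c : R) : c \is a GRing.unit ->
  malgC c^-1 * malgC c = 1 :> A.
Proof. by move=> u; rewrite -(@rmorphM R A (malgC)) (mulVr u) rmorph1. Qed.

Fact infpoly_mulVp : {in infpoly_unit, left_inverse 1 infpoly_inv *%R}.
Proof.
move=> p p_unit; have uP : infpoly_unit p = true by [].
have /andP[/eqP pE u] := uP.
rewrite /infpoly_inv uP; apply: etrans (infpoly_const_inv u).
exact: (congr1 (fun q : A => malgC (mcoeff mone p)^-1 * q) pE).
Qed.

Fact infpoly_unitP p q : q * p = 1 -> infpoly_unit p.
Proof.
move=> qp1; pose B := kbound p.
have ep1 : keval B q * keval B p = 1 by rewrite /keval -rmorphM qp1 rmorph1.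
have eval_unit : keval B p \is a GRing.unit.
  by apply/unitrPr; exists (keval B q); rewrite mulrC.
move: eval_unit; rewrite poly_unitE => /andP[/eqP sz u].
have supp1 m : m \in msupp p -> m = mone.
  move=> mp; have c0 : (keval B p)`_(kron B m) != 0.
    by rewrite coef_keval // mcoeff_neq0.
  have k0 : kron B m = 0%N.
    apply/eqP; apply: contraNT c0; rewrite -lt0n => k_gt0.
    by rewrite nth_default // sz.
  apply: (@kron_inj B) => [i|i|]; rewrite ?k0 ?kron1 ?cm1 //.
  exact: kboundP.
have pE : p = malgC (mcoeff mone p).
  apply/malgP => m; rewrite mcoeffC; have [<-|m1] := eqVneq; first by rewrite mulr1n.
  rewrite mulr0n; apply/eqP; rewrite mcoeff_eq0; apply: contra m1 => /supp1 ->.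
  by [].
rewrite /infpoly_unit -pE eqxx /=.
by move: u; rewrite {1}pE /keval mmapC coefC.
Qed.

Fact infpoly_invN : {in [predC infpoly_unit], infpoly_inv =1 id}.
Proof. by move=> p /negbTE; rewrite -topredE /= /infpoly_inv => ->. Qed.

End InfPolyDomain.

HB.instance Definition _ (R : idomainType) :=
  GRing.ComNzRing_hasMulInverse.Build (malg (cmonom nat) R)
    (@infpoly_mulVp R) (@infpoly_unitP R) (@infpoly_invN R).
HB.instance Definition _ (R : idomainType) :=
  GRing.ComUnitRing_isIntegral.Build (malg (cmonom nat) R)
    (@infpoly_domain R).

From mathcomp.multinomials Require Import mpoly.

Local Notation "x %:F" := (FracField.tofrac x).

(* The variable of index k in poly_ring stands for b_(k+1), so that the       *)
(* variables are exactly b_1, b_2, ...; the coefficient ring {poly int} is    *)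
(* Z[beta].                                                                   *)
Definition poly_ring := malg (cmonom nat) {poly int}.
HB.instance Definition _ := GRing.IntegralDomain.on poly_ring.

Definition K := {fraction poly_ring}.
HB.instance Definition _ := GRing.Field.on K.

Definition coefK (c : {poly int}) : K :=
  (monalg.mkmalgU mone c : poly_ring)%:F.

Definition beta : K := coefK 'X.

(* b 0 = 0 is a dummy value: the sequence b starts at b 1. *)
Definition b (k : nat) : K :=
  if k is k'.+1 then
    (monalg.mkmalgU (ucm k') 1 : poly_ring)%:F
  else 0.

Definition oplus (F : fieldType) (bt x y : F) : F := x + y + bt * x * y.
Definition ominus (F : fieldType) (bt x y : F) : F := (x - y) / (1 + bt * y).

(* The subring Z[beta][b_1, b_2, ...][(1 + beta b_i)^-1, i >= 1] of K. *)
Definition inR (f : K) : Prop :=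
  exists (p : poly_ring) (s : seq nat),
    all (leq 1) s /\
    f = p%:F / \prod_(i <- s) (1 + beta * b i).

(* The elements of N and of N-bar are the positive and the negative integers, *)
(* with bar i = - i; a signed permutation is then an odd map (which forces    *)
(* w 0 = 0).                                                                  *)
Definition bz (z : int) : K :=
  match z with
  | Posz k => b k
  | Negz k => ominus beta 0 (b k.+1)
  end.

Definition signed_perm (w : int -> int) : Prop :=
  [/\ bijective w, forall z, w (- z) = - w z
    & exists N : nat, forall z : int, (N < absz z)%N -> w z = z].

(* The action of w on K extends the one on R: the ring morphism with          *)
(* b_i |-> b_(w i) is applied to a numerator and to a denominator.            *)
Definition wact_poly (w : int -> int) (p : poly_ring) : K :=
  monalg.mmap coefK
    (fun m : cmonom nat =>
       \prod_(k <- finsupp m) bz (w (Posz k.+1)) ^+ m k) p.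

Definition wact (w : int -> int) (f : {fraction poly_ring}) : K :=
  wact_poly w \n_(repr f) / wact_poly w \d_(repr f).

Inductive cartan : predArgType := TypeB | TypeC | TypeD.

Definition is_strict (l : seq nat) : bool := sorted gtn l && (0%N \notin l).

Record SP : predArgType :=
  MkSP { parts :> seq nat; partsP : is_strict parts }.
HB.instance Definition _ := [isSub for parts].
HB.instance Definition _ := [Choice of SP by <:].

Definition emptySP : SP := @MkSP [::] isT.

(* The set S_l, listed in the order in which b_l lists the corresponding      *)
(* (ominus b_s).                                                              *)
Definition code (X : cartan) (l : SP) : seq nat :=
  match X with
  | TypeD => let s := [seq k.+1 | k <- parts l] in
             if odd (size l) then rcons s 1%N else s
  | _ => parts l
  end.

Definition bvec (X : cartan) (l : SP) : seq K :=
  [seq ominus beta 0 (b k) | k <- code X l].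

(* {bar s | s in S_l} U (N \ S_l) *)
Definition signed_code (X : cartan) (l : SP) (z : int) : Prop :=
  (exists2 s : nat, s \in code X l & z = - Posz s) \/
  (exists2 n : nat, (0 < n)%N && (n \notin code X l) & z = Posz n).

Definition is_act (X : cartan) (w : int -> int) (l m : SP) : Prop :=
  forall i : nat, (0 < i)%N ->
    (i \in code X m <-> exists2 z, signed_code X l z & w z = - Posz i).

Definition act (X : cartan) (w : int -> int) (l : SP) : SP :=
  epsilon (inhabits emptySP) (is_act X w l).

Inductive root : predArgType :=
| Rt of nat              (* Rt i       : t_i *)
| Rtt of nat             (* Rtt i      : 2 t_i *)
| Rminus of nat & nat    (* Rminus j i : t_j - t_i *)
| Rplus of nat & nat.    (* Rplus j i  : t_j + t_i *)

Definition positive_root (X : cartan) (a : root) : bool :=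
  match a, X with
  | Rt i, TypeB => (0 < i)%N
  | Rtt i, TypeC => (0 < i)%N
  | Rminus j i, _ | Rplus j i, _ => (0 < i)%N && (i < j)%N
  | _, _ => false
  end.

Definition e (a : root) : K :=
  match a with
  | Rt i => b i
  | Rtt i => oplus beta (b i) (b i)
  | Rminus j i => ominus beta (b j) (b i)
  | Rplus j i => oplus beta (b j) (b i)
  end.

Definition refl (a : root) (z : int) : int :=
  match a with
  | Rt i | Rtt i => if absz z == i then - z else z
  | Rminus j i => if absz z == i then Num.sg z * Posz j
                  else if absz z == j then Num.sg z * Posz i else z
  | Rplus j i => if absz z == i then - Num.sg z * Posz j
                 else if absz z == j then - Num.sg z * Posz i else z
  end.

(* Simple indices are natural numbers; in type D, 0 stands for 1-hat. *)
Definition simple_root (X : cartan) (i : nat) : root :=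
  if i is i'.+1 then Rminus i'.+2 i'.+1
  else match X with
       | TypeB => Rt 1
       | TypeC => Rtt 1
       | TypeD => Rplus 2 1
       end.

Definition simple_refl (X : cartan) (i : nat) : int -> int :=
  refl (simple_root X i).

Definition word (X : cartan) (s : seq nat) : int -> int :=
  foldr (fun i f => simple_refl X i \o f) id s.

Definition weyl (X : cartan) (w : int -> int) : Prop :=
  match X with
  | TypeD => exists s, w =1 word TypeD s
  | _ => signed_perm w
  end.

Definition has_length (X : cartan) (w : int -> int) (k : nat) : Prop :=
  (exists2 s, size s = k & w =1 word X s) /\
  (forall s, w =1 word X s -> (k <= size s)%N).

(* The Bruhat order on the Weyl group. *)
Inductive bruhat (X : cartan) : (int -> int) -> (int -> int) -> Prop :=
| Bruhat_refl u v : u =1 v -> bruhat X u v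
| Bruhat_step u v w a k l :
    positive_root X a -> v =1 u \o refl a ->
    has_length X u k -> has_length X v l -> (k < l)%N ->
    bruhat X v w -> bruhat X u w.

(* u is the minimal length representative of the coset of the stabilizer of   *)
(* the empty partition that corresponds to l under w |-> w (emptySP).         *)
Definition min_rep (X : cartan) (l : SP) (u : int -> int) : Prop :=
  [/\ weyl X u, act X u emptySP = l
    & forall v k m, weyl X v -> act X v emptySP = l ->
        has_length X u k -> has_length X v m -> (k <= m)%N].

Definition leSP (X : cartan) (l m : SP) : Prop :=
  exists u v, [/\ min_rep X l u, min_rep X m v & bruhat X u v].

Definition ltSP (X : cartan) (l m : SP) : Prop := leSP X l m /\ l <> m.

Section FactorialGPGQ.

Variables (F : fieldType) (bt : F) (c : nat -> F).

(* The common shape of GP_l and GQ_l: fac y l_j is the factor attached to the *)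
(* part l_j.                                                                  *)
Definition symmetrized (fac : F -> nat -> F) (l : seq nat)
    (n : nat) (x : 'I_n -> F) : F :=
  ((n - size l)`!%:R)^-1 *
  \sum_(w : 'S_n)
    ((\prod_(j < n | (j < size l)%N) fac (x (w j)) (nth 0%N l j)) *
     \prod_(i < n | (i < size l)%N) \prod_(j < n | (i < j)%N)
       (oplus bt (x (w i)) (x (w j)) / ominus bt (x (w i)) (x (w j)))).

Definition GP (l : seq nat) (n : nat) (x : 'I_n -> F) : F :=
  symmetrized (fun y m => \prod_(1 <= k < m.+1) oplus bt y (c k)) l x.

Definition GQ (l : seq nat) (n : nat) (x : 'I_n -> F) : F :=
  symmetrized (fun y m => oplus bt y y * \prod_(1 <= k < m) oplus bt y (c k)) l x.

End FactorialGPGQ.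

Local Notation xpoly N := (mpoly.mpoly N K).

Definition constK (N : nat) (c : K) : {fraction (xpoly N)} :=
  (c%:MP_[N])%:F.

(* GX_l^(N) as a rational function of x_1, ..., x_N over K. *)
Definition GX (X : cartan) (N : nat) (l : SP) : {fraction (xpoly N)} :=
  let x := fun i : 'I_N => ('X_i : xpoly N)%:F in
  match X with
  | TypeB => GP (constK N beta)
               (fun k => if k == 1%N then 0 else constK N (b k.-1)) l x
  | TypeC => GQ (constK N beta) (fun k => constK N (b k)) l x
  | TypeD => GP (constK N beta) (fun k => constK N (b k)) l x
  end.

Definition is_polynomial (N : nat) (f : {fraction (xpoly N)}) : Prop :=
  exists P : xpoly N, P%:F = f.

(* The unique polynomial equal to f, if any: it can be evaluated also at      *)
(* points where denominators in the formula for f vanish.                     *)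
Definition to_poly (N : nat) (f : {fraction (xpoly N)}) : xpoly N :=
  epsilon (inhabits 0) (fun P : xpoly N => P%:F = f).

(* GX_l^(N) at x = (b_m, 0, ..., 0). *)
Definition GXval (X : cartan) (N : nat) (l m : SP) : K :=
  (to_poly (GX X N l)).@[fun i : 'I_N => nth 0 (bvec X m) i].

Definition parity_ok (X : cartan) (N : nat) : bool :=
  if X is TypeD then ~~ odd N else true.

(* The least N that is at least the lengths of l and b_m, and even in type D. *)
Definition least_N (X : cartan) (l m : SP) : nat :=
  let N := maxn (size l) (size (bvec X m)) in
  if X is TypeD then (N + odd N)%N else N.

Definition psi (X : cartan) (l m : SP) : K := GXval X (least_N X l m) l m.

Definition inPsi (X : cartan) (f : SP -> K) : Prop :=
  (forall m, inR (f m)) /\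
  (forall m a, positive_root X a ->
     exists2 r, inR r & f (act X (refl a) m) - f m = e a * r).

Definition divdiff (X : cartan) (i : nat) (f : SP -> K) (m : SP) : K :=
  let a := simple_root X i in
  (wact (refl a) (f (act X (refl a) m)) - (1 + beta * e a) * f m) / e a.

Definition schubert_classes (X : cartan) (f : SP -> SP -> K) : Prop :=
  [/\ forall l, inPsi X (f l),
      forall i l,
        (ltSP X (act X (simple_refl X i) l) l ->
           forall m, divdiff X i (f l) m = f (act X (simple_refl X i) l) m) /\
        (leSP X l (act X (simple_refl X i) l) ->
           forall m, divdiff X i (f l) m = - beta * f l m)
    & forall l, f l emptySP = (l == emptySP)%:R].

(* Main.v *)
(* In the coordinates Y = 1 + beta x one has (x (+) z)/(x (-) z) =            *)
(* Z (Y Z - 1)/(Y - Z), and symmetrizing over S_n becomes a sum [gsum] over   *)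
(* the list of the values of Y, defined by recursion on the parts.  Lagrange  *)
(* interpolation evaluates the sums of the products of these ratios (with the *)
(* weights 1, Y, Y^2 - 1); moreover a pair of values Y, Y^-1, and also an     *)
(* entry Y = 1 at which the first factor vanishes, may be dropped.  Since     *)
(* GX_l is a polynomial, identities need to be checked at generic points only.*)
(*   A simple reflection acts on psi_l(mu) through the parameters b and       *)
(* through the point b_mu.  By the cancellation of Y, Y^-1 the point is       *)
(* essentially unchanged, so that pi_i psi_l is a divided difference of GX_l  *)
(* in the parameters only; this can be computed from the factors of GX_l that *)
(* involve b_i and b_(i+1) (or b_1, b_2 for the special reflection), which    *)
(* gives (ii).  By (ii) the values psi_l(mu) are determined recursively from  *)
(* psi_l(empty), which shows that they lie in R and satisfy the divisibility  *)
(* condition for simple roots; conjugation by simple reflections carries the  *)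
(* condition to all positive roots.                                           *)

Require Import Defs.
From HB Require Import structures.
From Stdlib Require Import ClassicalEpsilon FunctionalExtensionality.
From mathcomp Require Import all_boot all_order all_algebra all_fingroup.
From mathcomp Require Import generic_quotient finmap.
From mathcomp Require Import ring zify.
From mathcomp.multinomials Require Import mpoly.
From mathcomp.multinomials Require monalg.

Set Implicit Arguments.
Unset Strict Implicit.
Unset Printing Implicit Defensive.

Import GRing.Theory.
Local Open Scope ring_scope.

(** * Symmetrization as a polynomial *)

(** Put Y = 1 + beta x and B_k = 1 + beta b_k. Then (+) becomes multiplication, the point b_mu
    becomes the list of the B_k^-1 for k in the code of mu, a coordinate x = 0 becomes Y = 1, and 1
    + beta e(alpha_i) is a Laurent monomial in the B_k. A part 1 with trivial factor may be appended
    in type D ([gsum_rcons1]), so the three functions become one sum [gsum] over the elements s of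
    the code, with factor g(Y) times the product over k < s of (Y B_k - 1)/beta, where g is (Y -
    1)/beta, (Y^2 - 1)/beta or 1 in types B, C, D. Multiplying by the Vandermonde product shows that
    GX is a polynomial ([symmetrized_poly]); [fval] is its value at an arbitrary list, and
    identities of [gsum] pass to [fval] by density ([fval_dense]).

    The heart is the recursion [vpsi_rec]: with e = e(alpha_i), s_i psi_l(s_i mu) = (1 + beta e)
    psi_l(mu) + e Z, where Z is psi_(s_i l)(mu) if l is i-removable and -beta psi_l(mu) otherwise.
    This is (ii) with its denominator cleared. On the left, s_i acts on the parameters and on the
    point. For i >= 1 the two permutations of the point cancel; for the special reflection,
    inserting or dropping pairs Y, Y^-1 ([fval_cancel]) always leaves the point of mu enlarged by
    B_1 (types B, C) or by B_1 and B_2 (type D). What remains is a change of parameters, which only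
    a few parts can see: [fval_swap_in] and [fval_swap_repeat] for i >= 1, [fval_reflect1_in] and
    [fval_reflect2_in] otherwise, the latter two resting on the Lagrange sums [sum_sqr_prod_rt],
    [sum_mul_prod_rt] and [sum_prod_rt].

    The rest is formal. For mu empty there are fewer points than parts unless l is empty, which is
    (iii). The recursion expresses psi_l(s_i mu) through values at mu, so all values lie in R by
    induction on the boxes of mu ([psi_R]). As s_i f - f is divisible by e(alpha_i) for f in R
    ([sigma_sub_mul]), divisibility holds for simple roots ([gkm_simple]), and conjugation by simple
    reflections spreads it to all positive roots ([gkm_conj]). The Bruhat conditions become
    removability because minimal representatives have as many letters as the partition has boxes
    ([min_rep_length]), and s_i removes a box exactly in the removable case ([wt_act]). *)

Section Vandermonde.

Variable R : comNzRingType.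

(** The coefficients do not depend on j: this makes a matrix of values f_i(x_j) factor through a
    triangular matrix. *)
Lemma newton_interpolation n (x : 'I_n -> R) (f : {poly R}) :
  exists c : 'I_n -> R, forall j,
    f.[x j] = \sum_(k < n) c k * \prod_(l < n | (l < k)%N) (x j - x l).
Proof.
elim: n x f => [|n IHn] x f; first by exists (fun=> 0) => -[].
have /factor_theorem[g fE] : root (f - f.[x ord0]%:P) (x ord0).
  by rewrite /root !hornerE subrr.
have [c cE] := IHn (fun j => x (lift ord0 j)) g.
exists (fun k => if unlift ord0 k is Some k' then c k' else f.[x ord0]) => j.
rewrite big_ord_recl unlift_none big1 ?mulr1 => [|l]; last by rewrite ltn0.
have -> : f.[x j] = f.[x ord0] + g.[x j] * (x j - x ord0).
  by move/(congr1 (fun p => p.[x j])): fE; rewrite !hornerE => <-; ring.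
congr (_ + _).
under eq_bigr => k _ do rewrite liftK big_mkcond big_ord_recl /= -big_mkcond /=.
have [j'|] := unliftP ord0 j => ->; last first.
  by rewrite subrr mulr0 big1 // => k _; rewrite mul0r mulr0.
rewrite cE mulr_suml; apply: eq_bigr => k _; rewrite -mulrA; congr (_ * _).
by rewrite mulrC; congr (_ * _); apply: eq_bigr => l _.
Qed.

Definition vdm n (x : 'I_n -> R) : R :=
  \prod_(k < n) \prod_(l < n | (l < k)%N) (x k - x l).

(** The matrix of values is the matrix of Newton coefficients times a triangular matrix whose
    diagonal has product [vdm x]. No division is involved, so this holds over any commutative
    ring. *)
Lemma det_horner_dvd n (x : 'I_n -> R) (f : 'I_n -> {poly R}) :
  exists d, \det (\matrix_(i, j) (f i).[x j]) = d * vdm x.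
Proof.
have /fin_all_exists[c cE] i := newton_interpolation x (f i).
pose L := \matrix_(k < n, j < n) \prod_(l < n | (l < k)%N) (x j - x l).
exists (\det (\matrix_(i, k) c i k)); rewrite (_ : vdm x = \det L).
  rewrite -det_mulmx; congr (\det _); apply/matrixP => i j; rewrite !mxE cE.
  by apply: eq_bigr => k _; rewrite !mxE.
rewrite -det_tr det_trig; first by apply: eq_bigr => k _; rewrite !mxE.
apply/is_trig_mxP => i j lt_ij; rewrite !mxE (bigD1 i) //= subrr mul0r //.
Qed.

End Vandermonde.

(** By linearity F may be a monomial, whose antisymmetrization is the determinant of a matrix of
    powers. *)
Lemma antisym_dvd (R : comNzRingType) n (F : {mpoly R[n]}) :
  exists P, \sum_(s : 'S_n) (-1) ^+ s * msym s F =
    P * \prod_(k < n) \prod_(l < n | (l < k)%N) ('X_k - 'X_l).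
Proof.
elim/mpolyind: F => [|c m p _ _ [P IHp]].
  by exists 0; rewrite mul0r big1 // => s _; rewrite msym0 mulr0.
have [d dE] := det_horner_dvd (fun i => 'X_i : {mpoly R[n]}) (fun i => 'X^(m i)).
exists (c *: d + P); rewrite mulrDl -IHp -scalerAl -[\prod_(_ < n) _]/(vdm _) -dE.
rewrite scaler_sumr -big_split /=; apply: eq_bigr => s _.
rewrite msymD mulrDr msymZ -scalerAr; congr (c *: (_ * _) + _).
by rewrite /msym mmapX; apply: eq_bigr => i _; rewrite mxE hornerXn.
Qed.

Lemma vdm_perm (F : comNzRingType) n (x : 'I_n -> F) (s : 'S_n) :
  \prod_(i < n) \prod_(j < n | (i < j)%N) (x (s j) - x (s i)) =
  (-1) ^+ s * \prod_(i < n) \prod_(j < n | (i < j)%N) (x j - x i).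
Proof.
have E (y : 'I_n -> F) : \prod_(i < n) \prod_(j < n | (i < j)%N) (y j - y i) =
    \det (Vandermonde n (\row_j y j)).
  by rewrite det_Vandermonde; do 2![apply: eq_bigr => ? _]; rewrite !mxE.
rewrite (E (x \o s)) E -odd_permV -det_perm mulrC -det_mulmx -col_permE.
by congr (\det _); apply/matrixP => i j; rewrite !mxE.
Qed.

(** Times the Vandermonde product, every summand becomes polynomial and the sum becomes an
    antisymmetrization, hence divisible by that product. One P serves all morphisms h that separate
    the variables: the embedding in the fraction field as well as evaluation at points with distinct
    coordinates. *)
Lemma symmetrized_poly (k : fieldType) (bt : k) (f : nat -> {poly k})
    (l : seq nat) n : (size l <= n)%N ->
  exists P : {mpoly k[n]}, forall (F : fieldType)
    (h : {rmorphism {mpoly k[n]} -> F}), injective (fun i => h 'X_i) ->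
    h P = symmetrized (h bt%:MP)
      (fun y m => (map_poly (h \o @mpolyC n k) (f m)).[y]) l (fun i => h 'X_i).
Proof.
move=> le_ln; set r := size l.
(* The ratio attached to (i, j), present only for i < r, multiplied by x_j - x_i; the denominator 1
   + bt x_j of (-) moves to the numerator. *)
pose num (i j : 'I_n) : {mpoly k[n]} := if (i < r)%N then
  - (('X_i + 'X_j + bt%:MP * 'X_i * 'X_j) * (1 + bt%:MP * 'X_j)) else 'X_j - 'X_i.
pose A := \prod_(j < n | (j < r)%N) (map_poly (@mpolyC n k) (f (nth 0%N l j))).['X_j]
  * \prod_(i < n) \prod_(j < n | (i < j)%N) num i j.
have [P PE] := antisym_dvd A.
exists (((n - r)`!%:R^-1)%:MP * P) => F h h_inj; set x := fun i => h 'X_i.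
pose V := \prod_(i < n) \prod_(j < n | (i < j)%N) (x j - x i).
have V0 : V != 0.
  apply/prodf_neq0 => i _; apply/prodf_neq0 => j lt_ij.
  by rewrite subr_eq0 (inj_eq h_inj) -val_eqE /= gtn_eqF.
apply: (mulIf V0); rewrite rmorphM -mulrA.
have -> : h P * V = h (P * \prod_(k < n) \prod_(l < n | (l < k)%N) ('X_k - 'X_l)).
  rewrite rmorphM; congr (_ * _).
  rewrite rmorph_prod /V (exchange_big_dep xpredT) //=; apply: eq_bigr => i _.
  by rewrite rmorph_prod; apply: eq_bigr => j _; rewrite rmorphB.
rewrite -PE /symmetrized -mulrA; congr (_ * _).
  by rewrite -[LHS]/((h \o @mpolyC n k) _) fmorphV rmorph_nat.
rewrite rmorph_sum mulr_suml; apply: eq_bigr => s _.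
have gA (g : {rmorphism {mpoly k[n]} -> F}) : (forall c, g c%:MP = h c%:MP) ->
    g A = (\prod_(j < n | (j < r)%N)
        (map_poly (h \o @mpolyC n k) (f (nth 0%N l j))).[g 'X_j]) *
      \prod_(i < n) \prod_(j < n | (i < j)%N) (if (i < r)%N then
        - (oplus (h bt%:MP) (g 'X_i) (g 'X_j) * (1 + h bt%:MP * g 'X_j))
        else g 'X_j - g 'X_i).
  move=> gC; rewrite rmorphM !rmorph_prod; congr (_ * _).
    apply: eq_bigr => j _; rewrite -horner_map /= -map_poly_comp; congr (_.[_]).
    by apply: eq_map_poly => c /=; rewrite gC.
  apply: eq_bigr => i _; rewrite rmorph_prod; apply: eq_bigr => j _.
  rewrite /num /oplus; case: ifP => _; last by rewrite rmorphB.
  by rewrite rmorphN !(rmorphM, rmorphD) gC rmorph1.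
have sX i : h (msym s 'X_i) = x (s i) by rewrite /msym mmapX mmap1U.
rewrite rmorphM rmorphXn rmorphN1.
rewrite (_ : V = (-1) ^+ s * \prod_(i < n) \prod_(j < n | (i < j)%N)
  (x (s j) - x (s i))); last by rewrite vdm_perm signrMK.
rewrite [RHS]mulrCA; congr (_ * _).
have /= -> := gA (h \o @msym n k s) (fun c => congr1 h (mmapC _ _ c)).
rewrite -!mulrA; congr (_ * _).
  by apply: eq_bigr => j _; rewrite sX.
rewrite [in RHS]big_mkcond -big_split /=; apply: eq_bigr => i _.
case: ifP => i_r; last first.
  by rewrite mul1r; apply: eq_bigr => j _; rewrite !sX.
rewrite -big_split /=; apply: eq_bigr => j lt_ij; rewrite !sX.
have ne : x (s i) - x (s j) != 0.
  by rewrite subr_eq0 (inj_eq h_inj) (inj_eq perm_inj) -val_eqE /= ltn_eqF.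
by rewrite /ominus invf_div -[x (s j) - x (s i)]opprB mulrN mulrA divfK.
Qed.

(** * Recursive form of the symmetrization *)

Lemma sum_perm_recl (V : nmodType) n (F : 'S_n.+1 -> V) :
  \sum_s F s = \sum_k \sum_(s : 'S_n) F (lift_perm ord0 k s).
Proof.
rewrite pair_big (reindex (fun u : 'I_n.+1 * 'S_n => lift_perm ord0 u.1 u.2)) //=.
apply: onW_bij; apply: inj_card_bij => [[i s] [j t] /= eq_st|]; last first.
  by rewrite card_prod card_ord !card_Sn factS leqnn.
have eq_ij : i = j by rewrite -(lift_perm_id ord0 i s) eq_st lift_perm_id.
congr (_, _) => //; apply/permP => k; apply: (@lift_inj _ i).
by rewrite -(lift_perm_lift ord0) eq_st eq_ij lift_perm_lift.
Qed.

Section GSum.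

Variable F : fieldType.
Implicit Types (f : nat -> F -> F) (l : seq nat) (ys : seq F).

Definition rt (y z : F) : F := z * (y * z - 1) / (y - z).

Fixpoint gsum f l ys : F :=
  if l is s :: l' then
    \sum_(y <- ys) f s y * (\prod_(z <- rem y ys) rt y z) * gsum f l' (rem y ys)
  else 1.

Lemma perm_rem_eq (T : eqType) (x : T) s1 s2 :
  perm_eq s1 s2 -> perm_eq (rem x s1) (rem x s2).
Proof.
move=> eq12; have [xs1|xs1] := boolP (x \in s1); last first.
  by rewrite !rem_id // -(perm_mem eq12).
rewrite -(perm_cons x) -(permPl (perm_to_rem xs1)) (permPl eq12).
by rewrite perm_to_rem // -(perm_mem eq12).
Qed.

Lemma gsum_perm f l ys zs : perm_eq ys zs -> gsum f l ys = gsum f l zs.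
Proof.
elim: l ys zs => //= s l IHl ys zs eq_yz; rewrite (perm_big _ eq_yz) /=.
apply: eq_bigr => y _; have eq_r := perm_rem_eq y eq_yz.
by rewrite (perm_big _ eq_r) (IHl _ _ eq_r).
Qed.

Lemma gsum_small f l ys : (size ys < size l)%N -> gsum f l ys = 0.
Proof.
elim: l ys => // s l IHl ys lt /=; rewrite big_seq big1 // => y yys.
by rewrite IHl ?mulr0 // size_rem //; case: ys yys lt.
Qed.

Lemma eq_gsum f f' l ys : {in l, forall s, {in ys, f s =1 f' s}} ->
  gsum f l ys = gsum f' l ys.
Proof.
elim: l ys => //= s l IHl ys eq_f; apply: eq_big_seq => y yys.
rewrite eq_f ?mem_head //; congr (_ * _); apply: IHl => t tl z zys.
by apply: eq_f; [rewrite inE tl orbT|exact: mem_rem zys].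
Qed.

Variable bt : F.
Hypothesis bt0 : bt != 0.

Lemma oplus_ominus_rt x z :
  oplus bt x z / ominus bt x z = rt (1 + bt * x) (1 + bt * z).
Proof.
rewrite /oplus /ominus /rt invf_div.
have -> : 1 + bt * x - (1 + bt * z) = bt * (x - z) by ring.
rewrite invfM !mulrA; congr (_ / _).
by apply: (mulIf bt0); rewrite mulfVK //; ring.
Qed.

(** Summing over the image of the first index peels off the first part; when no part is left, (n -
    r)! equal terms remain and cancel the prefactor. *)
Lemma symmetrized_gsum (fac : F -> nat -> F) l n (x : 'I_n -> F) :
    (size l <= n)%N -> (forall m, m.+1%:R != 0 :> F) -> injective x ->
  symmetrized bt fac l x =
  gsum (fun s y => fac ((y - 1) / bt) s) l [seq 1 + bt * x i | i <- enum 'I_n].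
Proof.
move=> le_ln char0 x_inj; rewrite /symmetrized.
have fact0 m : m`!%:R != 0 :> F by rewrite -(prednK (fact_gt0 m)).
apply: (mulfI (fact0 (n - size l)%N)); rewrite mulVKf //.
elim: l n x le_ln x_inj => [|s l IHl] n x /= le_ln x_inj.
  under eq_bigr => w _ do rewrite !big_pred0_eq mulr1.
  by rewrite sumr_const subn0 mulr1 card_Sn.
case: n x le_ln x_inj => // n x le_ln x_inj.
rewrite sum_perm_recl subSS.
set Y := fun i => 1 + bt * x i.
have Yinj : injective Y by move=> i j /addrI /(mulfI bt0) /x_inj.
rewrite big_map big_enum mulr_sumr; apply: eq_bigr => k _.
have xkE : (Y k - 1) / bt = x k by rewrite /Y addrAC subrr add0r mulrC mulKf.
have remE : perm_eq (rem (Y k) [seq Y i | i <- enum 'I_n.+1])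
    [seq Y (lift k i) | i <- enum 'I_n].
  have uY : uniq [seq Y i | i <- enum 'I_n.+1] by rewrite map_inj_uniq ?enum_uniq.
  apply: uniq_perm; rewrite ?rem_uniq //.
    by rewrite map_inj_uniq ?enum_uniq // => i j /Yinj /lift_inj.
  move=> y; rewrite mem_rem_uniq // inE.
  apply/andP/mapP => [[yk /mapP[i _ yE]]|[i _ ->]]; last first.
    by rewrite (inj_eq Yinj) eq_sym neq_lift map_f ?mem_enum.
  have [j iE|ik] := unliftP k i; last by rewrite yE ik eqxx in yk.
  by exists j; rewrite ?mem_enum // yE iE.
rewrite (gsum_perm _ _ remE) (perm_big _ remE) /= xkE.
have xk_inj : injective (x \o lift k) by move=> i j /x_inj /lift_inj.
rewrite mulrCA -(IHl _ (x \o lift k)) // big_map big_enum /= mulr_sumr.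
apply: eq_bigr => w _.
rewrite [in LHS]big_mkcond [in LHS]big_ord_recl /= lift_perm_id -!mulrA.
congr (_ * _).
rewrite [X in _ * X = _]big_mkcond [X in _ * X = _]big_ord_recl /= mulrCA; congr (_ * _).
  rewrite big_mkcond big_ord_recl /= mul1r lift_perm_id.
  rewrite [RHS](reindex_inj (@perm_inj _ w)) /=; apply: eq_bigr => i _.
  by rewrite lift_perm_lift oplus_ominus_rt.
congr (_ * _).
  rewrite [RHS]big_mkcond; apply: eq_bigr => i _.
  by rewrite lift_perm_lift ltnS.
rewrite [RHS]big_mkcond; apply: eq_bigr => i _; rewrite ltnS; case: ifP => // _.
rewrite big_mkcond big_ord_recl /= mul1r [RHS]big_mkcond; apply: eq_bigr => j _.
by rewrite !lift_perm_lift ltnS.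
Qed.

End GSum.

(** * Lagrange interpolation and sums of products of ratios *)

Section RationalSums.

Variable F : fieldType.
Implicit Types (f : nat -> F -> F) (l : seq nat) (ys : seq F) (h : {poly F}).

Lemma big_rem_cons (V : nmodType) (Phi : F -> seq F -> V) a ys : a \notin ys ->
  \sum_(y <- a :: ys) Phi y (rem y (a :: ys)) =
  Phi a ys + \sum_(y <- ys) Phi y (a :: rem y ys).
Proof.
move=> ays; rewrite big_cons /= eqxx; congr (_ + _).
by apply: eq_big_seq => y yys; rewrite eq_sym (negbTE (memPn ays y yys)).
Qed.

(** The interpolation polynomial of h at the nodes ys is h itself by the degree bound; compare the
    coefficients of degree [(size ys).-1]. *)
Lemma lagrange_sum ys h : uniq ys -> (size h <= size ys)%N ->
  \sum_(y <- ys) h.[y] / (\prod_(z <- rem y ys) (y - z)) = h`_(size ys).-1.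
Proof.
move=> uys le_h; pose c y := h.[y] / (\prod_(z <- rem y ys) (y - z)).
pose L := \sum_(y <- ys) c y *: \prod_(z <- rem y ys) ('X - z%:P).
have szP y : y \in ys -> size (\prod_(z <- rem y ys) ('X - z%:P)) = size ys.
  by move=> yys; rewrite size_prod_XsubC size_rem // prednK //; case: (ys) yys.
have szL : (size L <= size ys)%N.
  rewrite /L big_seq; apply: (big_ind (fun p : {poly F} => size p <= size ys)%N).
  - by rewrite size_poly0.
  - by move=> p q sp sq; rewrite (leq_trans (size_polyD _ _)) // geq_max sp.
  by move=> y yys; rewrite (leq_trans (size_scale_leq _ _)) // szP.
have Lh : L = h.
  apply/eqP; rewrite -subr_eq0; apply: contraTT isT => nz.
  have /= := max_poly_roots nz _ uys; rewrite ltnNge.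
  rewrite (leq_trans (size_polyD _ _)) ?geq_max ?szL ?size_polyN //= => -> //.
  apply/allP => w wys; rewrite /root hornerD hornerN subr_eq0 horner_sum.
  rewrite (perm_big _ (perm_to_rem wys)) /= big_cons hornerZ.
  have -> : (\prod_(z <- rem w ys) ('X - z%:P)).[w] = \prod_(z <- rem w ys) (w - z).
    by rewrite horner_prod; apply: eq_bigr => z _; rewrite hornerXsubC.
  rewrite [X in _ + X]big_seq [X in _ + X]big1 ?addr0 => [|y yr].
    rewrite /c divfK //; rewrite prodf_seq_neq0; apply/allP => z; rewrite mem_rem_uniq // inE.
    by case/andP=> zw _; rewrite subr_eq0 eq_sym.
  move: yr; rewrite mem_rem_uniq // inE => /andP[yw yys].
  have wr : w \in rem y ys by rewrite mem_rem_uniq // inE eq_sym yw.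
  by rewrite hornerZ horner_prod (big_rem w) //= hornerXsubC subrr mul0r mulr0.
rewrite -[in RHS]Lh coef_sum; apply: eq_big_seq => y yys.
rewrite coefZ -[LHS]mulr1; congr (_ * _); rewrite -(szP y yys) -/(lead_coef _).
by apply/esym/monicP/monic_prod_XsubC.
Qed.

Lemma prodfN1 ys (g : F -> F) :
  \prod_(z <- ys) - g z = (-1) ^+ size ys * \prod_(z <- ys) g z.
Proof.
elim: ys => [|y ys IHys]; first by rewrite !big_nil mul1r.
by rewrite !big_cons IHys exprS; ring.
Qed.

Section Identities.

Variable ys : seq F.
Hypothesis uys : uniq [:: 0, 1, -1 & ys].

Let h := \prod_(z <- ys) (z *: 'X - 1).
Let p := \prod_(z <- ys) z.
Let D y := \prod_(z <- ys) (y - z).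

Let szh : (size h <= (size ys).+1)%N /\ h`_(size ys) = p.
Proof.
rewrite /h /p; elim: ys => [|y s [IHs IHc]]; first by rewrite !big_nil size_poly1 coef1.
rewrite !big_cons mulrBl mul1r -scalerAl coefB coefZ coefXM /= IHc.
rewrite [_`_(size s).+1]nth_default // subr0; split=> //.
rewrite (leq_trans (size_polyD _ _)) // geq_max size_polyN (leq_trans IHs) // andbT.
by rewrite (leq_trans (size_scale_leq _ _)) // (leq_trans (size_polyMleq _ _)) // size_polyX.
Qed.

Let hE y : h.[y] = \prod_(z <- ys) (y * z - 1).
Proof.
by rewrite horner_prod; apply: eq_bigr => z _; rewrite !hornerE mulrC.
Qed.

Let p0 : p != 0.
Proof.
rewrite prodf_seq_neq0; apply/allP => z zys; apply: contraTneq uys => z0.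
by rewrite /= !inE -z0 zys !orbT.
Qed.

Let D_neq0 y : y \notin ys -> D y != 0.
Proof.
move=> yys; rewrite prodf_seq_neq0; apply/allP => z zys; rewrite subr_eq0.
by apply: contraNneq yys => ->.
Qed.

Let uP : [/\ 0 \notin ys, 1 \notin ys, -1 \notin ys, uniq ys & (2 : F) != 0].
Proof.
move: uys; rewrite /= !inE !negb_or => /and4P[/and3P[_ _ ->] /andP[n1 ->] -> ->].
by rewrite -subr_eq0 opprK in n1.
Qed.

Let nz y : y \in ys ->
  [/\ y != 0, y - 1 != 0, y + 1 != 0 & \prod_(z <- rem y ys) (y - z) != 0].
Proof.
have [n0 n1 nN1 u _] := uP => yys; rewrite subr_eq0 addr_eq0; split.
- by apply: contraNneq n0 => <-.
- by apply: contraNneq n1 => <-.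
- by apply: contraNneq nN1 => <-.
rewrite prodf_seq_neq0; apply/allP => z; rewrite mem_rem_uniq // inE.
by case/andP=> zw _; rewrite subr_eq0 eq_sym.
Qed.

(** The poles at 0, 1 and -1 appear here. Each of the three sums below is Lagrange interpolation of
    h on ys together with those among the nodes 0, 1, -1 that its weight does not cancel. *)
Let prod_rtE y : y \in ys ->
  \prod_(z <- rem y ys) rt y z =
  p * h.[y] / (y * (y - 1) * (y + 1) * \prod_(z <- rem y ys) (y - z)).
Proof.
move=> yys; have [y0 y1 yN1 d0] := nz yys.
rewrite hE /p !(big_rem y yys) /= !big_split /= prodfV.
by field; rewrite d0 y1 yN1 y0.
Qed.

Let sign0 : (-1) ^+ size ys != 0 :> F.
Proof. by rewrite signr_eq0. Qed.

Let D0 : D 0 = (-1) ^+ size ys * p.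
Proof. by rewrite -prodfN1; apply: eq_bigr => z _; rewrite sub0r. Qed.

Let h0 : h.[0] = (-1) ^+ size ys.
Proof.
rewrite hE; under eq_bigr => z _ do rewrite mul0r sub0r.
by rewrite (prodfN1 _ (fun=> 1)) big1 // mulr1.
Qed.

Let h1 : h.[1] = (-1) ^+ size ys * D 1.
Proof. by rewrite hE -prodfN1; apply: eq_bigr => z _; rewrite mul1r opprB. Qed.

Let hN1 : h.[-1] = D (-1).
Proof. by rewrite hE; apply: eq_bigr => z _; rewrite mulN1r addrC. Qed.

(** The weight cancels the poles at 1 and -1, so only the node 0 is adjoined, and the top
    coefficient is p. *)
Lemma sum_sqr_prod_rt :
  \sum_(y <- ys) (y ^+ 2 - 1) * \prod_(z <- rem y ys) rt y z = p ^+ 2 - 1.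
Proof.
have [n0 n1 nN1 u two] := uP.
have u0 : uniq (0 :: ys) by rewrite /= n0.
have /= := lagrange_sum u0 szh.1; rewrite szh.2.
rewrite (big_rem_cons (fun y s => h.[y] / \prod_(z <- s) (y - z))) // -/(D 0) h0 D0.
set S := \sum_(y <- ys) _ => E; rewrite -[LHS](mulfVK p0); set T := (X in X * p).
have -> : T = S; last first.
  have -> : S = p - p^-1.
    by move/(canRL (addKr _)): E => ->; move: ((-1) ^+ _) sign0 => sg sg0; field; rewrite p0 sg0.
  by field.
rewrite /T /S mulr_suml; apply: eq_big_seq => y yys; rewrite big_cons subr0 prod_rtE //.
have [y0 y1 yN1 d0] := nz yys.
by field; rewrite d0 y1 yN1 y0 p0.
Qed.

(** The weight cancels the pole at 0; the parity comes from the nodes 1 and -1, where h equals D up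
    to the sign (-1)^(size ys), respectively exactly. *)
Lemma sum_mul_prod_rt :
  \sum_(y <- ys) y * \prod_(z <- rem y ys) rt y z = if odd (size ys) then p else 0.
Proof.
have [n0 n1 nN1 u two] := uP.
have u1 : uniq [:: 1, -1 & ys] by case/andP: uys.
have := lagrange_sum u1 (leqW szh.1); rewrite [RHS]nth_default ?szh.1 //.
rewrite (big_rem_cons (fun y s => h.[y] / \prod_(z <- s) (y - z))); last by case/andP: u1.
rewrite (big_rem_cons (fun y s => h.[y] / \prod_(z <- 1 :: s) (y - z))) //.
rewrite !big_cons -/(D 1) -/(D (-1)) h1 hN1.
set S := \sum_(y <- ys) _ => E; rewrite -[LHS](mulfVK p0); set T := (X in X * p).
have -> : T = S; last first.
  have -> : S = (1 - (-1) ^+ size ys) / 2.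
    move/(canRL (addKr _)): E => E; move/(canRL (addKr _)): E => ->.
    move: ((-1) ^+ _) => sg; by field; rewrite oppr_eq0 two !D_neq0.
  by rewrite -[(-1) ^+ size ys]signr_odd; case: odd; rewrite ?expr1 ?expr0; field.
rewrite /T /S mulr_suml; apply: eq_big_seq => y yys; rewrite !big_cons opprK prod_rtE //.
have [y0 y1 yN1 d0] := nz yys.
by field; rewrite d0 y1 yN1 y0 p0.
Qed.

Lemma sum_prod_rt :
  \sum_(y <- ys) \prod_(z <- rem y ys) rt y z = if odd (size ys) then 1 else 1 - p.
Proof.
have [n0 n1 nN1 u two] := uP.
have := lagrange_sum uys (leqW (leqW szh.1)).
rewrite [RHS]nth_default ?(leqW szh.1) //.
rewrite (big_rem_cons (fun y s => h.[y] / \prod_(z <- s) (y - z))); last by case/andP: uys.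
rewrite (big_rem_cons (fun y s => h.[y] / \prod_(z <- 0 :: s) (y - z))); last by case/and3P: uys.
rewrite (big_rem_cons (fun y s => h.[y] / \prod_(z <- [:: 0, 1 & s]) (y - z))) //.
rewrite !big_cons -/(D 0) -/(D 1) -/(D (-1)) h0 D0 h1 hN1.
set S := \sum_(y <- ys) _ => E; rewrite -[LHS](mulfVK p0); set T := (X in X * p).
have -> : T = S; last first.
  have -> : S = p^-1 - (1 + (-1) ^+ size ys) / 2.
    do 3!move/(canRL (addKr _)): E => E; rewrite E.
    move: ((-1) ^+ _) sign0 => sg sg0; by field; rewrite !oppr_eq0 oner_eq0 two p0 sg0 !D_neq0.
  by rewrite -[(-1) ^+ size ys]signr_odd; case: odd; rewrite ?expr1 ?expr0; field; rewrite ?two ?p0.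
rewrite /T /S mulr_suml; apply: eq_big_seq => y yys; rewrite !big_cons subr0 opprK prod_rtE //.
have [y0 y1 yN1 d0] := nz yys.
by field; rewrite d0 y1 yN1 y0 p0.
Qed.

End Identities.

End RationalSums.

(** * Behaviour of [gsum] under changes of points and parameters *)

Section GSumIdentities.

Variable F : fieldType.
Implicit Types (f : nat -> F -> F) (l t : seq nat) (ys zs : seq F) (q e : F).

Lemma rem_cat (T : eqType) (x : T) s1 s2 :
  rem x (s1 ++ s2) = if x \in s1 then rem x s1 ++ s2 else s1 ++ rem x s2.
Proof.
elim: s1 => //= y s1 IHs; rewrite inE eq_sym; case: (x == y) => //=.
by rewrite IHs; case: (x \in s1).
Qed.

(* New variables [aa] may be dropped as long as they cannot be used by the     *)
(* parts in [l]; the parts in the tails are left to the last hypothesis.       *)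
Lemma gsum_prefix f f' q e aa l t t1 t2 ys : uniq (aa ++ ys) ->
    {in l, forall s,
       {in aa, forall a, f' s a * \prod_(z <- rem a aa) rt a z = 0} /\
       {in ys, forall y, f' s y * \prod_(a <- aa) rt y a = f s y}} ->
    (forall zs, uniq zs -> {subset zs <= ys} -> size ys = (size l + size zs)%N ->
       gsum f' t (aa ++ zs) = q * gsum f t1 zs + e * gsum f t2 zs) ->
  gsum f' (l ++ t) (aa ++ ys) =
  q * gsum f (l ++ t1) ys + e * gsum f (l ++ t2) ys.
Proof.
elim: l ys => [|s l IHl] ys u fl ft /=.
  by apply: ft; [move: u; rewrite cat_uniq => /and3P[]|..].
have [fa fy] := fl s (mem_head _ _).
have [_ dis uys] : [/\ uniq aa, {in ys, forall y, y \notin aa} & uniq ys].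
  by move: u; rewrite cat_uniq -all_predC => /and3P[-> /allP ? ->].
rewrite big_cat /= big_seq big1 ?add0r => [|a aaa]; last first.
  by rewrite rem_cat aaa big_cat /= mulrA fa // !mul0r.
rewrite !mulr_sumr -big_split /=; apply: eq_big_seq => y yys.
rewrite rem_cat (negbTE (dis y yys)) big_cat /= mulrA fy // (IHl (rem y ys)) //.
- by rewrite mulrDr; congr (_ + _); rewrite mulrCA.
- move: u; rewrite !cat_uniq rem_uniq // => /and3P[-> H _]; rewrite andbT /=.
  by apply: contra H => /hasP[z /mem_rem zys zaa]; apply/hasP; exists z.
- move=> s' s'l; have [fa' fy'] := fl s' (mem_behead (s := s :: l) s'l).
  by split=> // z /mem_rem; apply: fy'.
move=> zs uzs sub szE; apply: ft => // [z /sub /mem_rem //|].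
by rewrite addSn -szE size_rem // prednK //; case: (ys) yys.
Qed.

Lemma gsum_prefix_eq f f' aa l t t1 ys : uniq (aa ++ ys) ->
    {in l, forall s,
       {in aa, forall a, f' s a * \prod_(z <- rem a aa) rt a z = 0} /\
       {in ys, forall y, f' s y * \prod_(a <- aa) rt y a = f s y}} ->
    (forall zs, uniq zs -> {subset zs <= ys} -> size ys = (size l + size zs)%N ->
       gsum f' t (aa ++ zs) = gsum f t1 zs) ->
  gsum f' (l ++ t) (aa ++ ys) = gsum f (l ++ t1) ys.
Proof.
move=> u fl ft; rewrite (@gsum_prefix f f' 1 0 _ _ _ t1 [::]) // => [|zs *].
  by rewrite mul1r mul0r addr0.
by rewrite mul1r mul0r addr0 ft.
Qed.

Lemma sum_antisym_eq0 (V : zmodType) (T : eqType) (A : T -> T -> V) (s : seq T) :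
  uniq s -> {in s &, forall y w, y != w -> A y w = - A w y} ->
  \sum_(y <- s) \sum_(w <- rem y s) A y w = 0.
Proof.
elim: s => [|a s IHs] /=; first by rewrite big_nil.
case/andP=> as_ us antiA; rewrite big_cons eqxx.
under [X in _ + X]eq_big_seq => y ys.
  rewrite (negbTE (_ : a != y)) ?big_cons; last by apply: contraNneq as_ => ->.
  over.
rewrite big_split /= IHs ?addr0 // -?big_split /=; last first.
  by move=> y w ys ws; apply: antiA; rewrite inE ?ys ?ws orbT.
rewrite big_seq big1 // => y ys; rewrite antiA ?addNr ?mem_head ?inE ?ys ?orbT //.
by apply: contraNneq as_ => ->.
Qed.

Lemma rem_rem (T : eqType) (x y : T) s : uniq s -> rem x (rem y s) = rem y (rem x s).
Proof.
move=> us; rewrite !(rem_filter _ (filter_uniq _ us), rem_filter _ us).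
by rewrite -!filter_predI; apply: eq_filter => z /=; rewrite andbC.
Qed.

Variable bt : F.
Hypothesis bt0 : bt != 0.

(* Two equal adjacent parts: the summand becomes antisymmetric in the two      *)
(* variables once the multiple [- bt] of the strict one is subtracted.         *)
Lemma gsum_repeat f a l c ys : uniq ys ->
    (forall y, f a.+1 y = f a y * ((y * c - 1) / bt)) ->
  gsum f [:: a, a & l] ys = - bt * gsum f [:: a.+1, a & l] ys.
Proof.
move=> uys fS; apply/eqP; rewrite mulNr -addr_eq0 /=; apply/eqP.
rewrite mulr_sumr -big_split /=.
pose A y w := c * y * rt y w * (f a y * f a w * \prod_(z <- rem w (rem y ys)) rt y z
  * \prod_(z <- rem w (rem y ys)) rt w z * gsum f l (rem w (rem y ys))).
transitivity (\sum_(y <- ys) \sum_(w <- rem y ys) A y w); last first.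
  apply: sum_antisym_eq0 => // y w yys wys yw.
  rewrite /A (rem_rem y w) // /rt -[w - y]opprB invrN; ring.
apply: eq_big_seq => y yys; rewrite !mulr_sumr -big_split /=.
apply: eq_big_seq => w wr; rewrite fS /A (big_rem w wr) /=; field.
exact: bt0.
Qed.

(** Keeps ys away from the extra interpolation nodes; it also forces 1 and -1 to differ, so that 2
    is invertible. *)
Definition generic ys := uniq [:: 0, 1, -1 & ys].

Lemma generic_uniq ys : generic ys -> uniq ys.
Proof. by case/and4P. Qed.

Lemma generic_neq0 ys z : generic ys -> z \in ys -> z != 0.
Proof.
by case/andP; rewrite !inE !negb_or => /and3P[_ _ n0] _ zys; apply: contraNneq n0 => <-.
Qed.

Lemma generic_sub ys zs : generic ys -> uniq zs -> {subset zs <= ys} -> generic zs.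
Proof.
rewrite /generic /= !inE !negb_or => /and4P[/and3P[-> -> n0] /andP[-> n1] nN1 _] uzs sub.
by rewrite uzs (contra (sub 0) n0) (contra (sub 1) n1) (contra (sub _) nN1).
Qed.

(** No part can use c or c^-1, since the ratio of c and c^-1 vanishes in either order; for any other
    y the ratios with c and with c^-1 have product 1. *)
Lemma gsum_cancel f l c ys : uniq [:: c, c^-1 & ys] -> c != 0 ->
  gsum f l [:: c, c^-1 & ys] = gsum f l ys.
Proof.
move=> u c0; rewrite -[in LHS](cats0 l) -[in RHS](cats0 l).
apply: (@gsum_prefix_eq f f [:: c; c^-1]) => // s _.
move: u; rewrite /= !inE !negb_or => /and3P[/andP[cV cys] Vys _].
split=> [a|y yys].
  rewrite !inE; case/pred2P=> -> /=; rewrite ?eqxx ?(negbTE cV) big_seq1 /rt ?mulfV ?mulVf //.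
    by rewrite subrr mulr0 mul0r mulr0.
  by rewrite subrr mulr0 mul0r mulr0.
rewrite !big_cons big_nil mulr1 -[RHS]mulr1; congr (_ * _).
have yc : y - c != 0 by rewrite subr_eq0; apply: contraNneq cys => <-.
have yV : y * c - 1 != 0.
  rewrite subr_eq0; apply: contraNneq Vys => /(canRL (mulfK c0)).
  by rewrite mul1r => <-.
by rewrite /rt; field; rewrite c0 yc yV.
Qed.

Lemma gsum_cons1 f l ys : uniq (1 :: ys) -> {in l, forall s, f s 1 = 0} ->
  gsum f l (1 :: ys) = gsum f l ys.
Proof.
move=> u f1; rewrite -[in LHS](cats0 l) -[in RHS](cats0 l).
apply: (@gsum_prefix_eq f f [:: 1]) => // s sl.
split=> [a|y yys]; first by rewrite inE => /eqP->; rewrite f1 ?mul0r.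
rewrite big_seq1 /rt !mulr1 mul1r divff ?mulr1 // subr_eq0.
by case/andP: u => ys1 _; apply: contraNneq ys1 => <-.
Qed.

(** After the parts in l an odd number of variables is left, and the trailing part contributes
    [sum_prod_rt], which is then 1. This allows codes of even size in type D. *)
Lemma gsum_rcons1 f l ys : generic ys -> (forall y, f 1%N y = 1) ->
    odd (size l) != odd (size ys) ->
  gsum f (rcons l 1%N) ys = gsum f l ys.
Proof.
move=> gys f1 par; rewrite -cats1.
rewrite -[in RHS](cats0 l).
apply: (@gsum_prefix_eq f f [::]) => [|s _|zs uzs sub szE].
- exact: generic_uniq.
- by split=> // y _; rewrite big_nil mulr1.
rewrite /=.
under [LHS]eq_bigr => y _ do rewrite f1 mul1r mulr1.
rewrite sum_prod_rt; last exact: generic_sub sub.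
by move: par; rewrite szE oddD; do 2!case: odd.
Qed.

(** The common form of the factors in all three types; s is an element of the code, hence one more
    than the part in type D. *)
Definition fac (g : F -> F) (C : nat -> F) (s : nat) (y : F) : F :=
  g y * \prod_(1 <= k < s) ((y * C k - 1) / bt).

Lemma fac1 g C y : fac g C 1 y = g y.
Proof. by rewrite /fac big_geq // mulr1. Qed.

Lemma facS g C s y : (0 < s)%N -> fac g C s.+1 y = fac g C s y * ((y * C s - 1) / bt).
Proof. by move=> s0; rewrite /fac big_nat_recr //= mulrA. Qed.

Lemma eq_fac g C C' s y : (forall k, (0 < k < s)%N -> C k = C' k) ->
  fac g C s y = fac g C' s y.
Proof. by move=> eqC; congr (_ * _); apply: eq_big_nat => k /eqC ->. Qed.

Section Swap.

Variables (g : F -> F) (C C' : nat -> F) (i : nat) (e : F).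
Hypotheses (i_gt0 : (0 < i)%N) (C'i : C' i = C i.+1) (C'Si : C' i.+1 = C i).
Hypothesis C'E : forall k, k != i -> k != i.+1 -> C' k = C k.
Hypothesis CSi : C i.+1 = (1 + bt * e) * C i.

(** The factor of s contains the parameters of index below s: both exchanged ones or neither, unless
    s = i+1. *)
Lemma fac_swap s y : s != i.+1 -> fac g C' s y = fac g C s y.
Proof.
move=> sSi; have eqi m : (m <= i)%N -> fac g C' m y = fac g C m y.
  by move=> mi; apply: eq_fac => k km; apply: C'E; apply/eqP; lia.
have [/eqi //|lt_is] := leqP s i.
have {lt_is sSi} [d ->] : exists d, s = (d + i.+2)%N by exists (s - i.+2)%N; lia.
elim: d => [|d IHd]; last first.
  by rewrite addSn !facS ?IHd ?C'E //; first [lia | apply/eqP; lia].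
by rewrite add0n !facS // eqi // C'i C'Si mulrAC.
Qed.

Lemma fac_swapS y :
  fac g C' i.+1 y = (1 + bt * e) * fac g C i.+1 y + e * fac g C i y.
Proof.
rewrite !facS // (@eq_fac g C' C); last by move=> k ki; apply: C'E; apply/eqP; lia.
by rewrite C'i CSi; field.
Qed.

Lemma gsum_swap_notin l ys : i.+1 \notin l ->
  gsum (fac g C') l ys = gsum (fac g C) l ys.
Proof.
move=> il; apply: eq_gsum => s sl y _; apply: fac_swap.
by apply: contraNneq il => <-.
Qed.

Lemma gsum_swap_in l1 l2 ys : uniq ys -> i.+1 \notin l1 -> i.+1 \notin l2 ->
  gsum (fac g C') (l1 ++ i.+1 :: l2) ys =
  (1 + bt * e) * gsum (fac g C) (l1 ++ i.+1 :: l2) ys +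
  e * gsum (fac g C) (l1 ++ i :: l2) ys.
Proof.
move=> uys il1 il2; apply: (@gsum_prefix _ _ _ _ [::]) => // [s sl|zs _ _ _] /=.
  split=> // y _; rewrite big_nil mulr1 fac_swap //.
  by apply: contraNneq il1 => <-.
rewrite !mulr_sumr -big_split /=; apply: eq_bigr => y _.
by rewrite fac_swapS gsum_swap_notin //; ring.
Qed.

(** Lowering i+1 produces two equal parts i, i, which by [gsum_repeat] amount to -bt times the
    original sum; so the coefficients 1 + bt e and - bt e add up to 1. *)
Lemma gsum_swap_repeat l1 l2 ys : uniq ys -> i.+1 \notin l1 -> i.+1 \notin l2 ->
  gsum (fac g C') (l1 ++ [:: i.+1, i & l2]) ys =
  gsum (fac g C) (l1 ++ [:: i.+1, i & l2]) ys.
Proof.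
move=> uys il1 il2; rewrite gsum_swap_in //; last first.
  by rewrite inE negb_or il2 andbT; apply/eqP; lia.
have -> : gsum (fac g C) (l1 ++ [:: i, i & l2]) ys =
    - bt * gsum (fac g C) (l1 ++ [:: i.+1, i & l2]) ys; last by ring.
rewrite (@gsum_prefix (fac g C) (fac g C) (- bt) 0 [::] l1 _ [:: i.+1, i & l2] [::]) //.
- by rewrite mul0r addr0.
- by move=> s sl; split=> // y _; rewrite big_nil mulr1.
move=> zs uzs _ _; rewrite mul0r addr0.
by apply: gsum_repeat => // y; apply: facS.
Qed.

End Swap.

Lemma sum_affine_rt c ys : generic ys ->
  \sum_(y <- ys) (y * c - 1) / bt * \prod_(z <- rem y ys) rt y z =
  if odd (size ys) then (c * \prod_(z <- ys) z - 1) / bt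
  else (\prod_(z <- ys) z - 1) / bt.
Proof.
move=> gys; transitivity (\sum_(y <- ys) (c / bt * (y * \prod_(z <- rem y ys) rt y z) -
    bt^-1 * \prod_(z <- rem y ys) rt y z)); first by apply: eq_bigr => y _; ring.
rewrite big_split /= sumrN -!mulr_sumr sum_mul_prod_rt // sum_prod_rt //.
by case: odd; ring.
Qed.

Lemma gsum_single1 f ys : generic ys -> odd (size ys) -> (forall y, f 1%N y = 1) ->
  gsum f [:: 1%N] ys = 1.
Proof. by move=> gys par f1; rewrite (@gsum_rcons1 f [::]) //= par. Qed.

(** The ratio with an extra variable c turns the parameter c^-1 into c. *)
Lemma rt_inv_factor y c : c != 0 -> y != c ->
  (y * c^-1 - 1) / bt * rt y c = (y * c - 1) / bt.
Proof. move=> c0; rewrite -subr_eq0 => yc; by rewrite /rt; field; rewrite c0 bt0 yc. Qed.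

Section ReflectOne.

Variables (p : nat) (C C' : nat -> F).
Hypothesis p12 : (p == 1%N) || (p == 2%N).
Hypotheses (C'1 : C' 1%N = (C 1%N)^-1) (C'E : forall k, (1 < k)%N -> C' k = C k).

Let g y := (y ^+ p - 1) / bt.

Lemma sum_expr_rt ys : generic ys ->
  \sum_(y <- ys) g y * \prod_(z <- rem y ys) rt y z =
  ((\prod_(z <- ys) z) ^+ p - 1) / bt.
Proof.
move=> gys; case/pred2P: p12 => pE.
  have := sum_affine_rt 1 gys; rewrite mul1r if_same /g pE expr1 => <-.
  by apply: eq_bigr => y _; rewrite mulr1 expr1.
rewrite pE -sum_sqr_prod_rt // mulr_suml; apply: eq_bigr => y _.
by rewrite /g pE mulrAC.
Qed.

(** A part at least 2 has a factor with parameter (C 1)^-1: it vanishes at the extra variable C 1,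
    and elsewhere absorbs the ratio with C 1 by [rt_inv_factor]. Only the tail t notices the
    change. *)
Lemma gsum_reflect1 l t t1 t2 q e ys : generic (C 1%N :: ys) -> all (leq 2) l ->
  (forall zs, uniq zs -> {subset zs <= ys} -> size ys = (size l + size zs)%N ->
    gsum (fac g C') t (C 1%N :: zs) =
    q * gsum (fac g C) t1 zs + e * gsum (fac g C) t2 zs) ->
  gsum (fac g C') (l ++ t) (C 1%N :: ys) =
  q * gsum (fac g C) (l ++ t1) ys + e * gsum (fac g C) (l ++ t2) ys.
Proof.
move=> gys /allP l2 ft; have c0 : C 1%N != 0.
  by apply: (generic_neq0 gys); rewrite mem_head.
have uys := generic_uniq gys; apply: (gsum_prefix (aa := [:: C 1%N])) => // s /l2 s2.
have facE (D : nat -> F) y : fac g D s y =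
    g y * ((y * D 1%N - 1) / bt * \prod_(2 <= k < s) ((y * D k - 1) / bt)).
  by rewrite /fac big_ltn.
have prodE y : \prod_(2 <= k < s) ((y * C' k - 1) / bt) =
    \prod_(2 <= k < s) ((y * C k - 1) / bt).
  by apply: eq_big_nat => k /andP[k2 _]; rewrite C'E.
split=> [a|y yys]; rewrite facE C'1 prodE.
  by rewrite inE => /eqP->; rewrite (mulfV c0) subrr !mul0r mulr0 mul0r.
rewrite big_seq1 facE -[LHS]mulrA; congr (_ * _); rewrite [LHS]mulrAC rt_inv_factor //.
by case/andP: uys => cys _; apply: contraNneq cys => <-.
Qed.

Lemma gsum_reflect1_notin l ys : generic (C 1%N :: ys) -> all (leq 2) l ->
  gsum (fac g C') l (C 1%N :: ys) = gsum (fac g C) l ys.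
Proof.
move=> gys l2; rewrite -[l]cats0 (@gsum_reflect1 _ _ [::] [::] 1 0) //.
  by rewrite mul1r mul0r addr0.
by move=> zs _ _ _; rewrite mul1r mul0r addr0.
Qed.

(** The tail sum is (P^p - 1)/bt for P the product of the remaining variables. The extra variable c
    multiplies P by c, and c^p P^p - 1 = c^p (P^p - 1) + (c^p - 1). *)
Lemma gsum_reflect1_in l ys : generic (C 1%N :: ys) -> all (leq 2) l ->
  gsum (fac g C') (rcons l 1%N) (C 1%N :: ys) =
  C 1%N ^+ p * gsum (fac g C) (rcons l 1%N) ys +
  (C 1%N ^+ p - 1) / bt * gsum (fac g C) l ys.
Proof.
move=> gys l2; rewrite -cats1 -[in X in _ = _ + X](cats0 l).
apply: gsum_reflect1 => // zs uzs sub _.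
have gzs : generic (C 1%N :: zs).
  apply: (generic_sub gys) => [|z]; last first.
    by rewrite !inE => /predU1P[->|/sub ->]; rewrite ?eqxx ?orbT.
  rewrite /= uzs andbT; case/and5P: gys => _ _ _ H _.
  exact: contra (sub _) H.
have tailE (D : nat -> F) s : gsum (fac g D) [:: 1%N] s =
    \sum_(y <- s) g y * \prod_(z <- rem y s) rt y z.
  by apply: eq_bigr => y _; rewrite fac1 mulr1.
have gz : generic zs by apply: (generic_sub gys) => // z /sub; rewrite inE => ->; rewrite orbT.
rewrite !tailE !sum_expr_rt // big_cons exprMn mulr1.
by field.
Qed.

End ReflectOne.

Section ReflectTwo.

Variables C C' : nat -> F.
Hypotheses (C'1 : C' 1%N = (C 2%N)^-1) (C'2 : C' 2%N = (C 1%N)^-1).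
Hypothesis C'E : forall k, (2 < k)%N -> C' k = C k.

Let one (y : F) : F := 1.

(** As in [gsum_reflect1], now with two extra variables, which the parts at least 3 absorb. *)
Lemma gsum_reflect2 l t t1 t2 q e ys :
    generic [:: C 1%N, C 2%N & ys] -> all (leq 3) l ->
    (forall zs, generic [:: C 1%N, C 2%N & zs] -> size ys = (size l + size zs)%N ->
      gsum (fac one C') t [:: C 1%N, C 2%N & zs] =
      q * gsum (fac one C) t1 zs + e * gsum (fac one C) t2 zs) ->
  gsum (fac one C') (l ++ t) [:: C 1%N, C 2%N & ys] =
  q * gsum (fac one C) (l ++ t1) ys + e * gsum (fac one C) (l ++ t2) ys.
Proof.
move=> gys /allP l3 ft.
have [c1 c2] : C 1%N != 0 /\ C 2%N != 0.
  by split; apply: (generic_neq0 gys); rewrite !inE eqxx ?orbT.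
have uys := generic_uniq gys.
apply: (gsum_prefix (aa := [:: C 1%N; C 2%N])) => // [s /l3 s3|zs uzs sub szE]; last first.
  apply: ft => //; apply: (generic_sub gys) => [|z].
    case/and3P: uys => H1 H2 _; rewrite /= uzs andbT (contra (sub _) H2) andbT.
    by move: H1; rewrite !inE !negb_or => /andP[->]; apply: contra (sub _).
  by rewrite !inE => /or3P[->|->|/sub ->]; rewrite ?orbT.
have facE (D : nat -> F) y : fac one D s y = (y * D 1%N - 1) / bt *
    ((y * D 2%N - 1) / bt * \prod_(3 <= k < s) ((y * D k - 1) / bt)).
  by rewrite /fac mul1r big_ltn ?(ltnW s3) // big_ltn.
have prodE y : \prod_(3 <= k < s) ((y * C' k - 1) / bt) =
    \prod_(3 <= k < s) ((y * C k - 1) / bt).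
  by apply: eq_big_nat => k /andP[k3 _]; rewrite C'E.
split=> [a|y yys]; rewrite facE C'1 C'2 prodE.
  by rewrite !inE => /pred2P[]->; rewrite ?(mulfV c1) ?(mulfV c2) subrr !mul0r ?mulr0 ?mul0r.
case/and3P: uys => H1 H2 _.
have y1 : y != C 1%N by apply: contraNneq H1 => <-; rewrite inE yys orbT.
have y2 : y != C 2%N by apply: contraNneq H2 => <-.
rewrite !big_cons big_nil mulr1 facE [in RHS]mulrCA -!(rt_inv_factor _ y1, rt_inv_factor _ y2) //.
by ring.
Qed.

(** With oddly many variables left, the tail 1 gives 1; the tail 2 gives (C_1 P - 1)/bt, where the
    new parameter C_2^-1 compensates the factor C_1 C_2 gained by the product P. *)
Lemma gsum_reflect2_same l t ys : generic [:: C 1%N, C 2%N & ys] -> all (leq 3) l ->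
    t = [::] \/ (t = [:: 1%N] \/ t = [:: 2%N]) /\ odd (size ys) = ~~ odd (size l) ->
  gsum (fac one C') (l ++ t) [:: C 1%N, C 2%N & ys] = gsum (fac one C) (l ++ t) ys.
Proof.
move=> gys l3 tE; rewrite (@gsum_reflect2 _ _ t [::] 1 0) //.
  by rewrite mul1r mul0r addr0.
move=> zs g2 szE; rewrite mul1r mul0r addr0.
have gz : generic zs.
  apply: (generic_sub g2) => [|z]; last by rewrite !inE orbA => ->; rewrite orbT.
  by have /and3P[] := generic_uniq g2.
case: tE => [->//|[tE]]; rewrite szE oddD => par.
have {par} odd_zs : odd (size zs) by move: par; do 2!case: odd.
case: tE => ->; first by rewrite !gsum_single1 //= ?odd_zs // => y; rewrite fac1.
have tailE (D : nat -> F) s : gsum (fac one D) [:: 2%N] s =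
    \sum_(y <- s) (y * D 1%N - 1) / bt * \prod_(z <- rem y s) rt y z.
  by apply: eq_bigr => y _; rewrite facS // fac1 mulr1 mul1r.
rewrite !tailE !sum_affine_rt //= negbK odd_zs !big_cons C'1; congr ((_ - 1) / bt).
by rewrite mulrCA mulKf // (generic_neq0 g2) // !inE eqxx orbT.
Qed.

(** With evenly many variables left, the tail 2, 1 gives (P - 1)/bt whatever the parameters are, and
    the extra variables multiply P by C_1 C_2. *)
Lemma gsum_reflect2_in l ys : generic [:: C 1%N, C 2%N & ys] -> all (leq 3) l ->
    odd (size ys) = odd (size l) ->
  gsum (fac one C') (l ++ [:: 2%N; 1%N]) [:: C 1%N, C 2%N & ys] =
  C 1%N * C 2%N * gsum (fac one C) (l ++ [:: 2%N; 1%N]) ys +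
  (C 1%N * C 2%N - 1) / bt * gsum (fac one C) l ys.
Proof.
move=> gys l3 par; rewrite -[in X in _ = _ + X](cats0 l).
apply: gsum_reflect2 => // zs g2 szE.
have gz : generic zs.
  apply: (generic_sub g2) => [|z]; last by rewrite !inE orbA => ->; rewrite orbT.
  by have /and3P[] := generic_uniq g2.
have {par} odd_zs : ~~ odd (size zs) by move: par; rewrite szE oddD; do 2!case: odd.
have tailE (D : nat -> F) s : generic s -> ~~ odd (size s) ->
    gsum (fac one D) [:: 2%N; 1%N] s = (\prod_(z <- s) z - 1) / bt.
  move=> gs os; have := sum_affine_rt (D 1%N) gs; rewrite (negbTE os) => <-.
  apply: eq_big_seq => y ys'; rewrite -/(gsum _ [:: 1%N] _).
  have -> : gsum (fac one D) [:: 1%N] (rem y s) = 1.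
    apply: gsum_single1 => [||z]; last by rewrite fac1.
      apply: (generic_sub gs) => [|z /mem_rem //].
      by rewrite rem_uniq // (generic_uniq gs).
    by rewrite size_rem //; case: (s) ys' os => //= ? s' _; rewrite negbK.
  by rewrite facS // fac1 mulr1 mul1r.
rewrite !tailE //= ?negbK // !big_cons; field.
exact: bt0.
Qed.

End ReflectTwo.

End GSumIdentities.

(** * Values at points with repetitions *)

Section Density.

Variable F : fieldType.
Hypothesis char0 : forall m, m.+1%:R != 0 :> F.
Implicit Types (p : {poly F}) (s ys : seq F) (phi : seq F -> F).

Lemma poly_cofinite_eq0 p s : (forall y, y \notin s -> p.[y] = 0) -> p = 0.
Proof.
move=> p0; apply/eqP; apply: contraTT isT => nz.
have natr_inj : injective (fun i : nat => i%:R : F).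
  move=> i j /eqP; wlog lt_ij : i j / (i <= j)%N => [W|].
    by case/orP: (leq_total i j) => ? /eqP e; [|apply/esym]; apply: W => //; apply/eqP.
  rewrite eq_sym -subr_eq0 -natrB //; case E: (j - i)%N => [|d].
    by move=> _; apply/eqP; rewrite eqn_leq lt_ij /= -subn_eq0 E.
  by rewrite (negbTE (char0 d)).
pose r := [seq y <- [seq i%:R | i <- iota 0 (size s + size p)] | y \notin s].
have ur : uniq [seq i%:R : F | i <- iota 0 (size s + size p)].
  by rewrite map_inj_uniq ?iota_uniq.
have r0 : all (root p) r.
  by apply/allP => y; rewrite mem_filter => /andP[ys _]; rewrite /root p0.
have := max_poly_roots nz r0 (filter_uniq _ ur); rewrite ltnNge => /negP[].
pose r' := [seq y <- [seq i%:R | i <- iota 0 (size s + size p)] | y \in s].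
have E : (size r' + size r = size s + size p)%N.
  by rewrite !size_filter (count_predC (mem s)) size_map size_iota.
have : (size r' <= size s)%N.
  apply: uniq_leq_size; first exact: filter_uniq.
  by move=> y; rewrite mem_filter => /andP[].
by rewrite -(leq_add2r (size r)) E leq_add2l.
Qed.

Definition polyfun (f : F -> F) := exists p, forall y, f y = p.[y].

Lemma polyfun_const c : polyfun (fun=> c).
Proof. by exists c%:P => y; rewrite hornerC. Qed.

Lemma polyfunD f f' : polyfun f -> polyfun f' -> polyfun (fun y => f y + f' y).
Proof. by move=> [p pE] [q qE]; exists (p + q) => y; rewrite hornerD pE qE. Qed.

Lemma polyfunM f f' : polyfun f -> polyfun f' -> polyfun (fun y => f y * f' y).
Proof. by move=> [p pE] [q qE]; exists (p * q) => y; rewrite hornerM pE qE. Qed.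

(** Polynomial in each coordinate separately: this weak form is easy to check for composites and is
    enough for the density argument. *)
Definition sep_poly n phi := forall s1 s2, (size s1 + (size s2).+1)%N = n ->
  polyfun (fun y => phi (s1 ++ y :: s2)).

Lemma sep_polyD n phi psi : sep_poly n phi -> sep_poly n psi ->
  sep_poly n (fun s => phi s + psi s).
Proof. by move=> sp sq s1 s2 szE; apply: polyfunD; [apply: sp|apply: sq]. Qed.

Lemma sep_polyZ n c phi : sep_poly n phi -> sep_poly n (fun s => c * phi s).
Proof.
by move=> sp s1 s2 szE; apply: polyfunM; [apply: polyfun_const|apply: sp].
Qed.

(* The coordinates are freed one at a time: with the other ones fixed, a       *)
(* polynomial vanishing at all but finitely many points vanishes.              *)
Lemma sep_poly_eq0 n bad phi : uniq bad -> sep_poly n phi ->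
    (forall s, size s = n -> uniq (bad ++ s) -> phi s = 0) ->
  forall s, size s = n -> phi s = 0.
Proof.
move=> ubad sp phi0 s; rewrite -[s in phi s]cats0 -[s in size s]cats0 size_cat.
have : uniq (bad ++ [::]) by rewrite cats0.
move: [::]; elim/last_ind: s => [|s a IHs] t u szE; first exact: phi0.
rewrite -cats1 -catA /=; rewrite size_rcons addSnnS in szE.
have [p pE] := sp s t szE.
rewrite pE (_ : p = 0) ?horner0 //; apply: (@poly_cofinite_eq0 _ (bad ++ t)) => y yt.
rewrite -pE IHs //; move: u yt; rewrite !cat_uniq mem_cat /= !negb_or.
by move=> /and3P[-> -> ->] /andP[-> ->].
Qed.

Lemma sep_poly_eq n bad phi psi : uniq bad -> sep_poly n phi -> sep_poly n psi ->
    (forall s, size s = n -> uniq (bad ++ s) -> phi s = psi s) ->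
  forall s, size s = n -> phi s = psi s.
Proof.
move=> ubad sp sq eqs s sz; apply/eqP; rewrite -subr_eq0 -mulN1r; apply/eqP.
apply: (sep_poly_eq0 ubad (sep_polyD sp (sep_polyZ (-1) sq))) => // t szt ut.
by rewrite eqs // mulN1r subrr.
Qed.

End Density.

Lemma eq_symmetrized (F : fieldType) (bt : F) fac fac' l n (x x' : 'I_n -> F) :
  (forall y m, fac y m = fac' y m) -> x =1 x' ->
  symmetrized bt fac l x = symmetrized bt fac' l x'.
Proof.
move=> eq_fac eq_x; congr (_ * _); apply: eq_bigr => w _; congr (_ * _).
  by apply: eq_bigr => j _; rewrite eq_fac eq_x.
by apply: eq_bigr => i _; apply: eq_bigr => j _; rewrite !eq_x.
Qed.

Section Extension.

Variable F : fieldType.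
Hypothesis char0 : forall m, m.+1%:R != 0 :> F.
Variable bt : F.
Hypothesis bt0 : bt != 0.
Implicit Types (f : nat -> {poly F}) (l : seq nat) (ys : seq F).

Definition point n ys (i : 'I_n) : F := (ys`_i - 1) / bt.

Lemma symmetrized_point f l n (P : {mpoly F[n]}) : (size l <= n)%N ->
    (forall (E : fieldType) (h : {rmorphism {mpoly F[n]} -> E}),
      injective (fun i => h 'X_i) ->
      h P = symmetrized (h bt%:MP)
        (fun y m => (map_poly (h \o @mpolyC n F) (f m)).[y]) l (fun i => h 'X_i)) ->
  forall ys, size ys = n -> uniq ys ->
    P.@[point ys] = gsum (fun s y => (f s).[(y - 1) / bt]) l ys.
Proof.
move=> le_ln PE ys szys uys.
have pt_inj : injective (@point n ys).
  move=> i j /(mulIf (invr_neq0 bt0)) /addIr /eqP.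
  by rewrite nth_uniq ?szys // => /eqP /val_inj.
have := PE F (meval (@point n ys)); rewrite /= => ->; last first.
  by move=> i j; rewrite !mevalXU => /pt_inj.
rewrite mevalC (@eq_symmetrized _ _ _ (fun y m => (f m).[y]) _ _ _ (point ys)).
- rewrite symmetrized_gsum //; apply: gsum_perm; rewrite (_ : map _ _ = ys) //.
  apply: (@eq_from_nth _ 0) => [|i]; rewrite size_map size_enum_ord => // lt_i.
  rewrite (nth_map (Ordinal lt_i)) ?size_enum_ord // /point nth_enum_ord //.
  by rewrite mulrC divfK // addrCA subrr addr0.
- move=> y m; congr (_.[_]); rewrite -[RHS](@map_poly_id _ idfun) //.
  by apply: eq_map_poly => c /=; rewrite mevalC.
by move=> i; rewrite mevalXU.
Qed.

Lemma gsum_mpoly f l n : exists P : {mpoly F[n]}, forall ys, size ys = n ->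
  uniq ys -> P.@[point ys] = gsum (fun s => horner (f s)) l ys.
Proof.
have [le_ln|lt_nl] := leqP (size l) n; last first.
  by exists 0 => ys szys _; rewrite meval0 gsum_small // szys.
pose f' s := f s \Po (1 + bt *: 'X).
have [P PE] := symmetrized_poly bt f' le_ln; exists P => ys szys uys.
rewrite (symmetrized_point le_ln PE) //; apply: eq_gsum => s _ y _.
rewrite /f' horner_comp; congr (_.[_]).
by rewrite hornerD hornerZ hornerX -polyC1 hornerC mulrC divfK // addrC subrK.
Qed.

(* The value at an arbitrary list of the polynomial that [gsum] coincides with *)
(* on lists without repetition.                                                *)
Definition gbar f l ys : F :=
  (projT1 (constructive_indefinite_description _ (gsum_mpoly f l (size ys)))).@[point ys].

Lemma gbarE f l ys : uniq ys -> gbar f l ys = gsum (fun s => horner (f s)) l ys.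
Proof.
by rewrite /gbar; case: constructive_indefinite_description => P /= PE uys; apply: PE.
Qed.

Lemma gbar_mpoly f l n : exists P : {mpoly F[n]}, forall ys, size ys = n ->
  gbar f l ys = P.@[point ys].
Proof.
by eexists; move=> ys szys; rewrite /gbar szys; reflexivity.
Qed.

Lemma polyfun_meval n (P : {mpoly F[n]}) (v : F -> 'I_n -> F) :
  (forall i, polyfun (fun y => v y i)) -> polyfun (fun y => P.@[v y]).
Proof.
move=> vP; pose q i := projT1 (constructive_indefinite_description _ (vP i)).
have qE i y : v y i = (q i).[y].
  by rewrite /q; case: constructive_indefinite_description.
exists (\sum_(m <- msupp P) P@_m *: \prod_i q i ^+ m i) => y.
rewrite mevalE horner_sum; apply: eq_bigr => m _; rewrite hornerZ horner_prod.
by congr (_ * _); apply: eq_bigr => i _; rewrite horner_exp qE.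
Qed.

Lemma sep_poly_meval n (P : {mpoly F[n]}) : sep_poly n (fun ys => P.@[@point n ys]).
Proof.
move=> s1 s2 szE; apply: polyfun_meval => i; rewrite /point.
apply: polyfunM; last exact: polyfun_const.
apply: polyfunD; last exact: polyfun_const.
have [lt_i|gt_i|iE] := ltngtP i (size s1).
- by exists (s1`_i)%:P => y; rewrite hornerC nth_cat lt_i.
- exists (s2`_(i - size s1).-1)%:P => y; rewrite hornerC nth_cat ltnNge ltnW //=.
  by move: gt_i; rewrite -subn_gt0; case: (i - size s1)%N.
by exists 'X => y; rewrite nth_cat iE ltnn subnn hornerX.
Qed.

Lemma sep_poly_gbar f l n : sep_poly n (gbar f l).
Proof.
have [P PE] := gbar_mpoly f l n; move=> s1 s2 szE.
have [p pE] := sep_poly_meval P szE; exists p => y.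
by rewrite PE ?pE // size_cat.
Qed.

Lemma gbar_small f l ys : (size ys < size l)%N -> gbar f l ys = 0.
Proof.
move=> lt; apply: (@sep_poly_eq0 _ char0 (size ys) [::] (gbar f l)) => //.
  exact: sep_poly_gbar.
by move=> s szs us; rewrite gbarE // gsum_small // szs.
Qed.

Lemma gbar_perm f l ys zs : perm_eq ys zs -> gbar f l ys = gbar f l zs.
Proof.
rewrite perm_sym => /(perm_iotaP 0)[Is IsE ->].
have szI : size Is = size ys by rewrite (perm_size IsE) size_iota.
have uI : uniq Is by rewrite (perm_uniq IsE) iota_uniq.
have nthP (s : seq F) : size s = size ys -> perm_eq [seq s`_i | i <- Is] s.
  by move=> szs; apply/(perm_iotaP 0); exists Is => //; rewrite szs.
apply: (@sep_poly_eq _ char0 (size ys) [::] (gbar f l)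
  (fun s => gbar f l [seq s`_i | i <- Is])) => //.
- exact: sep_poly_gbar.
- move=> s1 s2 szE.
  have kI : size s1 \in Is by rewrite (perm_mem IsE) mem_iota /= -szE addnS ltnS leq_addr.
  case/splitPr: kI szI uI => I1 I2 szI uI.
  have nk y i : i != size s1 -> (s1 ++ y :: s2)`_i = (s1 ++ 0 :: s2)`_i.
    move=> ne; rewrite !nth_cat; case: ltngtP ne => // lt _.
    by move: lt; rewrite -subn_gt0; case: (i - _)%N.
  have mapE y (J : seq nat) : size s1 \notin J ->
      [seq (s1 ++ y :: s2)`_i | i <- J] = [seq (s1 ++ 0 :: s2)`_i | i <- J].
    by move=> kJ; apply/eq_in_map => i iJ; apply: nk; apply: contraNneq kJ => <-.
  move: uI; rewrite cat_uniq /= negb_or => /and3P[_ /andP[k1 _] /andP[k2 _]].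
  pose J (I : seq nat) := [seq (s1 ++ 0 :: s2)`_i | i <- I].
  have szJ : (size (J I1) + (size (J I2)).+1)%N = size ys.
    by rewrite !size_map -szI size_cat.
  have [p pE] := @sep_poly_gbar f l _ _ _ szJ; exists p => y.
  rewrite -pE map_cat /= !mapE //; congr (gbar f l (_ ++ _ :: _)).
  by rewrite nth_cat ltnn subnn.
move=> s szs us; rewrite !gbarE //; last by rewrite (perm_uniq (nthP s szs)).
by apply: gsum_perm; rewrite perm_sym nthP.
Qed.

End Extension.

(** * The identities at arbitrary points *)

Section Values.

Variable F : fieldType.
Hypothesis char0 : forall m, m.+1%:R != 0 :> F.
Variable bt : F.
Hypothesis bt0 : bt != 0.
Implicit Types (g : {poly F}) (C : nat -> F) (l : seq nat) (ys : seq F).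

Definition facp g C s : {poly F} :=
  g * \prod_(1 <= k < s) (bt^-1 *: (C k *: 'X - 1)).

Lemma facpE g C s y : (facp g C s).[y] = fac bt (horner g) C s y.
Proof.
rewrite /facp hornerM horner_prod; congr (_ * _); apply: eq_bigr => k _.
by rewrite hornerZ hornerD hornerN hornerZ hornerX -polyC1 hornerC mulrC [y * _]mulrC.
Qed.

Definition fval g C l ys := gbar char0 bt0 (facp g C) l ys.

Lemma fvalE g C l ys : uniq ys -> fval g C l ys = gsum (fac bt (horner g) C) l ys.
Proof. by move=> u; rewrite /fval gbarE //; apply: eq_gsum => s _ y _; apply: facpE. Qed.

Lemma fval_small g C l ys : (size ys < size l)%N -> fval g C l ys = 0.
Proof. exact: gbar_small. Qed.

Lemma fval_nil g C ys : fval g C [::] ys = 1.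
Proof.
apply: (@sep_poly_eq _ char0 (size ys) [::] (fval g C [::]) (fun=> 1)) => //.
- exact: sep_poly_gbar.
- by move=> s1 s2 _; apply: polyfun_const.
by move=> s _ us; rewrite fvalE.
Qed.

Lemma fval_perm g C l ys zs : perm_eq ys zs -> fval g C l ys = fval g C l zs.
Proof. exact: gbar_perm. Qed.

Lemma sep_poly_cat n (phi : seq F -> F) aa : sep_poly (size aa + n) phi ->
  sep_poly n (fun s => phi (aa ++ s)).
Proof.
move=> sp s1 s2 szE; have := sp (aa ++ s1) s2; rewrite size_cat -addnA szE.
by case=> // p pE; exists p => y; rewrite catA.
Qed.

(** The form in which identities of [gsum] pass to [fval]: the points may be taken distinct and
    outside [bad], which contains the extra points aa and, where needed, the interpolation nodes. *)
Lemma fval_dense g C C' q e l l1 l2 aa bad ys :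
    uniq bad -> uniq aa -> {subset aa <= bad} ->
    (forall zs, size zs = size ys -> uniq (bad ++ zs) ->
      gsum (fac bt (horner g) C') l (aa ++ zs) =
      q * gsum (fac bt (horner g) C) l1 zs + e * gsum (fac bt (horner g) C) l2 zs) ->
  fval g C' l (aa ++ ys) = q * fval g C l1 ys + e * fval g C l2 ys.
Proof.
move=> ubad uaa sub E.
apply: (@sep_poly_eq _ char0 (size ys) bad (fun s => fval g C' l (aa ++ s))
  (fun s => q * fval g C l1 s + e * fval g C l2 s)) => //.
- exact/sep_poly_cat/sep_poly_gbar.
- by apply: sep_polyD; apply: sep_polyZ; apply: sep_poly_gbar.
move=> s szs; rewrite cat_uniq => /and3P[_ dis us]; rewrite !fvalE //.
  by rewrite E // cat_uniq ubad dis us.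
rewrite cat_uniq uaa us andbT /=; apply: contra dis => /hasP[z zs zaa].
by apply/hasP; exists z => //; apply: sub.
Qed.

Lemma fval_dense_eq g C C' l l1 aa bad ys :
    uniq bad -> uniq aa -> {subset aa <= bad} ->
    (forall zs, size zs = size ys -> uniq (bad ++ zs) ->
      gsum (fac bt (horner g) C') l (aa ++ zs) = gsum (fac bt (horner g) C) l1 zs) ->
  fval g C' l (aa ++ ys) = fval g C l1 ys.
Proof.
move=> ubad uaa sub E; rewrite (@fval_dense g C C' 1 0 l l1 l1 aa bad) //.
  by rewrite mul1r mul0r addr0.
by move=> zs szs u; rewrite mul1r mul0r addr0 E.
Qed.

Lemma fval_cancel g C l c ys : c != 0 -> c != c^-1 ->
  fval g C l [:: c, c^-1 & ys] = fval g C l ys.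
Proof.
move=> c0 cV; have uc : uniq [:: c; c^-1] by rewrite /= inE cV.
apply: (@fval_dense_eq g C C l l [:: c; c^-1] [:: c; c^-1]) => // zs _ u.
exact: gsum_cancel.
Qed.

Lemma fval_cons1 g C l ys : g.[1] = 0 -> fval g C l (1 :: ys) = fval g C l ys.
Proof.
move=> g1; apply: (@fval_dense_eq g C C l l [:: 1] [:: 1]) => // zs _ u.
by apply: gsum_cons1 => // s _; rewrite /fac g1 mul0r.
Qed.

Definition laurent (f : F -> F) :=
  exists d (p : {poly F}), forall y, y != 0 -> y ^+ d * f y = p.[y].

Lemma laurentD f f' : laurent f -> laurent f' -> laurent (fun y => f y + f' y).
Proof.
move=> [d [p pE]] [d' [p' pE']]; exists (d + d')%N, ('X^d' * p + 'X^d * p') => y y0.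
by rewrite hornerD !hornerM !hornerXn -pE // -pE' // exprD; ring.
Qed.

Lemma laurentM f f' : laurent f -> laurent f' -> laurent (fun y => f y * f' y).
Proof.
move=> [d [p pE]] [d' [p' pE']]; exists (d + d')%N, (p * p') => y y0.
by rewrite hornerM -pE // -pE' // exprD; ring.
Qed.

Lemma laurent_const c : laurent (fun=> c).
Proof. by exists 0%N, c%:P => y _; rewrite hornerC mul1r. Qed.

Lemma laurent_meval n (P : {mpoly F[n]}) (v : F -> 'I_n -> F) :
  (forall i, laurent (fun y => v y i)) -> laurent (fun y => P.@[v y]).
Proof.
move=> vL.
have big (op : F -> F -> F) idx (I : Type) (r : seq I) (h : F -> I -> F) :
    (forall f f', laurent f -> laurent f' -> laurent (fun y => op (f y) (f' y))) ->
    (forall i, laurent (fun y => h y i)) ->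
    laurent (fun y => \big[op/idx]_(i <- r) h y i).
  move=> opL hL; elim: r => [|i r [d [p pE]]].
    have [d [p pE]] := laurent_const idx; exists d, p => y y0.
    by rewrite big_nil pE.
  have [|d' [p' pE']] := opL (fun y => h y i) (fun y => \big[op/idx]_(i <- r) h y i) (hL i).
    by exists d, p.
  by exists d', p' => y y0; rewrite big_cons pE'.
have [] // := big +%R 0 _ (msupp P) (fun y m => P@_m * \prod_i v y i ^+ m i).
- exact: laurentD.
- move=> m; apply: laurentM; first exact: laurent_const.
  apply: big; first exact: laurentM.
  move=> i; elim: (m i : nat) => [|k IHk]; first exact: laurent_const.
  have [d [p pE]] := laurentM (vL i) IHk; exists d, p => y y0.
  by rewrite exprS pE.
by move=> d [p pE]; exists d, p => y y0; rewrite mevalE pE.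
Qed.

(** The limit c = 1 of [fval_cancel], which itself requires c different from c^-1. The value at y,
    y^-1, ys is a Laurent polynomial in y, constant wherever that lemma applies, hence constant. *)
Lemma fval_cons11 g C l ys : fval g C l [:: 1, 1 & ys] = fval g C l ys.
Proof.
have [P PE] := gbar_mpoly char0 bt0 (facp g C) l (size ys).+2.
pose v y := @point _ bt (size ys).+2 [:: y, y^-1 & ys].
have [d [p pE]] : laurent (fun y => P.@[v y]).
  apply: laurent_meval => i; rewrite /v /point; apply: laurentM; last exact: laurent_const.
  apply: laurentD; last exact: laurent_const.
  case: i => [[|[|i]] lt_i] /=; last exact: laurent_const.
    by exists 0%N, 'X => y _; rewrite mul1r hornerX.
  by exists 1%N, 1 => y y0; rewrite expr1 mulfV // -polyC1 hornerC.
have E y : fval g C l [:: y, y^-1 & ys] = P.@[v y] by apply: PE.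
have := pE 1 (oner_neq0 _); rewrite -E invr1 expr1n mul1r => ->.
suff /eqP -> : p == fval g C l ys *: 'X^d.
  by rewrite hornerZ hornerXn expr1n mulr1.
(* At 0 the Laurent polynomial is undefined, and at 1 and -1 one has y = y^-1. *)
rewrite -subr_eq0; apply/eqP/(@poly_cofinite_eq0 _ char0 _ [:: 0; 1; -1]) => y.
rewrite !inE !negb_or => /and3P[y0 y1 yN1].
suff yV : y != y^-1.
  by rewrite hornerD hornerN hornerZ hornerXn -pE // -E (fval_cancel g C l ys y0 yV) mulrC subrr.
apply: contraNneq y1 => yV; have : (y - 1) * (y + 1) == 0.
  by rewrite -subr_sqr_1 expr2 {2}yV mulfV // subrr.
by rewrite mulf_eq0 subr_eq0 addr_eq0 (negbTE yN1) orbF.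
Qed.

Lemma uniq_01N1 : uniq [:: 0; 1; -1 : F].
Proof.
rewrite /= !inE negb_or eq_sym oner_eq0 eq_sym oppr_eq0 oner_eq0 /= andbT.
by rewrite -subr_eq0 opprK (char0 1).
Qed.

Lemma eq_gsum_fac (h h' : F -> F) C l ys : h =1 h' ->
  gsum (fac bt h C) l ys = gsum (fac bt h' C) l ys.
Proof. by move=> eqh; apply: eq_gsum => s _ y _; rewrite /fac eqh. Qed.

Lemma horner_1 : horner (1 : {poly F}) =1 (fun=> 1).
Proof. by move=> y; rewrite -polyC1 hornerC. Qed.

Lemma fval_rcons1 C l ys : odd (size l) != odd (size ys) ->
  fval 1 C (rcons l 1%N) ys = fval 1 C l ys.
Proof.
move=> par; apply: (@fval_dense_eq 1 C C _ _ [::] [:: 0; 1; -1]) => //.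
  exact: uniq_01N1.
move=> zs szE gz; apply: gsum_rcons1 => //; last by rewrite szE.
by move=> y; rewrite fac1 horner_1.
Qed.

Section Swap.

Variables (g : {poly F}) (C C' : nat -> F) (i : nat) (e : F).
Hypotheses (i_gt0 : (0 < i)%N) (C'i : C' i = C i.+1) (C'Si : C' i.+1 = C i).
Hypothesis C'E : forall k, k != i -> k != i.+1 -> C' k = C k.
Hypothesis CSi : C i.+1 = (1 + bt * e) * C i.

Lemma fval_swap_notin l ys : i.+1 \notin l -> fval g C' l ys = fval g C l ys.
Proof.
move=> il; apply: (@fval_dense_eq g C C' _ _ [::] [::]) => // zs _ uzs.
exact: gsum_swap_notin i_gt0 C'i C'Si C'E _ _ il.
Qed.

Lemma fval_swap_in l1 l2 ys : i.+1 \notin l1 -> i.+1 \notin l2 ->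
  fval g C' (l1 ++ i.+1 :: l2) ys =
  (1 + bt * e) * fval g C (l1 ++ i.+1 :: l2) ys + e * fval g C (l1 ++ i :: l2) ys.
Proof.
move=> il1 il2; apply: (@fval_dense g C C' _ _ _ _ _ [::] [::]) => // zs _ uzs.
exact: (gsum_swap_in bt0 _ i_gt0 C'i C'Si C'E).
Qed.

Lemma fval_swap_repeat l1 l2 ys : i.+1 \notin l1 -> i.+1 \notin l2 ->
  fval g C' (l1 ++ [:: i.+1, i & l2]) ys = fval g C (l1 ++ [:: i.+1, i & l2]) ys.
Proof.
move=> il1 il2; apply: (@fval_dense_eq g C C' _ _ [::] [::]) => // zs _ uzs.
exact: (gsum_swap_repeat bt0 _ i_gt0 C'i C'Si C'E CSi).
Qed.

End Swap.

Section ReflectOne.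

Variables (p : nat) (C C' : nat -> F).
Hypothesis p12 : (p == 1%N) || (p == 2%N).
Hypotheses (C'1 : C' 1%N = (C 1%N)^-1) (C'E : forall k, (1 < k)%N -> C' k = C k).
Hypothesis u1 : uniq [:: 0; 1; -1; C 1%N].

Let g : {poly F} := bt^-1 *: ('X^p - 1).

Let gE y : g.[y] = (y ^+ p - 1) / bt.
Proof. by rewrite hornerZ hornerD hornerN hornerXn -polyC1 hornerC mulrC. Qed.

Let mem1 : {subset [:: C 1%N] <= [:: 0; 1; -1; C 1%N]}.
Proof. by move=> z; rewrite !inE => ->; rewrite !orbT. Qed.

Lemma fval_reflect1_notin l ys : all (leq 2) l ->
  fval g C' l (C 1%N :: ys) = fval g C l ys.
Proof.
move=> l2; apply: (@fval_dense_eq g C C' _ _ [:: C 1%N] [:: 0; 1; -1; C 1%N]) => //.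
by move=> zs _ uzs; rewrite !(eq_gsum_fac _ _ _ gE) (gsum_reflect1_notin bt0 p C'1 C'E).
Qed.

Lemma fval_reflect1_in l ys : all (leq 2) l ->
  fval g C' (rcons l 1%N) (C 1%N :: ys) =
  C 1%N ^+ p * fval g C (rcons l 1%N) ys + (C 1%N ^+ p - 1) / bt * fval g C l ys.
Proof.
move=> l2; apply: (@fval_dense g C C' _ _ _ _ _ [:: C 1%N] [:: 0; 1; -1; C 1%N]) => //.
by move=> zs _ uzs; rewrite !(eq_gsum_fac _ _ _ gE) (gsum_reflect1_in bt0 p12 C'1 C'E).
Qed.

End ReflectOne.

Section ReflectTwo.

Variables C C' : nat -> F.
Hypotheses (C'1 : C' 1%N = (C 2%N)^-1) (C'2 : C' 2%N = (C 1%N)^-1).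
Hypothesis C'E : forall k, (2 < k)%N -> C' k = C k.
Hypothesis u12 : uniq [:: 0; 1; -1; C 1%N; C 2%N].

Let sub12 : {subset [:: C 1%N; C 2%N] <= [:: 0; 1; -1; C 1%N; C 2%N]}.
Proof. by move=> z; rewrite !inE => ->; rewrite !orbT. Qed.

Let uniq12 : uniq [:: C 1%N; C 2%N].
Proof. by case/and4P: u12. Qed.

Lemma fval_reflect2_same l t ys : all (leq 3) l ->
    t = [::] \/ (t = [:: 1%N] \/ t = [:: 2%N]) /\ odd (size ys) = ~~ odd (size l) ->
  fval 1 C' (l ++ t) [:: C 1%N, C 2%N & ys] = fval 1 C (l ++ t) ys.
Proof.
move=> l3 tE; apply: (@fval_dense_eq 1 C C' _ _ [:: C 1%N; C 2%N] _ _ u12) => //.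
move=> zs szE uzs; rewrite !(eq_gsum_fac _ _ _ horner_1).
by apply: (gsum_reflect2_same bt0 C'1 C'2 C'E) => //; rewrite szE.
Qed.

Lemma fval_reflect2_in l ys : all (leq 3) l -> odd (size ys) = odd (size l) ->
  fval 1 C' (l ++ [:: 2%N; 1%N]) [:: C 1%N, C 2%N & ys] =
  C 1%N * C 2%N * fval 1 C (l ++ [:: 2%N; 1%N]) ys +
  (C 1%N * C 2%N - 1) / bt * fval 1 C l ys.
Proof.
move=> l3 par; apply: (@fval_dense 1 C C' _ _ _ _ _ [:: C 1%N; C 2%N] _ _ u12) => //.
move=> zs szE uzs; rewrite !(eq_gsum_fac _ _ _ horner_1).
by apply: (gsum_reflect2_in bt0 C'1 C'2 C'E) => //; rewrite szE.
Qed.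

End ReflectTwo.

Lemma gsum_map (sigma : {rmorphism F -> F}) f f' l ys :
    (forall s y, sigma (f s y) = f' s (sigma y)) ->
  sigma (gsum f l ys) = gsum f' l [seq sigma y | y <- ys].
Proof.
have map_rem y s : rem (sigma y) [seq sigma z | z <- s] = [seq sigma z | z <- rem y s].
  by elim: s => //= z s IHs; rewrite (inj_eq (fmorph_inj sigma)); case: eqP => //= _; rewrite IHs.
move=> ff'; elim: l ys => [|s l IHl] ys /=; first exact: rmorph1.
rewrite rmorph_sum big_map; apply: eq_bigr => y _.
rewrite !rmorphM IHl ff' map_rem; congr (_ * _ * _).
rewrite rmorph_prod big_map; apply: eq_bigr => z _.
by rewrite /rt !rmorphM fmorphV !(rmorphB, rmorphM) rmorph1.
Qed.

Lemma fval_map (sigma : {rmorphism F -> F}) (tau : F -> F) g C l ys :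
    cancel tau sigma -> cancel sigma tau -> sigma bt = bt ->
    (forall y, sigma g.[y] = g.[sigma y]) ->
  sigma (fval g C l ys) = fval g (sigma \o C) l [seq sigma y | y <- ys].
Proof.
move=> tauK sigmaK sbt sg.
rewrite -{1}[ys](mapK sigmaK); set zs := map sigma ys.
apply: (@sep_poly_eq _ char0 (size zs) [::]
  (fun s => sigma (fval g C l (map tau s))) (fval g (sigma \o C) l)) => //.
- move=> s1 s2 szE.
  have szE' : (size (map tau s1) + (size (map tau s2)).+1)%N = size zs by rewrite (size_map tau s1) (size_map tau s2).
  have [p pE] := @sep_poly_gbar _ char0 _ bt0 (facp g C) l _ _ _ szE'.
  (* Applying sigma to p(tau y) gives the polynomial with coefficients moved by sigma, at y: this is
     why the points are first pulled back by the inverse tau. *)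
  exists (map_poly sigma p) => y; rewrite map_cat /= /fval pE -[in RHS](tauK y).
  by rewrite horner_map.
- exact: sep_poly_gbar.
move=> s szs us; rewrite !fvalE ?map_inj_uniq //; last exact: can_inj tauK.
rewrite (gsum_map (f' := fac bt (horner g) (sigma \o C))) ?(mapK tauK) // => k y.
rewrite /fac rmorphM sg rmorph_prod; congr (_ * _); apply: eq_bigr => j _.
by rewrite rmorphM fmorphV rmorphB rmorphM rmorph1 sbt.
Qed.

End Values.

(** * The field K and the Weyl group action on it *)

Section PolyRing.

Import monalg.

Definition pvar (k : nat) : poly_ring := mkmalgU (ucm k) 1.
Definition pconst (c : {poly int}) : poly_ring := mkmalgU mone c.

Lemma mkmalgUM (m1 m2 : cmonom nat) (c1 c2 : {poly int}) :
  mkmalgU (mmul m1 m2) (c1 * c2) = (mkmalgU m1 c1 : poly_ring) * mkmalgU m2 c2.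
Proof. by apply/esym; apply: fgmulUU. Qed.

Lemma mkmalgU_exp i d : exists2 m : cmonom nat, forall j, m j = (d * (i == j))%N
  & mkmalgU m 1 = pvar i ^+ d :> poly_ring.
Proof.
elim: d => [|d [m mE mP]]; first by exists mone => [j|]; rewrite ?cm1.
exists (mmul (ucm i) m) => [j|]; first by rewrite cmM cmU mE mulSn.
by rewrite -[1 in LHS]mulr1 mkmalgUM mP exprS.
Qed.

Lemma mkmalgU_prod (s : seq nat) (x : nat -> nat) : uniq s ->
  exists2 m : cmonom nat, forall j, m j = if j \in s then x j else 0%N
    & mkmalgU m 1 = \prod_(i <- s) pvar i ^+ x i :> poly_ring.
Proof.
elim: s => [|i s IHs] /=; first by exists mone => [j|]; rewrite ?cm1 ?big_nil.
case/andP=> i_s /IHs[m mE mP]; have [m' m'E m'P] := mkmalgU_exp i (x i).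
exists (mmul m' m) => [j|]; last by rewrite -[1 in LHS]mulr1 mkmalgUM mP m'P big_cons.
rewrite cmM mE m'E inE eq_sym; have [->|_] := eqVneq j i; last by rewrite muln0.
by rewrite (negbTE i_s) muln1 addn0.
Qed.

(** Through this principle the later arguments use only generators of the polynomial ring. *)
Lemma poly_ring_ind (Q : poly_ring -> Prop) :
    (forall c, Q (pconst c)) -> (forall k, Q (pvar k)) ->
    (forall p q, Q p -> Q q -> Q (p + q)) -> (forall p q, Q p -> Q q -> Q (p * q)) ->
  forall p, Q p.
Proof.
move=> Qc Qv QD QM p; rewrite (monalgE p).
have Q0 : Q 0 by have := Qc 0; rewrite /pconst monalgU0.
have UE (m : cmonom nat) (c : {poly int}) :
    mkmalgU m c = pconst c * mkmalgU m 1 :> poly_ring.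
  by rewrite /pconst -mkmalgUM mulr1 mul1m.
apply: (big_ind Q) => [||m _]; [exact: Q0 | exact: QD |].
rewrite UE; apply: (QM); first exact: Qc.
have [m' m'E m'P] := @mkmalgU_prod (finsupp m) m (fset_uniq _).
have <- : m' = m.
  apply/eqP/cmP => j; rewrite m'E; case: ifP => // jm.
  by apply/esym/eqP; rewrite cmE_eq0 jm.
rewrite m'P; apply: (big_ind Q) => [||k _]; [exact: (Qc 1) | exact: QM |].
elim: (m k : nat) => [|d IHd]; first exact: (Qc 1).
by rewrite exprS; apply: (QM).
Qed.

Section Evaluation.

Variables (S : comNzRingType) (h : nat -> S).

(** Written like the body of [wact_poly], so that [wact] is convertible to the extension of a ring
    morphism to fractions. *)
Definition mon_ev (m : cmonom nat) : S := \prod_(k <- finsupp m) h k ^+ m k.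

Lemma mon_evEw (m : cmonom nat) (d : {fset nat}) : (finsupp m `<=` d)%fset ->
  mon_ev m = \prod_(k <- d) h k ^+ m k.
Proof.
move=> le; rewrite /mon_ev (big_fset_incl _ le) // => k _.
by rewrite -cmE_neq0 negbK => /eqP->.
Qed.

Lemma mon_ev_mmorphism : mmorphism mon_ev.
Proof.
split=> [x y|]; last by rewrite /mon_ev mdom1 big_seq_fset0.
rewrite {1}/mon_ev mdomD (mon_evEw (fsubsetUl _ (finsupp y))).
rewrite (mon_evEw (fsubsetUr (finsupp x) _)) -big_split /=.
by apply: eq_bigr => k _; rewrite cmM exprD.
Qed.

HB.instance Definition _ :=
  isMultiplicative.Build (cmonom nat) S mon_ev mon_ev_mmorphism.

Lemma mon_evU k : mon_ev (ucm k) = h k.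
Proof. by rewrite /mon_ev mdomU big_seq_fset1 cmUU expr1. Qed.

Variable f : {rmorphism {poly int} -> S}.

Definition poly_ev : poly_ring -> S := mmap f mon_ev.

HB.instance Definition _ := GRing.RMorphism.copy poly_ev (mmap f mon_ev).

Lemma poly_evC c : poly_ev (pconst c) = f c.
Proof. by rewrite /poly_ev mmapC. Qed.

Lemma poly_evX k : poly_ev (pvar k) = h k.
Proof. by rewrite /poly_ev mmapU mon_evU -[RHS]mul1r; congr (_ * _); apply: (rmorph1 f). Qed.

End Evaluation.

HB.instance Definition _ := GRing.RMorphism.copy pconst (@mkmalgU (cmonom nat) {poly int} mone).

End PolyRing.

Definition tofracK : poly_ring -> K := @FracField.tofrac poly_ring.
HB.instance Definition _ := GRing.RMorphism.copy tofracK (@FracField.tofrac poly_ring).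

HB.instance Definition _ := GRing.RMorphism.copy Defs.coefK (tofracK \o pconst).

Lemma tofracK_eq0 p : (tofracK p == 0) = (p == 0).
Proof. exact: tofrac_eq0. Qed.

(* [B] and [pB] are hidden behind opaque proofs: unification would otherwise   *)
(* unfold them down to the construction of the polynomial ring.                *)
Lemma B_subproof : {f : nat -> K | forall k, f k = 1 + beta * b k}.
Proof. by exists (fun k => 1 + beta * b k). Qed.

Definition B : nat -> K := sval B_subproof.

Lemma BE k : B k = 1 + beta * b k.
Proof. exact: (svalP B_subproof). Qed.

(* Elements of K are shown to be nonzero by specializing beta to 1 and b_k to k. *)
Definition ev_int : poly_ring -> int :=
  poly_ev (fun k => k.+1%:Z) (horner_eval (1 : int)).
HB.instance Definition _ := GRing.RMorphism.copy ev_int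
  (poly_ev (fun k => k.+1%:Z) (horner_eval (1 : int))).

Lemma ev_intC c : ev_int (pconst c) = c.[1].
Proof. exact: poly_evC. Qed.

Lemma ev_intX k : ev_int (pvar k) = k.+1%:Z.
Proof. exact: poly_evX. Qed.

Lemma ev_int_neq0 p : ev_int p != 0 -> tofracK p != 0.
Proof. by rewrite tofracK_eq0; apply: contraNneq => ->; rewrite rmorph0. Qed.

Lemma K_char0 m : m.+1%:R != 0 :> K.
Proof.
rewrite -(rmorph_nat tofracK); apply: ev_int_neq0; rewrite rmorph_nat.
by rewrite natz.
Qed.

Lemma pB_subproof :
  {f : nat -> poly_ring | forall k, B k = tofracK (f k) /\ ev_int (f k) = k.+1%:Z}.
Proof.
exists (fun k => 1 + pconst 'X * (if k is k'.+1 then pvar k' else 0)) => k; split.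
  rewrite BE rmorphD rmorph1 rmorphM; congr (_ + _ * _).
  by case: k => [|k] //=; rewrite rmorph0.
rewrite rmorphD rmorph1 rmorphM /= ev_intC hornerX mul1r.
by case: k => [|k]; rewrite ?rmorph0 ?addr0 // ev_intX -[1]/(1%:Z) -PoszD.
Qed.

Definition pB : nat -> poly_ring := sval pB_subproof.

Lemma tofrac_pB k : B k = tofracK (pB k).
Proof. exact: (svalP pB_subproof k).1. Qed.

Lemma ev_pB k : ev_int (pB k) = k.+1%:Z.
Proof. exact: (svalP pB_subproof k).2. Qed.

Lemma beta_neq0 : beta != 0.
Proof.
apply: (@ev_int_neq0 (pconst 'X)).
by rewrite ev_intC hornerX.
Qed.

Lemma B0 : B 0 = 1.
Proof. by rewrite BE mulr0 addr0. Qed.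

Lemma B_neq0 k : B k != 0.
Proof. by rewrite tofrac_pB; apply: ev_int_neq0; rewrite ev_pB. Qed.

Lemma B_inj : injective B.
Proof.
move=> i j eqB; apply/eqP; apply: contraTT isT => ij.
have : tofracK (pB i - pB j) != 0.
  by apply: ev_int_neq0; rewrite rmorphB /= !ev_pB subr_eq0 eqz_nat eqSS.
by rewrite rmorphB /= -!tofrac_pB eqB subrr eqxx.
Qed.

Lemma B_mul_neq1 i j : (0 < i + j)%N -> B i * B j != 1.
Proof.
move=> ij; have : tofracK (pB i * pB j - 1) != 0.
  apply: ev_int_neq0; rewrite rmorphB rmorphM rmorph1 /= !ev_pB subr_eq0 -PoszM.
  by rewrite eqz_nat; apply/eqP; lia.
by rewrite rmorphB rmorphM rmorph1 /= -!tofrac_pB subr_eq0.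
Qed.

Lemma B_neqN1 i : B i != -1.
Proof.
have : tofracK (pB i + 1) != 0.
  by apply: ev_int_neq0; rewrite rmorphD rmorph1 /= !ev_pB -[1]/(1%:Z) -PoszD addn1.
by rewrite rmorphD rmorph1 /= -tofrac_pB addr_eq0.
Qed.

Lemma uniq_01N1_cat (F : fieldType) (x y : F) : uniq [:: 0; 1; -1 : F] ->
  x != 0 -> y != 0 -> x != 1 -> y != 1 -> x != -1 -> y != -1 -> x != y ->
  uniq [:: 0; 1; -1; x; y].
Proof.
move=> u x0 y0 x1 y1 xN1 yN1 xy.
rewrite -[[:: 0; 1; -1; x; y]]/([:: 0; 1; -1] ++ [:: x; y]) cat_uniq u /= !inE.
by rewrite xy !negb_or x0 y0 x1 y1 xN1 yN1.
Qed.

Lemma uniq_B12 : uniq [:: 0; 1; -1; B 1; B 2].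
Proof.
apply: uniq_01N1_cat; try exact: B_neq0; try exact: B_neqN1.
- exact: (uniq_01N1 K_char0).
- by rewrite -B0; apply/negP => /eqP /B_inj.
- by rewrite -B0; apply/negP => /eqP /B_inj.
by apply/negP => /eqP /B_inj.
Qed.

(** * Extension of injective morphisms to fraction fields *)

Section FractionExtension.

Local Open Scope quotient_scope.

Variable R : idomainType.
Local Notation "x %:F" := (@FracField.tofrac R x).

Lemma fraction_numden (f : {fraction R}) :
  f = (\n_(repr f))%:F / (\d_(repr f))%:F.
Proof.
have d0 : (\d_(repr f))%:F != 0 by rewrite tofrac_eq0 denom_ratioP.
apply: (mulIf d0); rewrite divfK //; unlock FracField.tofrac.
rewrite -[in LHS](reprK f) -[LHS]FracField.pi_mul; apply/eqmodP => /=.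
rewrite FracField.equivfE /FracField.mulf !numden_Ratio ?oner_eq0 ?mulr1 ?mulf_neq0 ?denom_ratioP ?reprK //.
by rewrite mulrC.
Qed.

Variables (F : fieldType) (phi : {rmorphism R -> F}).
Hypothesis phi_neq0 : forall p, p != 0 -> phi p != 0.

Definition frac_ext (f : {fraction R}) : F := phi \n_(repr f) / phi \d_(repr f).

Lemma frac_extE p q : q != 0 -> frac_ext (p%:F / q%:F) = phi p / phi q.
Proof.
move=> q0; set f := _ / _; rewrite /frac_ext.
have d0 : \d_(repr f) != 0 by exact: denom_ratioP.
have E : \n_(repr f) * q = p * \d_(repr f).
  apply/eqP; rewrite -tofrac_eq !rmorphM; apply/eqP.
  have := fraction_numden f; rewrite {1}/f => /eqP.
  by rewrite eqr_div ?tofrac_eq0 // => /eqP ->.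
apply/eqP; rewrite eqr_div ?phi_neq0 //; apply/eqP.
by rewrite -!rmorphM E.
Qed.

Lemma frac_ext_tofrac p : frac_ext p%:F = phi p.
Proof. by rewrite -[p%:F]divr1 -tofrac1 frac_extE ?oner_eq0 // rmorph1 divr1. Qed.

Lemma frac_ext_is_zmod_morphism : zmod_morphism frac_ext.
Proof.
move=> f g; rewrite (fraction_numden f) (fraction_numden g).
move: (denom_ratioP (repr f)) (denom_ratioP (repr g)).
move: \n_(repr f) \d_(repr f) \n_(repr g) \d_(repr g) => p q r s q0 s0.
rewrite -mulNr addf_div ?tofrac_eq0 // -tofracN -!tofracM -tofracD.
rewrite !frac_extE ?mulf_neq0 // !(rmorphD, rmorphM, rmorphN).
by rewrite -[- (phi r / phi s)]mulNr addf_div ?phi_neq0.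
Qed.

Lemma frac_ext_is_monoid_morphism : monoid_morphism frac_ext.
Proof.
split; first by rewrite -tofrac1 frac_ext_tofrac rmorph1.
move=> f g; rewrite (fraction_numden f) (fraction_numden g).
move: (denom_ratioP (repr f)) (denom_ratioP (repr g)).
move: \n_(repr f) \d_(repr f) \n_(repr g) \d_(repr g) => p q r s q0 s0.
by rewrite mulf_div -!tofracM !frac_extE ?mulf_neq0 // !rmorphM mulf_div.
Qed.

End FractionExtension.

Section MultiplicativeCoordinate.

Variables (F : fieldType) (bt : F).
Hypothesis bt0 : bt != 0.

Lemma addK_div x : x = (1 + bt * x - 1) / bt.
Proof. by rewrite addrC addKr mulrC mulKf. Qed.

Lemma ominus0E x : 1 + bt * x != 0 -> 1 + bt * ominus bt 0 x = (1 + bt * x)^-1.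
Proof.
by move=> x0; rewrite /ominus; apply: (mulIf x0); rewrite mulVf // mulrDl mul1r mulrA divfK //; ring.
Qed.

Lemma oplusE x y : 1 + bt * oplus bt x y = (1 + bt * x) * (1 + bt * y).
Proof. by rewrite /oplus; ring. Qed.

Lemma ominusE x y : 1 + bt * y != 0 ->
  1 + bt * ominus bt x y = (1 + bt * x) / (1 + bt * y).
Proof. by move=> y0; rewrite /ominus; field. Qed.

Lemma inv_coordM u : u != 0 -> (u^-1 - 1) / bt * u = - ((u - 1) / bt).
Proof. by move=> u0; field; rewrite bt0 u0. Qed.

Lemma inv_coordV u : u != 0 -> - ((u^-1 - 1) / bt) = u^-1 * ((u - 1) / bt).
Proof. by move=> u0; field; rewrite bt0 u0. Qed.

Lemma quotient_perturb (p d e r r' : F) : d != 0 -> d + e * r' != 0 ->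
  (p + e * r) / (d + e * r') - p / d = e * ((r - r' * (p / d)) / (d + e * r')).
Proof. by move=> d0 d0'; field; rewrite d0 d0'. Qed.

End MultiplicativeCoordinate.

(** * Involutions in the Weyl group as field automorphisms *)

Section WeylAction.

(* [A] stands for [poly_ring], given abstractly by its generators: computing   *)
(* with the concrete ring would make unification diverge.                      *)
Variables (A : idomainType) (pc : {rmorphism {poly int} -> A}) (pv : nat -> A).
Hypothesis A_ind : forall Q : A -> Prop,
  (forall c, Q (pc c)) -> (forall k, Q (pv k)) ->
  (forall p q, Q p -> Q q -> Q (p + q)) -> (forall p q, Q p -> Q q -> Q (p * q)) ->
  forall p, Q p.

Notation F := {fraction A}.
Notation "x %:F" := (@FracField.tofrac A x).

Definition genbeta : F := (pc 'X)%:F.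
Definition genb (k : nat) : F := if k is k'.+1 then (pv k')%:F else 0.
Definition genB (k : nat) : F := 1 + genbeta * genb k.
Definition genbz (z : int) : F :=
  match z with Posz k => genb k | Negz k => ominus genbeta 0 (genb k.+1) end.
Definition genBz (z : int) : F :=
  match z with Posz k => genB k | Negz k => (genB k.+1)^-1 end.

Hypotheses (beta0 : genbeta != 0) (B_neq0 : forall k, genB k != 0).

Lemma genBzN z : genBz (- z) = (genBz z)^-1.
Proof.
case: z => [[|k]|k].
- by change (genB 0 = (genB 0)^-1); rewrite /genB /= mulr0 addr0 invr1.
- exact: erefl.
by change (genB k.+1 = (genB k.+1)^-1^-1); rewrite invrK.
Qed.

Lemma genbzE z : genbz z = (genBz z - 1) / genbeta.
Proof.
case: z => k; first exact: addK_div.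
rewrite /genBz /genB -ominus0E; last exact: B_neq0.
exact: addK_div.
Qed.

Definition genR (f : F) : Prop := exists (p : A) (s : seq nat),
  all (leq 1) s /\ f = p%:F / \prod_(i <- s) (1 + genbeta * genb i).

Lemma genR_tofrac p : genR p%:F.
Proof. by exists p, [::]; rewrite big_nil divr1. Qed.

Lemma genR1 : genR 1.
Proof. by rewrite -tofrac1; apply: genR_tofrac. Qed.

Definition genpB k : A := if k is k'.+1 then 1 + pc 'X * pv k' else 1.

Lemma genBE k : genB k = (genpB k)%:F.
Proof.
case: k => [|k]; first by rewrite /genB /= mulr0 addr0 tofrac1.
by rewrite /genB /= tofracD tofracM tofrac1.
Qed.

Lemma prod_genBE s : \prod_(i <- s) (1 + genbeta * genb i) = (\prod_(i <- s) genpB i)%:F.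
Proof. by rewrite rmorph_prod; apply: eq_bigr => i _; apply: genBE. Qed.

Lemma prod_genB_neq0 s : \prod_(i <- s) (1 + genbeta * genb i) != 0.
Proof. by rewrite prodf_seq_neq0; apply/allP => i _; apply: B_neq0. Qed.

Lemma genRM f g : genR f -> genR g -> genR (f * g).
Proof.
move=> [p [s [s1 ->]]] [q [t [t1 ->]]]; exists (p * q), (s ++ t).
by rewrite all_cat s1 t1 big_cat /= tofracM mulf_div.
Qed.

Lemma genRD f g : genR f -> genR g -> genR (f + g).
Proof.
move=> [p [s [s1 ->]]] [q [t [t1 ->]]].
exists (p * \prod_(i <- t) genpB i + q * \prod_(i <- s) genpB i), (s ++ t).
rewrite all_cat s1 t1 big_cat /= tofracD !tofracM -!prod_genBE.
by rewrite addf_div ?prod_genB_neq0.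
Qed.

Lemma genRN f : genR f -> genR (- f).
Proof. by rewrite -mulN1r => fR; apply: genRM => //; rewrite -tofrac1 -tofracN; apply: genR_tofrac. Qed.

Lemma genR_invB k : genR (genB k)^-1.
Proof.
case: k => [|k]; first by rewrite genBE tofrac1 invr1; apply: genR1.
by exists 1, [:: k.+1]; rewrite big_seq1 tofrac1 div1r.
Qed.

Lemma genR_Bz z : genR (genBz z).
Proof. by case: z => k; [rewrite /= genBE; apply: genR_tofrac | exact: (genR_invB k.+1)]. Qed.

Lemma genR_bz z : genR (genbz z).
Proof.
case: z => k; first by case: k => [|k]; rewrite /= -?tofrac0; apply: genR_tofrac.
rewrite /= /ominus sub0r; apply: genRM; last exact: (genR_invB k.+1).
by apply/genRN/genR_tofrac.
Qed.

Variable w : int -> int.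
Hypotheses (wK : involutive w) (wN : forall z, w (- z) = - w z).
Variable phi : {rmorphism A -> F}.
Hypotheses (phiC : forall c, phi (pc c) = (pc c)%:F).
Hypothesis phiX : forall k, phi (pv k) = genbz (w k.+1).

Lemma odd_int_map0 : w 0 = 0.
Proof. by have := wN 0; rewrite oppr0; case: (w 0) => [[|n]|n]. Qed.

Lemma phi_pB k : phi (genpB k) = genBz (w k).
Proof.
case: k => [|k]; first by rewrite odd_int_map0 rmorph1 /= genBE tofrac1.
rewrite rmorphD rmorph1 rmorphM /= phiC phiX -/genbeta genbzE.
by rewrite mulrC divfK // addrC subrK.
Qed.

(** Says that applying phi to the fraction P/D = phi p gives back p, as w is an involution; it is
    phrased without fractions because injectivity of phi, which follows from it, is what permits
    extending phi to them. *)
Lemma phi_inverse p : exists P D, [/\ phi p * D%:F = P%:F, phi D != 0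
  & phi P = phi D * p%:F].
Proof.
elim/A_ind: p => [c|k|p q|p q].
- by exists (pc c), 1; rewrite tofrac1 rmorph1 mulr1 mul1r oner_neq0 phiC.
- have wwk : w (w k.+1) = k.+1 by apply: wK.
  case E : (w k.+1) => [[|j]|j].
  + by move: wwk; rewrite E odd_int_map0.
  + exists (pv j), 1; rewrite tofrac1 rmorph1 mulr1 mul1r oner_neq0.
    by rewrite !phiX -E wwk E.
  exists (- pv j), (genpB j.+1).
  have wj : w j.+1 = - Posz k.+1.
    by rewrite -[LHS]opprK -wN -NegzE -E wwk.
  rewrite phi_pB -genBE wj genBzN !rmorphN /= !phiX E wj.
  have Bk := B_neq0 k.+1; have Bj := B_neq0 j.+1; split.
  + by rewrite -[(pv j)%:F]/(genbz j.+1) !genbzE inv_coordM.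
  + by rewrite invr_eq0.
  by rewrite -[(pv k)%:F]/(genbz k.+1) !genbzE genBzN inv_coordV.
- move=> [P [D [e1 d1 e2]]] [P' [D' [e1' d1' e2']]].
  exists (P * D' + P' * D), (D * D').
  rewrite !(rmorphM, rmorphD) /= -e1 -e1' e2 e2' mulf_neq0 //; split=> //; ring.
move=> [P [D [e1 d1 e2]]] [P' [D' [e1' d1' e2']]].
exists (P * P'), (D * D').
rewrite !rmorphM /= -e1 -e1' e2 e2' mulf_neq0 //; split=> //; ring.
Qed.

Lemma phi_neq0 p : p != 0 -> phi p != 0.
Proof.
have [P [D [e1 d1 e2]]] := phi_inverse p.
apply: contraNneq => p0; move: e1; rewrite p0 mul0r => /esym/eqP.
rewrite tofrac_eq0 => /eqP P0; move: e2; rewrite P0 rmorph0 => /esym/eqP.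
by rewrite mulf_eq0 (negbTE d1) tofrac_eq0.
Qed.

Lemma frac_ext_rmorphism : {sigma : {rmorphism F -> F} | sigma =1 frac_ext phi}.
Proof.
pose add := GRing.isZmodMorphism.Build F F (frac_ext phi)
  (frac_ext_is_zmod_morphism phi_neq0).
pose mul := GRing.isMonoidMorphism.Build F F (frac_ext phi)
  (frac_ext_is_monoid_morphism phi_neq0).
by exists (HB.pack_for {rmorphism F -> F} (frac_ext phi) add mul).
Qed.

Definition sigma : {rmorphism F -> F} := sval frac_ext_rmorphism.

Lemma sigmaE f : sigma f = frac_ext phi f.
Proof. exact: (svalP frac_ext_rmorphism). Qed.

Lemma sigma_tofrac p : sigma p%:F = phi p.
Proof. by rewrite sigmaE (frac_ext_tofrac phi_neq0). Qed.

Lemma sigma_beta : sigma genbeta = genbeta.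
Proof. by rewrite sigma_tofrac phiC. Qed.

Lemma sigma_Bz z : sigma (genBz z) = genBz (w z).
Proof.
have pos k : sigma (genB k) = genBz (w k) by rewrite genBE sigma_tofrac phi_pB.
by case: z => k; rewrite ?pos //= fmorphV pos NegzE wN genBzN.
Qed.

Lemma sigmaK : involutive sigma.
Proof.
have pE p : sigma (sigma p%:F) = p%:F.
  elim/A_ind: p => [c|k|p q ep eq|p q ep eq].
  - by rewrite !(sigma_tofrac, phiC).
  - rewrite -[(pv k)%:F]/(genbz k.+1) genbzE.
    by rewrite !(fmorph_div, rmorphB) /= !rmorph1 !sigma_beta -/(genBz k.+1) !sigma_Bz wK.
  - by rewrite tofracD !rmorphD /= ep eq.
  by rewrite tofracM !rmorphM /= ep eq.
by move=> f; rewrite (fraction_numden f) !fmorph_div /= !pE.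
Qed.

Lemma genR_sigma f : genR f -> genR (sigma f).
Proof.
move=> [p [s [_ ->]]]; rewrite fmorph_div /=; apply: genRM.
  elim/A_ind: p => [c|k|p q rp rq|p q rp rq].
  - by rewrite sigma_tofrac phiC; apply: genR_tofrac.
  - by rewrite sigma_tofrac phiX; apply: genR_bz.
  - by rewrite tofracD rmorphD; apply: genRD.
  by rewrite tofracM rmorphM; apply: genRM.
rewrite rmorph_prod -prodfV; apply: (big_ind genR) => [|x y xR yR|i _].
- exact: genR1.
- exact: genRM.
by rewrite -/(genB i) -[genB i]/(genBz i) sigma_Bz -genBzN; apply: genR_Bz.
Qed.

(** The condition on generators spreads to products by sigma(pq) - pq = (sigma p - p) sigma q + p
    (sigma q - q), and to quotients by [quotient_perturb]. *)
Lemma sigma_sub_mul (e : F) : (forall k : nat, exists2 r, genR r & genbz (w k) - genb k = e * r) ->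
  forall f, genR f -> exists2 r, genR r & sigma f - f = e * r.
Proof.
move=> we.
have pE p : exists2 r, genR r & sigma p%:F - p%:F = e * r.
  elim/A_ind: p => [c|k|p q [r rR rE] [r' rR' rE']|p q [r rR rE] [r' rR' rE']].
  - by exists 0; rewrite -?tofrac0 ?sigma_tofrac ?phiC; [apply: genR_tofrac | rewrite tofrac0 mulr0 subrr].
  - have [r rR rE] := we k.+1; exists r => //.
    by rewrite sigma_tofrac phiX -rE.
  - exists (r + r'); first exact: genRD.
    by rewrite tofracD rmorphD mulrDr -rE -rE'; ring.
  exists (r * sigma q%:F + p%:F * r').
    apply: genRD; apply: genRM => //; last exact: genR_tofrac.
    by apply/genR_sigma/genR_tofrac.
  rewrite tofracM rmorphM mulrDr !mulrA -rE [e * _]mulrC -mulrA -rE'; ring.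
move=> f [p [s [s1 ->]]]; rewrite prod_genBE; set d := \prod_(i <- s) genpB i.
have [r rR rE] := pE p; have [r' rR' rE'] := pE d.
have d0 : d%:F != 0 by rewrite -prod_genBE prod_genB_neq0.
have dV : genR d%:F^-1 by exists 1, s; rewrite prod_genBE tofrac1 div1r.
have sd0 : sigma d%:F != 0 by rewrite fmorph_eq0.
exists ((r - r' * (p%:F * d%:F^-1)) * (sigma d%:F^-1)).
  apply: genRM; last exact: genR_sigma.
  by apply: genRD => //; apply: genRN; do 2!apply: genRM => //; apply: genR_tofrac.
have -> : sigma (p%:F / d%:F) = (p%:F + e * r) / sigma d%:F.
  by rewrite fmorph_div -rE addrC subrK.
rewrite [sigma d%:F^-1]fmorphV; move: sd0; have -> : sigma d%:F = d%:F + e * r' by rewrite -rE' addrC subrK.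
exact: quotient_perturb.
Qed.

End WeylAction.

(** * The Weyl group action on strict partitions *)

Section Codes.

Implicit Types (X : cartan) (l m : SP) (S : seq nat) (a : Defs.root) (w : int -> int).

Lemma gtn_trans : transitive gtn.
Proof. by move=> y x z /= xy yz; apply: ltn_trans yz xy. Qed.

Lemma gtn_irr : irreflexive gtn.
Proof. by move=> x; rewrite /= ltnn. Qed.

Lemma parts_sorted l : sorted gtn (parts l).
Proof. by case/andP: (partsP l). Qed.

Lemma parts_pos l : 0%N \notin parts l.
Proof. by case/andP: (partsP l). Qed.

Definition typeD X := if X is TypeD then true else false.

Lemma code_sorted X l : sorted gtn (code X l).
Proof.
have s1 : sorted gtn [seq k.+1 | k <- parts l].
  by rewrite sorted_map; apply: sub_sorted (parts_sorted l) => x y.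
case: X => /=; try exact: parts_sorted.
case: ifP => _ //; rewrite sorted_pairwise; last exact: gtn_trans.
rewrite pairwise_rcons -sorted_pairwise ?s1 ?andbT; last exact: gtn_trans.
apply/allP => _ /mapP[k kl ->] /=; rewrite ltnS lt0n.
by apply: contraNneq (parts_pos l) => <-.
Qed.

Lemma code_uniq X l : uniq (code X l).
Proof. exact: sorted_uniq gtn_trans gtn_irr _ (code_sorted X l). Qed.

Lemma code_pos X l : 0%N \notin code X l.
Proof.
have s1 : 0%N \notin [seq k.+1 | k <- parts l] by apply/mapP => -[].
by case: X => /=; rewrite ?parts_pos //; case: ifP; rewrite ?mem_rcons ?inE.
Qed.

Lemma code_even X l : typeD X -> ~~ odd (size (code X l)).
Proof.
by case: X => //= _; case: ifP; rewrite ?size_rcons /= size_map => ->.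
Qed.

Lemma code_inj X l m : code X l =i code X m -> l = m.
Proof.
move=> eqc; have {eqc} eqc : code X l = code X m.
  by apply: (irr_sorted_eq gtn_trans gtn_irr); rewrite ?code_sorted.
apply: val_inj; case: X eqc => //= eqc.
(* In type D the parts are recovered by deleting a possible 1 from the code and subtracting one. *)
have predE (k : SP) : parts k = [seq x.-1 | x <- code TypeD k & (1 < x)%N].
  have E : [seq x <- [seq x.+1 | x <- parts k] | (1 < x)%N] = [seq x.+1 | x <- parts k].
    apply/all_filterP/allP => _ /mapP[x xk ->]; rewrite ltnS lt0n.
    by apply: contraNneq (parts_pos k) => <-.
  rewrite /=; case: ifP => _; rewrite ?filter_rcons /= E -map_comp;
    by rewrite map_id_in.
by rewrite -[LHS]/(parts l) -[RHS]/(parts m) (predE l) (predE m) /= eqc.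
Qed.

Lemma code_surj X S : uniq S -> 0%N \notin S -> (typeD X -> ~~ odd (size S)) ->
  exists l, code X l =i S.
Proof.
move=> uS S0 evS.
have [s sS ss] : exists2 s, perm_eq s S & sorted gtn s.
  exists (rev (sort leq S)); first by rewrite perm_rev perm_sort.
  rewrite rev_sorted ltn_sorted_uniq_leq sort_uniq uS /=.
  exact: sort_sorted leq_total _.
have us : uniq s by rewrite (perm_uniq sS).
have s0 : 0%N \notin s by rewrite (perm_mem sS).
have BC : is_strict s by rewrite /is_strict ss.
case: X evS => evS; try by exists (MkSP BC) => k; rewrite -(perm_mem sS).
pose f := [seq k <- s | (1 < k)%N].
have fE : [seq k.+1 | k <- [seq k.-1 | k <- f]] = f.
  rewrite -map_comp map_id_in // => k; rewrite mem_filter => /andP[k1 _] /=.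
  by rewrite prednK // ltnW.
have sf : sorted gtn [seq k.-1 | k <- f].
  have : sorted gtn f by apply: (sorted_filter gtn_trans); exact: ss.
  by rewrite -{1}fE sorted_map; apply: sub_sorted => x y.
have f0 : 0%N \notin [seq k.-1 | k <- f].
  by apply/mapP => -[k]; rewrite mem_filter; case: k => [|[|k]].
have strict : is_strict [seq k.-1 | k <- f] by rewrite /is_strict sf.
exists (MkSP strict) => k; rewrite -(perm_mem sS) /= fE.
have memf : (k \in f) = (1 < k)%N && (k \in s) by rewrite mem_filter.
have szE : size s = (size f + (1%N \in s))%N.
  rewrite -(count_predC (ltn 1) s) size_filter; congr (_ + _)%N.
  rewrite -(count_uniq_mem _ us); apply: eq_in_count => x xs /=.
  rewrite -leqNgt; case: x xs => [|[|x]] //; by rewrite (negbTE s0).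
have {evS} : ~~ odd (size s) by rewrite (perm_size sS) evS.
rewrite size_map szE oddD; case s1 : (1%N \in s) => /=; last first.
  rewrite addbF => /negbTE ->; rewrite memf; case: k memf => [|[|k]] // _ /=; rewrite ?s1 //.
  by rewrite (negbTE s0).
rewrite addbT negbK => ->; rewrite mem_rcons inE memf.
case: k memf => [|[|k]] // _ /=; rewrite ?s1 //.
by rewrite (negbTE s0).
Qed.

(** Turns S into a set containing exactly one of z and -z for each nonzero z, the negative of
    [signed_code]; signed permutations act on such sets by taking images. *)
Definition in_code S (z : int) : bool :=
  match z with Posz k => k \in S | Negz k => k.+1 \notin S end.

Lemma in_codeN S z : z != 0 -> in_code S (- z) = ~~ in_code S z.
Proof.
case: z => [[|k]|k] // _.
by rewrite NegzE opprK -NegzE /= negbK.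
Qed.

Lemma signed_codeP X l z : z != 0 -> signed_code X l z <-> in_code (code X l) (- z).
Proof.
move=> z0; rewrite in_codeN //; case: z z0 => [[|k]|k] // _; split=> /=.
- by case=> [[[|s] sl] //|[n /andP[_ nl] [->]]].
- by move=> kl; right; exists k.+1.
- by case=> [[[|s] sl] // [->]|[n nl //]]; rewrite negbK.
by rewrite negbK => kl; left; exists k.+1; rewrite // NegzE.
Qed.

Definition odd_involution w := involutive w /\ forall z, w (- z) = - w z.

Lemma odd_involution0 w : odd_involution w -> w 0 = 0.
Proof. by case=> _ wN; have := wN 0; rewrite oppr0; case: (w 0) => [[|n]|n]. Qed.

Lemma is_act_inverseP X w w' l m : cancel w w' -> cancel w' w ->
    w' 0 = 0 -> (forall z, w' (- z) = - w' z) ->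
  is_act X w l m <-> forall i, (0 < i)%N -> (i \in code X m) = in_code (code X l) (w' i).
Proof.
move=> wK wK' w0 wN.
have key (i : nat) : (0 < i)%N ->
    (exists2 z, signed_code X l z & w z = - Posz i) <-> in_code (code X l) (w' i).
  move=> i0; have wi0 : w' i != 0.
    apply: contraTneq i0 => wi; have /(can_inj wK') : w' i = w' 0 by rewrite wi w0.
    by case=> ->.
  split=> [[z zl wz]|wil].
    have zE : z = - w' i by rewrite -(wK z) wz wN.
    by move: zl; rewrite zE signed_codeP ?oppr_eq0 // opprK.
  exists (- w' i); last by rewrite -wN wK'.
  by rewrite signed_codeP ?oppr_eq0 // opprK.
split=> H i i0.
  by apply/idP/idP => [/(H i i0)/key -> //|/(key i i0)/(H i i0)].
by rewrite (H i i0); apply: iff_sym; apply: key.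
Qed.

Lemma is_actP X w l m : odd_involution w ->
  is_act X w l m <-> forall i, (0 < i)%N -> (i \in code X m) = in_code (code X l) (w i).
Proof.
move=> ow; have w0 := odd_involution0 ow; case: ow => wK wN.
exact: is_act_inverseP.
Qed.

Lemma act_uniq X w l m : is_act X w l m -> Defs.act X w l = m.
Proof.
move=> wm; have wa : is_act X w l (Defs.act X w l) by apply: epsilon_spec; exists m.
apply: (@code_inj X) => -[|i]; first by rewrite !(negbTE (code_pos _ _)).
by apply/idP/idP => [/(wa i.+1 isT)/(wm i.+1 isT)|/(wm i.+1 isT)/(wa i.+1 isT)].
Qed.

Lemma code_act X w l S : odd_involution w -> uniq S -> 0%N \notin S ->
    (typeD X -> ~~ odd (size S)) ->
    (forall i : nat, (0 < i)%N -> (i \in S) = in_code (code X l) (w i)) ->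
  code X (Defs.act X w l) =i S /\ is_act X w l (Defs.act X w l).
Proof.
move=> ow uS S0 evS SE; have [m mE] := code_surj uS S0 evS.
have am : is_act X w l m by apply/is_actP => // i i0; rewrite mE SE.
by rewrite (act_uniq am).
Qed.

End Codes.

(** * Reflections on codes, and removable boxes *)

Section Reflections.

Implicit Types (X : cartan) (l m : SP) (S : seq nat) (a : Defs.root) (w : int -> int).

Definition proper_root a : bool :=
  match a with
  | Rt i | Rtt i => (0 < i)%N
  | Rminus j i | Rplus j i => (0 < i)%N && (i < j)%N
  end.

Lemma positive_root_proper X a : positive_root X a -> proper_root a.
Proof. by case: a => [i|i|j i|j i]; case: X. Qed.

Definition swap i j k : nat := if k == i then j else if k == j then i else k.

Lemma swapK i j : involutive (swap i j).
Proof.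
move=> k; rewrite /swap; have [->|ki] := eqVneq k i.
  by rewrite eqxx; have [->|] := eqVneq j i.
by have [->|kj] := eqVneq k j; rewrite ?eqxx // (negbTE ki) (negbTE kj).
Qed.

Definition refl_nat a (k : nat) : int :=
  match a with
  | Rt i | Rtt i => if k == i then - Posz k else Posz k
  | Rminus j i => Posz (swap i j k)
  | Rplus j i => if k == i then - Posz j else if k == j then - Posz i else Posz k
  end.

Lemma refl_Posz a k : (0 < k)%N -> refl a (Posz k) = refl_nat a k.
Proof.
by case: k => // k _; case: a => [i|i|j i|j i] //=; rewrite /swap;
   do 2?[case: ifP => _]; rewrite /= ?mul1r ?mulN1r.
Qed.

Lemma refl0 a : proper_root a -> refl a 0 = 0.
Proof.
case: a => [i|i|j i|j i] /=; try by case: ifP => // _ _; rewrite oppr0.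
  by case/andP=> i0 ij; rewrite /= !ltn_eqF // (ltn_trans i0).
by case/andP=> i0 ij; rewrite /= !ltn_eqF // (ltn_trans i0).
Qed.

Lemma refl_odd a z : refl a (- z) = - refl a z.
Proof.
have sgN (x : int) : Num.sg (- x) = - Num.sg x by case: x => [[|k]|k].
case: a => [i|i|j i|j i] /=; rewrite abszN ?sgN;
  do 2?[case: ifP => _]; by rewrite ?mulNr ?opprK.
Qed.

Lemma refl_involutive a : proper_root a -> involutive (refl a).
Proof.
move=> pa; have pos k : (0 < k)%N -> refl a (refl a (Posz k)) = Posz k.
  move=> k0; rewrite (refl_Posz _ k0); case: a pa => [i|i|j i|j i] pa.
  - rewrite {1}/refl_nat; case: ifP => ki; rewrite ?refl_odd refl_Posz // /refl_nat ki //.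
    by rewrite opprK.
  - rewrite {1}/refl_nat; case: ifP => ki; rewrite ?refl_odd refl_Posz // /refl_nat ki //.
    by rewrite opprK.
  - case/andP: pa => i0 ij; rewrite {1}/refl_nat refl_Posz /refl_nat ?swapK //.
    by rewrite /swap; case: ifP => _; [lia|case: ifP].
  case/andP: pa => i0 ij; rewrite {1}/refl_nat.
  have [ki|ki] := eqVneq k i.
    rewrite refl_odd refl_Posz /refl_nat; last by lia.
    by rewrite eqxx gtn_eqF // opprK ki.
  have [kj|kj] := eqVneq k j.
    by rewrite refl_odd refl_Posz // /refl_nat eqxx opprK kj.
  by rewrite refl_Posz // /refl_nat (negbTE ki) (negbTE kj).
case=> [[|k]|k]; first by rewrite !refl0.
  exact: pos.
by rewrite NegzE !refl_odd pos.
Qed.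

Lemma refl_odd_involution a : proper_root a -> odd_involution (refl a).
Proof. by move=> pa; split; [apply: refl_involutive|apply: refl_odd]. Qed.

Definition refl_set a S : seq nat :=
  match a with
  | Rt i | Rtt i => if i \in S then rem i S else i :: S
  | Rminus j i => [seq swap i j k | k <- S]
  | Rplus j i => if (i \in S) && (j \in S) then rem i (rem j S)
                 else if (i \in S) || (j \in S) then S else [:: i, j & S]
  end.

Lemma refl_set_uniq a S : proper_root a -> uniq S -> uniq (refl_set a S).
Proof.
case: a => [i|i|j i|j i] /= pa uS.
- by case: ifP => iS; rewrite ?rem_uniq //= iS.
- by case: ifP => iS; rewrite ?rem_uniq //= iS.
- by rewrite map_inj_uniq //; apply: can_inj (swapK i j).
case iS : (i \in S); case jS : (j \in S) => //=; first by rewrite !rem_uniq.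
by rewrite inE iS jS uS; case/andP: pa => _ /ltn_eqF->.
Qed.

Lemma mem_refl_set a S i : proper_root a -> uniq S -> 0%N \notin S ->
  (i \in refl_set a S) = (0 < i)%N && in_code S (refl_nat a i).
Proof.
move=> pa uS S0.
have neg (k : nat) : (0 < k)%N -> in_code S (- Posz k) = (k \notin S) by case: k.
have pos : (i \in S) -> (0 < i)%N by case: i => //; rewrite (negbTE S0).
have one j : (0 < j)%N -> (i \in (if j \in S then rem j S else j :: S)) =
    (0 < i)%N && in_code S (if i == j then - Posz i else Posz i).
  move=> j0; have [->|ij] := eqVneq i j.
    by rewrite j0 neg //; case: ifP => jS; rewrite ?mem_rem_uniq ?inE ?eqxx.
  transitivity (i \in S); first by case: ifP => jS; rewrite ?mem_rem_uniq ?inE ?(negbTE ij).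
  by rewrite /=; case iS: (i \in S); rewrite ?andbF // pos.
case: a pa => [j|j|j h|j h] pa; [exact: one | exact: one | |]; case/andP: pa => h0 hj.
  rewrite /refl_set /refl_nat /= -[i in LHS](swapK h j) (mem_map (can_inj (swapK h j))).
  have [->|i0] := posnP i; last by [].
  by rewrite /swap !ltn_eqF ?(negbTE S0) // (ltn_trans h0).
have j0 : (0 < j)%N by apply: ltn_trans hj.
rewrite /refl_set /refl_nat.
have [->|ih] := eqVneq i h.
  rewrite h0 neg //; case hS : (h \in S); case jS : (j \in S) => /=.
  - by rewrite mem_rem_uniq ?rem_uniq // !inE eqxx.
  - by rewrite hS.
  - by rewrite hS.
  by rewrite inE eqxx.
have [->|ij] := eqVneq i j.
  rewrite j0 neg //; case hS : (h \in S); case jS : (j \in S) => /=.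
  - by rewrite (mem_rem_uniq h (rem_uniq j uS)) inE (mem_rem_uniqF _ uS) andbF.
  - by rewrite jS.
  - by rewrite jS.
  by rewrite !inE eqxx orbT.
transitivity (i \in S).
  case: ifP => _; first by rewrite (mem_rem_uniq h (rem_uniq j uS)) inE ih (mem_rem_uniq j uS) inE ij.
  by case: ifP => _ //; rewrite !inE (negbTE ih) (negbTE ij).
by rewrite /=; case iS: (i \in S); rewrite ?andbF // pos.
Qed.

Lemma code_refl X a l : positive_root X a ->
  perm_eq (code X (Defs.act X (refl a) l)) (refl_set a (code X l)) /\
  is_act X (refl a) l (Defs.act X (refl a) l).
Proof.
move=> pX; have pa := positive_root_proper pX.
have uS := code_uniq X l; have S0 := code_pos X l.
have uR : uniq (refl_set a (code X l)) by apply: refl_set_uniq.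
have [|||||cE ?] := @code_act X (refl a) l (refl_set a (code X l)).
- exact: refl_odd_involution.
- exact: uR.
- by rewrite mem_refl_set.
- move=> D; have := @code_even X l D; case: X D pX uS S0 uR => // _.
  set S := code TypeD l; case: a pa => // j i pa _ uS S0 uR ev.
    by rewrite /= size_map.
  rewrite /refl_set; case: ifP => [/andP[iS jS]|_]; last by case: ifP => _ //=; rewrite negbK.
  have ij : i != j by case/andP: pa => _ /ltn_eqF->.
  have ir : i \in rem j S by rewrite mem_rem_uniq // !inE ij.
  move: ev; rewrite (perm_size (perm_to_rem jS)) /= (perm_size (perm_to_rem ir)) /=.
  by rewrite negbK.
- by move=> i i0; rewrite mem_refl_set // i0 refl_Posz.
by split=> //; apply: uniq_perm => //; apply: code_uniq.
Qed.

Lemma simple_root_positive X i : positive_root X (simple_root X i).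
Proof. by case: i => [|i] /=; [case: X | case: X; rewrite /= ltnSn]. Qed.

Lemma simple_root_proper X i : proper_root (simple_root X i).
Proof. exact: positive_root_proper (simple_root_positive X i). Qed.

Lemma refl_neq0 a z : proper_root a -> z != 0 -> refl a z != 0.
Proof.
by move=> pa; apply: contra_neq => wz; rewrite -(refl_involutive pa z) wz refl0.
Qed.

Lemma in_code_act X a l z : positive_root X a -> z != 0 ->
  in_code (code X (Defs.act X (refl a) l)) z = in_code (code X l) (refl a z).
Proof.
move=> pX; have pa := positive_root_proper pX; have ow := refl_odd_involution pa.
have [_ /(is_actP _ _ _ ow) H] := code_refl l pX.
case: z => [[|k]|k] // _; first exact: H.
by rewrite NegzE refl_odd !in_codeN ?refl_neq0 //= H.
Qed.

Lemma eq_act X a a' d d' l :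
    positive_root X a -> positive_root X a' -> positive_root X d -> positive_root X d' ->
    (forall z, refl a (refl a' z) = refl d (refl d' z)) ->
  Defs.act X (refl a') (Defs.act X (refl a) l) = Defs.act X (refl d') (Defs.act X (refl d) l).
Proof.
move=> pa pa' pd pd' E; apply: (@code_inj X) => -[|i].
  by rewrite !(negbTE (code_pos _ _)).
have P k : (k.+1 \in code X l) = in_code (code X l) (Posz k.+1) by [].
rewrite -[LHS]/(in_code _ (Posz i.+1)) -[RHS]/(in_code _ (Posz i.+1)).
by rewrite !in_code_act ?refl_neq0 ?(positive_root_proper pa') ?(positive_root_proper pd') // E.
Qed.

Lemma act_involutive X a : positive_root X a -> involutive (Defs.act X (refl a)).
Proof.
move=> pX l; have pa := positive_root_proper pX; apply: (@code_inj X) => -[|i].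
  by rewrite !(negbTE (code_pos _ _)).
rewrite -[LHS]/(in_code _ (Posz i.+1)) -[RHS]/(in_code _ (Posz i.+1)).
by rewrite !in_code_act ?refl_neq0 // refl_involutive.
Qed.

(* Number of boxes of the shifted diagram of a partition with code S. *)
Definition wt X S : nat := \sum_(k <- S) (if typeD X then k.-1 else k).

Lemma wt_perm X S S' : perm_eq S S' -> wt X S = wt X S'.
Proof. exact: perm_big. Qed.

(** Removing a box of content i > 0 lowers the element i+1 of the code to i; the special box removes
    the element 1, or the pair 2, 1 in type D. *)
Definition removable X i S : bool :=
  match i with
  | i'.+1 => (i'.+2 \in S) && (i'.+1 \notin S)
  | 0 => if typeD X then (2 \in S) && (1 \in S) else 1 \in S
  end%N.

Lemma wt_cons X k S : wt X (k :: S) = ((if typeD X then k.-1 else k) + wt X S)%N.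
Proof. exact: big_cons. Qed.

Lemma wt_rem X k S : k \in S -> wt X S = ((if typeD X then k.-1 else k) + wt X (rem k S))%N.
Proof. by move=> kS; rewrite -wt_cons; apply/wt_perm/perm_to_rem. Qed.

Lemma map_swap_id i j S : i \notin S -> j \notin S -> [seq swap i j k | k <- S] = S.
Proof.
move=> iS jS; apply: map_id_in => k kS; rewrite /swap.
by rewrite !ifN //; [apply: contraNneq jS => <-|apply: contraNneq iS => <-].
Qed.

(** Through this trichotomy, Bruhat comparisons of l with s_i l reduce to comparing numbers of
    boxes. *)
Lemma wt_act X i l : let l' := Defs.act X (simple_refl X i) l in
  if removable X i (code X l) then (wt X (code X l') + 1 = wt X (code X l))%N
  else l' = l \/ (wt X (code X l') = wt X (code X l) + 1)%N.
Proof.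
have pX := simple_root_positive X i.
have [pS _] := code_refl l pX; rewrite /= (wt_perm X pS).
have uS := code_uniq X l; have S0 := code_pos X l.
have same : refl_set (simple_root X i) (code X l) =i code X l ->
    Defs.act X (simple_refl X i) l = l.
  by move=> E; apply: (@code_inj X) => k; rewrite (perm_mem pS) E.
set S := code X l in uS S0 same pS *.
case: i pX pS same => [|i] pX pS same.
  rewrite /removable; case: X l @S pX pS same uS S0 => l S pX pS same uS S0 /=.
  - case S1 : (1%N \in S); first by rewrite (wt_rem _ S1) addnC.
    by right; rewrite wt_cons addnC.
  - case S1 : (1%N \in S); first by rewrite (wt_rem _ S1) addnC.
    by right; rewrite wt_cons addnC.
  case S2 : (2%N \in S); case S1 : (1%N \in S) => /=.
  - have S2' : 2%N \in rem 1%N S by rewrite mem_rem_uniq // !inE S2.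
    have S1' : 1%N \in rem 2%N S by rewrite mem_rem_uniq // !inE S1.
    by rewrite (wt_rem _ S2) (wt_rem _ S1') /= addnC.
  - by left; apply: same => k; rewrite /= S1 S2.
  - by left; apply: same => k; rewrite /= S1 S2.
  by right; rewrite !wt_cons /= add0n addnC.
have pa := positive_root_proper pX.
have perm_swap j k (jS : j \in S) (kS : k \notin S) :
    perm_eq [seq swap j k x | x <- S] (k :: rem j S).
  rewrite (perm_trans (perm_map _ (perm_to_rem jS))) //= map_swap_id ?mem_rem_uniqF //.
    by rewrite /swap eqxx.
  by rewrite (contra (@mem_rem _ _ _ _) kS).
have swapC (j k x : nat) : swap j k x = swap k j x.
  by rewrite /swap; case: (eqVneq x j) => [->|]; case: eqVneq.
rewrite /removable /=; case Si1 : (i.+2 \in S); case Si : (i.+1 \in S) => /=.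
- left; apply: same => k; rewrite mem_refl_set // -[refl_nat _ _]/(Posz (swap i.+1 i.+2 k)) /= /swap.
  have [->|_] := eqVneq k i.+1; first by rewrite Si1 Si.
  have [->|_] := eqVneq k i.+2; first by rewrite Si1 Si.
  by case: k => //; rewrite (negbTE S0).
- under eq_map do rewrite swapC.
  rewrite (wt_perm X (perm_swap _ _ Si1 (negbT Si))) wt_cons (wt_rem X Si1).
  by case: typeD; rewrite ?addSn addn1.
- right; rewrite (wt_perm X (perm_swap _ _ Si (negbT Si1))) wt_cons (wt_rem X Si).
  by case: typeD; rewrite ?addSn addn1.
left; apply: same => k; rewrite mem_refl_set // -[refl_nat _ _]/(Posz (swap i.+1 i.+2 k)) /= /swap.
have [->|_] := eqVneq k i.+1; first by rewrite Si1 Si.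
have [->|_] := eqVneq k i.+2; first by rewrite Si1 Si.
by case: k => //; rewrite (negbTE S0).
Qed.

Lemma wt_act_le X i l :
  (wt X (code X (Defs.act X (simple_refl X i) l)) <= (wt X (code X l)).+1)%N.
Proof.
have := wt_act X i l; rewrite /=; case: ifP => _; first by lia.
by case=> [->|->]; lia.
Qed.

(** From an element above 1 go down through consecutive elements: either a gap occurs, or 2 and 1
    are both present. Otherwise the code lies in {1}; in type D it is then empty, having even
    size. *)
Lemma exists_removable X l : l <> emptySP -> exists i, removable X i (code X l).
Proof.
move=> l0; have S0 := code_pos X l.
have big k : (1 < k)%N -> k \in code X l -> exists i, removable X i (code X l).
  elim: k => [|[|[|k]] IHk] // _ kl.
    case S1 : (1%N \in code X l); last by exists 1%N; rewrite /= kl S1.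
    by exists 0%N; rewrite /removable kl S1; case: X {l0 S0 IHk kl S1}.
  case Sk : (k.+2 \in code X l); first exact: IHk.
  by exists k.+2; rewrite /= kl Sk.
case S2 : (has (ltn 1) (code X l)).
  by case/hasP: S2 => k kl k1; apply: (big k).
have sub : {subset code X l <= [:: 1%N]}.
  move=> k kl; rewrite inE; case: k kl => [|[|k]] kl //.
    by rewrite kl in S0.
  by move/hasPn: (negbT S2) => /(_ _ kl).
have le1 := uniq_leq_size (code_uniq X l) sub.
case E : (code X l) => [|k S].
  by case: l0; apply: (@code_inj X); rewrite E; case: (X).
have k1 : k = 1%N by apply/eqP; have := sub k; rewrite E mem_head inE => ->.
exists 0%N; rewrite /removable; case D : (typeD X); last by rewrite k1 mem_head.
have := @code_even X l; rewrite D => /(_ isT); move: le1; rewrite E.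
by case: (S).
Qed.

(** * Words, lengths and the Bruhat order *)

Lemma is_act_eq X u v l m : u =1 v -> is_act X u l m -> is_act X v l m.
Proof.
move=> uv um i i0; split=> [/(um i i0)[z zl uz]|[z zl vz]]; first by exists z; rewrite -?uv.
by apply/(um i i0); exists z; rewrite ?uv.
Qed.

Fixpoint word_inv X (s : seq nat) (z : int) : int :=
  if s is i :: s' then word_inv X s' (simple_refl X i z) else z.

Definition act_word X (s : seq nat) l : SP :=
  foldr (fun i => Defs.act X (simple_refl X i)) l s.

Lemma simple_involutive X i : involutive (simple_refl X i).
Proof. exact/refl_involutive/positive_root_proper/simple_root_positive. Qed.

Lemma word_odd X s z : word X s (- z) = - word X s z.
Proof. by elim: s => //= i s ->; apply: refl_odd. Qed.

Lemma word_inv_odd X s z : word_inv X s (- z) = - word_inv X s z.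
Proof. by elim: s z => //= i s IHs z; rewrite [simple_refl X i _]refl_odd IHs. Qed.

Lemma word_invK X s : cancel (word X s) (word_inv X s).
Proof. by elim: s => //= i s IHs z; rewrite simple_involutive. Qed.

Lemma wordK X s : cancel (word_inv X s) (word X s).
Proof. by elim: s => //= i s IHs z; rewrite /= IHs simple_involutive. Qed.

Lemma act_wordP X s l :
  is_act X (word X s) l (act_word X s l) /\ Defs.act X (word X s) l = act_word X s l.
Proof.
have H : is_act X (word X s) l (act_word X s l).
  have w0 : word_inv X s 0 = 0.
    by elim: s => //= i s IHs; rewrite [simple_refl X i 0](refl0 (simple_root_proper X i)).
  apply/(is_act_inverseP _ _ _ (@word_invK X s) (@wordK X s) w0 (@word_inv_odd X s)).
  suff E z : z != 0 -> in_code (code X (act_word X s l)) z = in_code (code X l) (word_inv X s z).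
    by move=> i i0; rewrite -E //; rewrite eqz_nat -lt0n.
  elim: s {w0} z => //= i s IHs z z0.
  rewrite in_code_act ?(simple_root_positive X) // IHs //.
  exact: refl_neq0 (simple_root_proper X i) z0.
by split=> //; apply: act_uniq.
Qed.

Lemma wt_emptySP X : wt X (code X emptySP) = 0%N.
Proof. by case: X; rewrite /wt big_nil. Qed.

Lemma wt_act_word X s : (wt X (code X (act_word X s emptySP)) <= size s)%N.
Proof.
elim: s => [|i s IHs]; first by rewrite wt_emptySP.
exact: leq_trans (wt_act_le X i _) _.
Qed.

(** Remove boxes one at a time; the word records the removed contents. *)
Lemma exists_word X l : exists2 s, size s = wt X (code X l) & act_word X s emptySP = l.
Proof.
have [n] := ubnP (wt X (code X l)); elim: n l => // n IHn l ltn.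
have [->|l0] := eqVneq l emptySP; first by exists [::]; rewrite ?wt_emptySP.
have [i ri] := exists_removable X (elimN eqP l0).
have := wt_act X i l; rewrite /= ri => wE.
have [|s szs sE] := IHn (Defs.act X (simple_refl X i) l); first by lia.
exists (i :: s); first by rewrite /= szs -addn1.
by rewrite /= sE; apply: act_involutive; apply: simple_root_positive.
Qed.

Lemma word_weyl X s : weyl X (word X s).
Proof.
suff : signed_perm (word X s) by case: X => //= _; exists s.
split; first by exists (word_inv X s); [apply: word_invK|apply: wordK].
- exact: word_odd.
elim: s => [|i s [N IHs]]; first by exists 0%N.
exists (maxn N i.+2) => z; rewrite gtn_max => /andP[Nz iz]; rewrite /= IHs //.
by clear IHs; case: i iz => [|i] iz; [case: X|]; rewrite /simple_refl /= !gtn_eqF //; lia.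
Qed.

(** Some word with as many letters as boxes leads from the empty partition to l, and no shorter one
    can, since each letter adds at most one box. *)
Lemma min_rep_length X l u k : min_rep X l u -> has_length X u k ->
  k = wt X (code X l).
Proof.
case=> wu ul min_u len_u; apply/eqP; rewrite eqn_leq; apply/andP; split.
  have [s szs sE] := exists_word X l.
  have [d] : exists d, has_length X (word X s) d.
    pose P n := exists2 t, size t = n & word X s =1 word X t.
    have Ps : exists n, P n by exists (size s), s.
    (* Equality with a word is not decidable, so the least size is found by classical descent. *)
    have [n [[t tn st] nmin]] : exists n, P n /\ forall n', P n' -> (n <= n')%N.
      case: Ps => n; elim/ltn_ind: n => n IHn Pn.
      have [[n' [lt' Pn']]|no] := classic (exists n', (n' < n)%N /\ P n'); first exact: IHn Pn'.
      exists n; split=> // n' Pn'; rewrite leqNgt; apply/negP => lt'.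
      by apply: no; exists n'.
    by exists n; split; [exists t | move=> t' tE; apply: nmin; exists t'].
  move=> len_s; apply: leq_trans (min_u _ _ _ (word_weyl X s) _ len_u len_s) _.
    by rewrite (act_wordP X s emptySP).2.
  by rewrite -szs; apply: len_s.2.
case: len_u => [[s <- us] _]; have [aw awE] := act_wordP X s emptySP.
have /act_uniq : is_act X u emptySP (act_word X s emptySP) by apply: is_act_eq aw => z; rewrite us.
by rewrite ul => ->; apply: wt_act_word.
Qed.

Lemma bruhat_length X u v : bruhat X u v ->
  u =1 v \/ exists k d, [/\ has_length X u k, has_length X v d & (k < d)%N].
Proof.
elim=> [u' v' uv|u' v' w' a k d _ _ lu lv lt _ [vw|[k' [d' [lv' lw lt']]]]]; first by left.
  right; exists k, d; split=> //; case: lv => [[s szs sv] minv]; split.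
    by exists s => // z; rewrite -vw.
  by move=> t tw; apply: minv => z; rewrite vw.
right; exists k, d'; split=> //; apply: leq_trans lt' => //.
suff -> : k' = d by apply: ltnW.
case: lv lv' => [[s szs sv] minv] [[s' szs' sv'] minv'].
by apply/eqP; rewrite eqn_leq -{1}szs -{2}szs' minv' // minv.
Qed.

(** Lengths increase along the Bruhat order, and lengths of minimal representatives count boxes. *)
Lemma leSP_wt X l m : leSP X l m -> (wt X (code X l) <= wt X (code X m))%N.
Proof.
case=> u [v [ml mv /bruhat_length[uv|[k [k' [lu lv lt]]]]]].
  case: ml mv => _ <- _ [_ <- _].
  (* [act] is an epsilon term in the function itself, so pointwise equality has to become
     equality. *)
  by rewrite (functional_extensionality _ _ uv).
by rewrite -(min_rep_length ml lu) -(min_rep_length mv lv) ltnW.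
Qed.

Lemma ltSP_removable X i l : ltSP X (Defs.act X (simple_refl X i) l) l ->
  removable X i (code X l).
Proof.
case=> /leSP_wt; have := wt_act X i l; rewrite /=; case: ifP => // _.
by case=> -> //; lia.
Qed.

Lemma leSP_not_removable X i l : leSP X l (Defs.act X (simple_refl X i) l) ->
  ~~ removable X i (code X l).
Proof.
move=> /leSP_wt; have := wt_act X i l; rewrite /=; case: ifP => // _; lia.
Qed.

End Reflections.

(** * Divided differences *)

Section SortedCodes.

Implicit Types (S : seq nat).

Lemma sorted_gtn_cat S1 S2 : sorted gtn (S1 ++ S2) =
  [&& all (fun x => all (gtn x) S2) S1, sorted gtn S1 & sorted gtn S2].
Proof. by rewrite !(sorted_pairwise gtn_trans) pairwise_cat. Qed.

Lemma sorted_gtn_eq S1 S2 : sorted gtn S1 -> sorted gtn S2 -> S1 =i S2 -> S1 = S2.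
Proof. exact: irr_sorted_eq gtn_trans gtn_irr _ _. Qed.

Lemma sorted_split_low n S : sorted gtn S -> 0%N \notin S ->
  S = [seq k <- S | (n < k)%N] ++ [seq k <- rev (iota 1 n) | k \in S].
Proof.
move=> sS S0; apply: sorted_gtn_eq => // [|k]; last first.
  rewrite mem_cat !mem_filter mem_rev mem_iota add1n ltnS.
  have [lt_nk|le_kn] := ltnP n k; first by rewrite /= !andbF orbF.
  by rewrite /= andbT lt0n; case: eqVneq => [->|]; rewrite ?andbT ?(negbTE S0).
rewrite sorted_gtn_cat; apply/and3P; split.
- apply/allP => x; rewrite mem_filter => /andP[nx _]; apply/allP => y.
  rewrite mem_filter mem_rev mem_iota => /andP[_ /andP[_ yn]] /=.
  by rewrite add1n ltnS in yn; apply: leq_ltn_trans yn nx.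
- by apply: (sorted_filter gtn_trans).
apply: (sorted_filter gtn_trans); rewrite rev_sorted.
by apply: (iota_ltn_sorted 1 n).
Qed.

Lemma sorted_split_mem i S : sorted gtn S -> i \in S -> exists S1 S2,
  [/\ S = S1 ++ i :: S2, all (ltn i) S1 & all (gtn i) S2].
Proof.
move=> sS iS; case/splitPr: iS sS => S1 S2 sS; exists S1, S2; split=> //.
  move: sS; rewrite sorted_gtn_cat => /andP[/allP H _]; apply/allP => x /H.
  by case/andP.
move: sS; rewrite sorted_gtn_cat => /and3P[_ _].
by rewrite (sorted_pairwise gtn_trans) => /andP[].
Qed.

End SortedCodes.

(** * The recursion under simple reflections *)

Section Recursion.

Variables (F : fieldType) (bt : F) (B : nat -> F).
Hypothesis char0 : forall m, m.+1%:R != 0 :> F.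
Hypotheses (bt0 : bt != 0) (B_neq0 : forall k, B k != 0).
Hypothesis u12 : uniq [:: 0; 1; -1; B 1%N; B 2%N].

Let Bz (z : int) : F := match z with Posz k => B k | Negz k => (B k.+1)^-1 end.

Definition gfac (X : cartan) : {poly F} :=
  match X with
  | TypeB => bt^-1 *: ('X^1 - 1)
  | TypeC => bt^-1 *: ('X^2 - 1)
  | TypeD => 1
  end.

(** The point b_mu in the coordinate Y: 1 + bt x is B_k^-1 when x is the (-)-inverse of b_k. *)
Definition inv_values (T : seq nat) : seq F := [seq (B k)^-1 | k <- T].

Definition vpsi X (l m : SP) : F :=
  fval char0 bt0 (gfac X) B (code X l) (inv_values (code X m)).

Definition eroot (a : Defs.root) : F :=
  match a with
  | Rt i => (B i - 1) / bt
  | Rtt i => (B i ^+ 2 - 1) / bt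
  | Rminus j i => (B j / B i - 1) / bt
  | Rplus j i => (B j * B i - 1) / bt
  end.

Lemma eroot1 u : 1 + bt * ((u - 1) / bt) = u.
Proof. by rewrite mulrC divfK // addrC subrK. Qed.

Section Value.

Variables (X : cartan) (i : nat) (sg : {rmorphism F -> F}).
Let w := simple_refl X i.
Hypotheses (sgK : involutive sg) (sg_bt : sg bt = bt).
Hypothesis sg_B : forall k : nat, sg (B k) = Bz (w k).

Lemma sg_vpsi l m : sg (vpsi X l m) =
  fval char0 bt0 (gfac X) (fun k : nat => Bz (w k)) (code X l)
    [seq (Bz (w k))^-1 | k : nat <- code X m].
Proof.
rewrite /vpsi (fval_map char0 bt0 B _ _ sgK sgK sg_bt) => [|y]; last first.
  case: (X) => /=; last by rewrite !horner_1 rmorph1.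
    by rewrite !(hornerZ, hornerD, hornerN, hornerXn, horner_1) rmorphM rmorphB rmorphXn rmorph1 fmorphV sg_bt.
  by rewrite !(hornerZ, hornerD, hornerN, hornerXn, horner_1) rmorphM rmorphB rmorphXn rmorph1 fmorphV sg_bt.
rewrite /inv_values -map_comp; congr fval; last first.
  by apply: eq_map => k /=; rewrite fmorphV sg_B.
by apply: functional_extensionality => k /=.
Qed.

Let e := eroot (simple_root X i).
Let act1 l := Defs.act X w l.

Lemma perm_inv_values (f : nat -> F) T T' : perm_eq T T' ->
  perm_eq [seq f k | k <- T] [seq f k | k <- T'].
Proof. exact: perm_map. Qed.

Lemma code_act1 l : perm_eq (code X (act1 l)) (refl_set (simple_root X i) (code X l)).
Proof. exact: (code_refl l (simple_root_positive X i)).1. Qed.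

Lemma code_act1_eq l S : sorted gtn S -> refl_set (simple_root X i) (code X l) =i S ->
  code X (act1 l) = S.
Proof.
move=> sS E; apply: sorted_gtn_eq => //; first exact: code_sorted.
by move=> k; rewrite (perm_mem (code_act1 l)).
Qed.

End Value.

Section ValueSucc.

Variables (X : cartan) (i : nat) (sg : {rmorphism F -> F}).
Let w := simple_refl X i.+1.
Hypotheses (sgK : involutive sg) (sg_bt : sg bt = bt).
Hypothesis sg_B : forall k : nat, sg (B k) = Bz (w k).
Let e := eroot (simple_root X i.+1).

Let wE k : Bz (w (Posz k)) = B (swap i.+1 i.+2 k).
Proof.
case: k => [|k]; first by rewrite [w 0](refl0 (simple_root_proper X i.+1)).
by rewrite [w _]refl_Posz.
Qed.

Let swap1 : swap i.+1 i.+2 i.+1 = i.+2.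
Proof. by rewrite /swap eqxx. Qed.

Let swap2 : swap i.+1 i.+2 i.+2 = i.+1.
Proof. by rewrite /swap eqxx; case: eqVneq => // ->. Qed.

Let swap3 k : k != i.+1 -> k != i.+2 -> swap i.+1 i.+2 k = k.
Proof. by rewrite /swap => /negbTE-> /negbTE->. Qed.

(** The reflection permutes the code of m and, through sg, the B_k: on the point these cancel, and
    only the parameters stay permuted. *)
Lemma sg_vpsi_succ l m : sg (vpsi X l (Defs.act X w m)) =
  fval char0 bt0 (gfac X) (fun k => B (swap i.+1 i.+2 k)) (code X l)
    (inv_values (code X m)).
Proof.
rewrite (sg_vpsi sgK sg_bt sg_B).
have -> : (fun k : nat => Bz (simple_refl X i.+1 k)) = (fun k => B (swap i.+1 i.+2 k)).
  by apply: functional_extensionality => k; apply: wE.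
apply: fval_perm; have := code_act1 X i.+1 m; rewrite /= => pm.
have {pm} := perm_inv_values (fun k => (Bz (simple_refl X i.+1 k))^-1) pm.
rewrite -map_comp => pm; apply: perm_trans pm _.
rewrite (_ : map _ _ = inv_values (code X m)) //; apply: eq_map => k /=.
by rewrite [Bz _]wE swapK.
Qed.

(** By the position of i+1 and i in S (index i.+1 here): if the larger is absent the exchange is
    invisible; if both are present it is [fval_swap_repeat]; if only the larger is, it is
    [fval_swap_in]. *)
Lemma vpsi_rec_succ l m : sg (vpsi X l (Defs.act X w m)) =
  (1 + bt * e) * vpsi X l m +
  e * (if removable X i.+1 (code X l) then vpsi X (Defs.act X w l) m
       else - bt * vpsi X l m).
Proof.
rewrite sg_vpsi_succ /vpsi; set ys := inv_values _; set S := code X l.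
have CSi : B i.+2 = (1 + bt * e) * B i.+1 by rewrite eroot1 divfK.
have sS : sorted gtn S := code_sorted X l.
(* In the non-removable case the right-hand side collapses, so it must be shown that the value does
   not change. *)
have unch (v : F) : (1 + bt * e) * v + e * (- bt * v) = v by ring.
have E3 k : k != i.+1 -> k != i.+2 -> B (swap i.+1 i.+2 k) = B k by move=> *; rewrite swap3.
have E1 : B (swap i.+1 i.+2 i.+1) = B i.+2 by rewrite swap1.
have E2 : B (swap i.+1 i.+2 i.+2) = B i.+1 by rewrite swap2.
rewrite /removable; case Si2 : (i.+2 \in S); last first.
  by rewrite unch; apply: (fval_swap_notin char0 bt0 _ _ E1 E2 E3); rewrite ?Si2.
have [S1 [S2 [SE lt1 lt2]]] := sorted_split_mem sS Si2.
have nS1 : i.+2 \notin S1 by apply/negP => /(allP lt1) /=; rewrite ltnn.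
have nS2 : i.+2 \notin S2 by apply/negP => /(allP lt2) /=; rewrite ltnn.
case Si1 : (i.+1 \in S) => /=.
  rewrite unch; have [S3 S2E] : exists S3, S2 = i.+1 :: S3.
    have iS2 : i.+1 \in S2.
      move: Si1; rewrite SE mem_cat inE => /or3P[/(allP lt1) /=|/eqP|//]; clear; lia.
    move: sS; rewrite SE sorted_gtn_cat => /and3P[_ _ sS2].
    case: (S2) iS2 lt2 sS2 => //= k S3; rewrite inE => /predU1P[<-|iS3]; first by exists S3.
    case/andP=> lt_k _ /andP[_ sk]; have : (i.+1 < k)%N; last by move: lt_k => /=; clear; lia.
    have : all (gtn k) S3 by apply: (order_path_min gtn_trans).
    by move/allP => /(_ _ iS3).
  rewrite SE S2E; apply: (fval_swap_repeat char0 bt0 _ _ E1 E2 E3 CSi) => //.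
  by move: nS2; rewrite S2E inE negb_or => /andP[].
have -> : code X (Defs.act X w l) = S1 ++ i.+1 :: S2.
  apply: code_act1_eq => [|k].
    move: sS; rewrite SE !sorted_gtn_cat /= => /and3P[H -> p2].
    rewrite andTb; apply/andP; split.
      apply/allP => x xS1; have /= := allP H x xS1; case/andP=> x1 ->; rewrite andbT.
      by apply: ltn_trans x1.
    rewrite (path_sortedE gtn_trans); move: p2; rewrite (path_sortedE gtn_trans) => /andP[_ ->].
    rewrite andbT; apply/allP => x xS2 /=; have := allP lt2 x xS2; rewrite /= ltnS leq_eqVlt.
    by case/predU1P => // xi; move: Si1; rewrite SE mem_cat inE -xi xS2 !orbT.
  rewrite -[refl_set _ _]/[seq swap i.+1 i.+2 x | x <- S] SE map_cat /= swap2.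
  have id1 : [seq swap i.+1 i.+2 x | x <- S1] = S1.
    by apply: map_swap_id => //; apply: contraFN Si1; rewrite SE mem_cat => ->.
  have id2 : [seq swap i.+1 i.+2 x | x <- S2] = S2.
    by apply: map_swap_id => //; apply: contraFN Si1; rewrite SE mem_cat inE => ->; rewrite !orbT.
  by rewrite id1 id2.
rewrite SE; exact: (fval_swap_in char0 bt0 _ _ E1 E2 E3 CSi).
Qed.

End ValueSucc.

Let neq_inv c : c \in [:: B 1%N; B 2%N] -> c != c^-1.
Proof.
move=> c12; have c0 : c != 0 by move: c12; rewrite !inE => /pred2P[]->.
have [c1 cN1] : c != 1 /\ c != -1.
  move: u12; rewrite -[[:: 0; 1; -1; B 1%N; B 2%N]]/([:: 0; 1; -1] ++ [:: B 1%N; B 2%N]).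
  rewrite cat_uniq => /and3P[_ /hasPn H _]; have := H c c12.
  by rewrite !inE !negb_or => /and3P[].
apply/eqP => cV; have /eqP : (c - 1) * (c + 1) = 0.
  by rewrite -subr_sqr_1 expr2 {2}cV mulfV // subrr.
by rewrite mulf_eq0 subr_eq0 addr_eq0 (negbTE c1) (negbTE cN1).
Qed.

Section ValueZeroBC.

Variables (X : cartan) (sg : {rmorphism F -> F}).
Let w := simple_refl X 0.
Hypotheses (XD : typeD X = false) (sgK : involutive sg) (sg_bt : sg bt = bt).
Hypothesis sg_B : forall k : nat, sg (B k) = Bz (w k).
Let e := eroot (simple_root X 0).
Let p := if X is TypeC then 2%N else 1%N.

Let C' (k : nat) : F := if k == 1%N then (B 1%N)^-1 else B k.

Let wE (k : nat) : Bz (w k) = C' k.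
Proof. by rewrite /w /C'; case: (X) XD => // _; case: k => [|[|k]]. Qed.

Let eE : e = (B 1%N ^+ p - 1) / bt.
Proof. by rewrite /e /p; case: (X) XD. Qed.

Let gE : gfac X = bt^-1 *: ('X^p - 1).
Proof. by rewrite /p; case: (X) XD. Qed.

Lemma refl_set0BC S : refl_set (simple_root X 0) S = if 1%N \in S then rem 1%N S else 1%N :: S.
Proof. by case: (X) XD. Qed.

(** If 1 is in the code of m, it is missing after the reflection and the pair B_1, B_1^-1 is
    inserted; if not, the new entry B_1^-1 is sent by sg to B_1. Both cases end at the same list. *)
Lemma sg_vpsi_zeroBC l m : sg (vpsi X l (Defs.act X w m)) =
  fval char0 bt0 (gfac X) C' (code X l) (B 1%N :: inv_values (code X m)).
Proof.
rewrite (sg_vpsi sgK sg_bt sg_B).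
have -> : (fun k : nat => Bz (simple_refl X 0 k)) = C'.
  by apply: functional_extensionality => k; apply: wE.
set T := code X m.
have vE (T' : seq nat) : 1%N \notin T' ->
    [seq (Bz (simple_refl X 0 k))^-1 | k : nat <- T'] = inv_values T'.
  by move=> T1; apply/eq_in_map => k kT; rewrite [Bz _]wE /C' ifN //; apply: contraNneq T1 => <-.
have := perm_inv_values (fun k : nat => (Bz (simple_refl X 0 k))^-1) (code_act1 X 0 m).
rewrite refl_set0BC -/T => pm; rewrite (fval_perm _ _ _ _ _ pm).
case T1 : (1%N \in T).
  rewrite vE; last by rewrite mem_rem_uniqF ?code_uniq.
  have pT := perm_inv_values (fun k => (B k)^-1) (perm_to_rem T1).
  have /(fval_perm char0 bt0 (gfac X) C' (code X l)) -> : perm_eq (B 1%N :: inv_values T)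
      [:: B 1%N, (B 1%N)^-1 & inv_values (rem 1%N T)] by rewrite perm_cons.
  by rewrite fval_cancel // neq_inv // mem_head.
by rewrite /= vE ?T1 // [Bz _]wE /C' eqxx invrK.
Qed.

Lemma vpsi_rec_zeroBC l m : sg (vpsi X l (Defs.act X w m)) =
  (1 + bt * e) * vpsi X l m +
  e * (if removable X 0 (code X l) then vpsi X (Defs.act X w l) m
       else - bt * vpsi X l m).
Proof.
rewrite sg_vpsi_zeroBC /vpsi; set ys := inv_values _; set S := code X l.
have sS : sorted gtn S := code_sorted X l.
have S0 : 0%N \notin S := code_pos X l.
have p12 : (p == 1%N) || (p == 2%N) by rewrite /p; case: (X).
have C'1 : C' 1%N = (B 1%N)^-1 by [].
have C'E k : (1 < k)%N -> C' k = B k by rewrite /C' => k1; rewrite gtn_eqF.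
have u1 : uniq [:: 0; 1; -1; B 1%N].
  by move: u12; rewrite -[[:: 0; 1; -1; B 1%N; B 2%N]]/([:: 0; 1; -1; B 1%N] ++ [:: B 2%N]) cat_uniq => /and3P[].
have SE := sorted_split_low 1 sS S0; rewrite /= in SE.
have l2 : all (leq 2) [seq k <- S | (1 < k)%N] by apply: filter_all.
rewrite /removable XD; case S1 : (1%N \in S); rewrite S1 in SE; last first.
  rewrite cats0 in SE; rewrite SE gE (fval_reflect1_notin char0 bt0 p C'1 C'E u1) //; ring.
have -> : code X (Defs.act X w l) = [seq k <- S | (1 < k)%N].
  apply: code_act1_eq => [|k]; first by apply: (sorted_filter gtn_trans).
  rewrite refl_set0BC -/S S1 mem_rem_uniq ?code_uniq // !inE mem_filter.
  by case: k => [|[|k]] //; rewrite (negbTE S0) andbF.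
rewrite {1 2}SE cats1 gE (fval_reflect1_in char0 bt0 p12 C'1 C'E u1) //.
by rewrite eE eroot1.
Qed.

End ValueZeroBC.

Section ValueZeroD.

Variable sg : {rmorphism F -> F}.
Let w := simple_refl TypeD 0.
Hypotheses (sgK : involutive sg) (sg_bt : sg bt = bt).
Hypothesis sg_B : forall k : nat, sg (B k) = Bz (w k).
Let e := eroot (simple_root TypeD 0).

Let C' (k : nat) : F :=
  if k == 1%N then (B 2%N)^-1 else if k == 2%N then (B 1%N)^-1 else B k.

Let wE (k : nat) : Bz (w k) = C' k.
Proof. by rewrite /w /C'; case: k => [|[|[|k]]]. Qed.

(** The four cases for 1 and 2 in the code of m lead to the same list, since a pair B_k, B_k^-1 can
    be inserted for each of k = 1, 2 present. *)
Lemma sg_vpsi_zeroD l m : sg (vpsi TypeD l (Defs.act TypeD w m)) =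
  fval char0 bt0 1 C' (code TypeD l) [:: B 1%N, B 2%N & inv_values (code TypeD m)].
Proof.
rewrite (sg_vpsi sgK sg_bt sg_B).
have -> : (fun k : nat => Bz (simple_refl TypeD 0 k)) = C'.
  by apply: functional_extensionality => k; apply: wE.
set T := code TypeD m; have uT : uniq T := code_uniq TypeD m.
have vE (T' : seq nat) : 1%N \notin T' -> 2%N \notin T' ->
    [seq (Bz (simple_refl TypeD 0 k))^-1 | k : nat <- T'] = inv_values T'.
  move=> T1 T2; apply/eq_in_map => k kT; rewrite [Bz _]wE /C' !ifN //.
    by apply: contraNneq T2 => <-.
  by apply: contraNneq T1 => <-.
have := perm_inv_values (fun k : nat => (Bz (simple_refl TypeD 0 k))^-1) (code_act1 TypeD 0 m).
rewrite -/T => pm; rewrite (fval_perm _ _ _ _ _ pm) {pm} /=.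
have c1 : B 1%N != (B 1%N)^-1 by rewrite neq_inv // !inE eqxx.
have c2 : B 2%N != (B 2%N)^-1 by rewrite neq_inv // !inE eqxx orbT.
pose V ys := fval char0 bt0 1 C' (code TypeD l) ys.
rewrite -!/(V _).
have Vperm ys zs : perm_eq ys zs -> V ys = V zs by apply: fval_perm.
have iv1 T' : 1%N \in T' -> perm_eq (inv_values T') ((B 1%N)^-1 :: inv_values (rem 1%N T')).
  by move=> T1; apply: (perm_inv_values (fun k => (B k)^-1) (perm_to_rem T1)).
have iv2 T' : 2%N \in T' -> perm_eq (inv_values T') ((B 2%N)^-1 :: inv_values (rem 2%N T')).
  by move=> T2; apply: (perm_inv_values (fun k => (B k)^-1) (perm_to_rem T2)).
have V1 s : V [:: B 1%N, (B 1%N)^-1 & s] = V s by apply: fval_cancel.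
have V2 s : V [:: B 2%N, (B 2%N)^-1 & s] = V s by apply: fval_cancel.
have C1 : (Bz (simple_refl TypeD 0 (Posz 1)))^-1 = B 2%N by rewrite (wE 1) invrK.
have C2 : (Bz (simple_refl TypeD 0 (Posz 2)))^-1 = B 1%N by rewrite (wE 2) invrK.
pose f (k : nat) := (Bz (simple_refl TypeD 0 k))^-1; rewrite -/f.
have M1 s : map f (1%N :: s) = B 2%N :: map f s by rewrite map_cons [f 1%N]C1.
have M2 s : map f (2%N :: s) = B 1%N :: map f s by rewrite map_cons [f 2%N]C2.
case T1 : (1%N \in T); case T2 : (2%N \in T); rewrite ?andbT ?andbF ?orbT ?orbF.
- have T1' : 1%N \in rem 2%N T by rewrite mem_rem_uniq // !inE T1.
  rewrite vE; first last.
  + by apply: contraFN (mem_rem_uniqF 2%N uT); apply: mem_rem.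
  + by rewrite mem_rem_uniqF ?rem_uniq.
  rewrite -[LHS]V2 -[LHS]V1; apply: Vperm; apply/seq.permP => P.
  have E2 := seq.permP (iv2 _ T2) P; have E1 := seq.permP (iv1 _ T1') P.
  rewrite /= in E1 E2; rewrite /= E2 E1; clear; lia.
- rewrite (Vperm _ _ (perm_inv_values _ (perm_to_rem T1))) M1 vE; first last.
  + by apply: contraFN T2; apply: mem_rem.
  + by rewrite mem_rem_uniqF.
  rewrite -[LHS]V1; apply: Vperm; apply/seq.permP => P.
  have E1 := seq.permP (iv1 _ T1) P; rewrite /= in E1; rewrite /= E1; clear; lia.
- rewrite (Vperm _ _ (perm_inv_values _ (perm_to_rem T2))) M2 vE; first last.
  + by rewrite mem_rem_uniqF.
  + by apply: contraFN T1; apply: mem_rem.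
  rewrite -[LHS]V2; apply: Vperm; apply/seq.permP => P.
  have E2 := seq.permP (iv2 _ T2) P; rewrite /= in E2; rewrite /= E2; clear; lia.
rewrite M1 M2 vE ?T1 ?T2 //; apply: Vperm; apply/seq.permP => P /=; clear; lia.
Qed.

(** The parity conditions of the reflection lemmas hold because all codes have even size in type
    D. *)
Lemma vpsi_rec_zeroD l m : sg (vpsi TypeD l (Defs.act TypeD w m)) =
  (1 + bt * e) * vpsi TypeD l m +
  e * (if removable TypeD 0 (code TypeD l) then vpsi TypeD (Defs.act TypeD w l) m
       else - bt * vpsi TypeD l m).
Proof.
rewrite sg_vpsi_zeroD /vpsi; set ys := inv_values _; set S := code TypeD l.
have sS : sorted gtn S := code_sorted TypeD l.
have S0 : 0%N \notin S := code_pos TypeD l.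
have C'1 : C' 1%N = (B 2%N)^-1 by [].
have C'2 : C' 2%N = (B 1%N)^-1 by [].
have C'E k : (2 < k)%N -> C' k = B k by rewrite /C' => k1; rewrite !gtn_eqF // ltnW.
have SE := sorted_split_low 2 sS S0; rewrite /rev /= in SE.
pose S3 := [seq k <- S | (2 < k)%N].
have l3 : all (leq 3) S3 by apply: filter_all.
have evS : ~~ odd (size S) by apply: code_even.
have evT : ~~ odd (size ys) by rewrite size_map; apply: code_even.
have e1 : 1 + bt * e = B 2%N * B 1%N by rewrite eroot1.
have unch (v : F) : (1 + bt * e) * v + e * (- bt * v) = v by ring.
have -> : removable TypeD 0 S = (2%N \in S) && (1%N \in S) by [].
case S2 : (2%N \in S); case S1 : (1%N \in S); rewrite [_ && _]/=;
  rewrite S1 S2 -/S3 in SE.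
- have -> : code TypeD (Defs.act TypeD w l) = S3.
    apply: code_act1_eq => [|k]; first by apply: (sorted_filter gtn_trans).
    rewrite /= -/S S1 S2 mem_filter.
    have rk := mem_rem_uniq 1%N (rem_uniq 2%N (code_uniq TypeD l)).
    rewrite rk inE mem_rem_uniq ?code_uniq // !inE.
    by case: k => [|[|[|k]]] //=; rewrite ?(negbTE S0).
  have par : odd (size ys) = odd (size S3).
    by move: evS evT; rewrite SE size_cat oddD /= addbF => /negbTE-> /negbTE->.
  rewrite SE (fval_reflect2_in char0 bt0 C'1 C'2 C'E u12 l3 par).
  by rewrite e1 [B 2%N * _]mulrC /e /= [B 2%N * _]mulrC.
- rewrite unch SE; apply: (fval_reflect2_same char0 bt0 C'1 C'2 C'E u12) => //.
  right; split; first by right.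
  by move: evS evT; rewrite SE size_cat oddD /= addbT negbK => -> /negbTE->.
- rewrite unch SE; apply: (fval_reflect2_same char0 bt0 C'1 C'2 C'E u12) => //.
  right; split; first by left.
  by move: evS evT; rewrite SE size_cat oddD /= addbT negbK => -> /negbTE->.
rewrite unch SE; apply: (fval_reflect2_same char0 bt0 C'1 C'2 C'E u12) => //.
by left.
Qed.

End ValueZeroD.

End Recursion.

(** * Divisibility along positive roots *)

Definition map_root (f : nat -> nat) (a : Defs.root) : Defs.root :=
  match a with
  | Rt i => Rt (f i)
  | Rtt i => Rtt (f i)
  | Rminus j i => Rminus (f j) (f i)
  | Rplus j i => Rplus (f j) (f i)
  end.

Lemma swap_gt0 i k : (0 < i)%N -> (0 < k)%N -> (0 < swap i i.+1 k)%N.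
Proof. by rewrite /swap => i0 k0; case: ifP => // _; case: ifP. Qed.

Lemma swap_l i j : swap i j i = j.
Proof. by rewrite /swap eqxx. Qed.

Lemma swap_r i j : swap i j j = i.
Proof. by rewrite /swap; case: eqVneq => [->|_]; rewrite ?eqxx. Qed.

Lemma swap_out i j k : k != i -> k != j -> swap i j k = k.
Proof. by rewrite /swap => /negbTE-> /negbTE->. Qed.

Lemma refl_conj_swap i a z : (0 < i)%N -> proper_root a ->
  refl (Rminus i.+1 i) (refl a z) =
  refl (map_root (swap i i.+1) a) (refl (Rminus i.+1 i) z).
Proof.
move=> i0 pa; have pi : proper_root (Rminus i.+1 i) by rewrite /= i0 ltnSn.
set f := swap i i.+1; have f_inj : injective f := can_inj (swapK i i.+1).
have sE k : (0 < k)%N -> refl (Rminus i.+1 i) (Posz k) = Posz (f k).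
  by move=> k0; rewrite refl_Posz.
have pos k : (0 < k)%N -> refl (Rminus i.+1 i) (refl a (Posz k)) =
    refl (map_root f a) (refl (Rminus i.+1 i) (Posz k)).
  move=> k0; have fk0 : (0 < f k)%N by apply: swap_gt0.
  rewrite sE // !refl_Posz //; case: a pa => [j|j|j h|j h] pa.
  - rewrite /map_root /refl_nat (inj_eq f_inj).
    by case: eqVneq => _; rewrite ?refl_odd sE.
  - rewrite /map_root /refl_nat (inj_eq f_inj).
    by case: eqVneq => _; rewrite ?refl_odd sE.
  - case/andP: pa => h0 hj; rewrite /map_root /refl_nat sE /swap.
      by rewrite !(inj_eq f_inj); case: ifP => _ //; case: ifP.
    by case: ifP => _; [apply: ltn_trans h0 hj | case: ifP].
  case/andP: pa => h0 hj; rewrite /map_root /refl_nat !(inj_eq f_inj).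
  case: ifP => _; first by rewrite refl_odd sE // (ltn_trans h0).
  by case: ifP => _; rewrite ?refl_odd sE.
case: z => [[|k]|k]; last by rewrite NegzE !refl_odd pos.
  rewrite !(refl0 pa) !(refl0 pi).
  have -> // : refl (map_root f a) 0 = 0.
  case: a pa {pos} => [j|j|j h|j h] /= pa; try by case: ifP => _; rewrite ?oppr0.
    case/andP: pa => h0 hj; rewrite !ltn_eqF //; apply: swap_gt0 => //.
    exact: ltn_trans hj.
  case/andP: pa => h0 hj; rewrite !ltn_eqF //; apply: swap_gt0 => //.
  exact: ltn_trans hj.
exact: pos.
Qed.

Section GKM.

Variables (F : fieldType) (bt : F) (B : nat -> F) (X : cartan).
Hypotheses (bt0 : bt != 0) (B_neq0 : forall k, B k != 0).
Variables (R : F -> Prop) (sg : nat -> {rmorphism F -> F}) (psi : SP -> SP -> F).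

Hypotheses (R0 : R 0) (RD : forall f g, R f -> R g -> R (f + g)).
Hypotheses (RN : forall f, R f -> R (- f)) (RM : forall f g, R f -> R g -> R (f * g)).
Hypotheses (R1 : R 1) (Rbt : R bt).
Hypothesis Re : forall i, R (eroot bt B (simple_root X i)).
Hypothesis RqV : forall i, R (1 + bt * eroot bt B (simple_root X i))^-1.

Hypotheses (sgK : forall i, involutive (sg i)) (sg_bt : forall i, sg i bt = bt).
Hypothesis sg_R : forall i f, R f -> R (sg i f).
Hypothesis sg_sub : forall i f, R f ->
  exists2 r, R r & sg i f - f = eroot bt B (simple_root X i) * r.
Hypothesis sg_B : forall i k : nat, sg i (B k) =
  match simple_refl X i k with Posz k => B k | Negz k => (B k.+1)^-1 end.

Hypothesis psi0 : forall l, R (psi l emptySP).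
Hypothesis psi_rec : forall i l m,
  let e := eroot bt B (simple_root X i) in
  sg i (psi l (Defs.act X (simple_refl X i) m)) =
  (1 + bt * e) * psi l m +
  e * (if removable X i (code X l) then psi (Defs.act X (simple_refl X i) l) m
       else - bt * psi l m).

Lemma psi_act i l m : let e := eroot bt B (simple_root X i) in
  psi l (Defs.act X (simple_refl X i) m) =
  sg i ((1 + bt * e) * psi l m +
    e * (if removable X i (code X l) then psi (Defs.act X (simple_refl X i) l) m
         else - bt * psi l m)).
Proof. by rewrite /= -psi_rec sgK. Qed.

(** Induction on the boxes of m, for all l at once: removing a box of m expresses the value through
    values at a smaller partition. *)
Lemma psi_R l m : R (psi l m).
Proof.
have [n] := ubnP (wt X (code X m)); elim: n l m => // n IHn l m ltn.
have [->|m0] := eqVneq m emptySP; first exact: psi0.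
have [i ri] := exists_removable X (elimN eqP m0).
have := wt_act X i m; rewrite /= ri => wE.
have mE : m = Defs.act X (simple_refl X i) (Defs.act X (simple_refl X i) m).
  by rewrite act_involutive ?simple_root_positive.
set m' := Defs.act _ _ m in wE mE; have ltm' : (wt X (code X m') < n)%N by lia.
rewrite mE psi_act; apply: sg_R; apply: RD.
  by apply: RM; [apply: RD => //; apply: RM | apply: IHn].
apply: RM => //; case: ifP => _; first exact: IHn.
by apply: RM; [apply: RN | apply: IHn].
Qed.

(** Quantified over all l, because conjugation by s_i brings in psi of s_i l. *)
Definition gkm a := forall l m, exists2 r, R r &
  psi l (Defs.act X (refl a) m) - psi l m = eroot bt B a * r.

(** s_i sends its simple root to the negative, and the (-)-inverse of e is - e / (1 + bt e). *)
Lemma sg_eroot_simple i : let e := eroot bt B (simple_root X i) in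
  sg i e = - (e * (1 + bt * e)^-1).
Proof.
have key u : u != 0 -> sg i u = u^-1 ->
    sg i ((u - 1) / bt) = - (((u - 1) / bt) * (1 + bt * ((u - 1) / bt))^-1).
  move=> u0 su; rewrite eroot1 // rmorphM fmorphV sg_bt rmorphB rmorph1 su.
  by field; rewrite bt0 u0.
rewrite /=; case: i key => [|i] key.
  case: X (sg_B 0) key => sB key /=; apply: key; rewrite ?expf_neq0 ?mulf_neq0 //.
    by rewrite rmorphXn sB exprVn.
  by rewrite rmorphM !sB /= invfM mulrC.
apply: key; rewrite ?mulf_neq0 ?invr_eq0 //.
have sE k : sg i.+1 (B k.+1) = B (swap i.+1 i.+2 k.+1) by rewrite sg_B [simple_refl _ _ _]refl_Posz.
by rewrite rmorphM fmorphV !sE swap_l swap_r invfM invrK mulrC.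
Qed.

(** By the recursion psi(s_i m) is s_i applied to psi(m) plus a multiple of e; s_i psi(m) - psi(m)
    is divisible by e, and so is s_i e. *)
Lemma gkm_simple i : gkm (simple_root X i).
Proof.
move=> l m; rewrite psi_act; set e := eroot _ _ _; set Y := if _ then _ else _.
have YR : R Y by rewrite /Y; case: ifP => _; [|apply: RM; [apply: RN|]] => //; apply: psi_R.
have [r rR rE] := sg_sub i (psi_R l m).
exists (r - (1 + bt * e)^-1 * sg i (bt * psi l m + Y)).
  apply: RD => //; apply: RN; apply: RM; first exact: RqV.
  by apply: sg_R; apply: RD => //; apply: RM => //; apply: psi_R.
have -> : (1 + bt * e) * psi l m + e * Y = psi l m + e * (bt * psi l m + Y) by ring.
have sE : sg i e = - (e * (1 + bt * e)^-1) := sg_eroot_simple i.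
rewrite rmorphD rmorphM sE mulrBr -[e * r]rE.
by move: (sg i (bt * _ + _)) => y; move: (_^-1) => q; ring.
Qed.

(** Write m = s_i m'. By the recursion at m' and at s_a' m', the difference for a is s_i applied to
    a combination of differences for a', and s_i maps e(a') to e(a). *)
Lemma gkm_conj i a a' : positive_root X a -> positive_root X a' ->
    (forall z, simple_refl X i (refl a z) = refl a' (simple_refl X i z)) ->
    sg i (eroot bt B a') = eroot bt B a ->
  gkm a' -> gkm a.
Proof.
move=> pa pa' conj ea ga l m; set s := simple_refl X i.
have [m' mE] : exists m', m = Defs.act X s m'.
  by exists (Defs.act X s m); rewrite act_involutive ?simple_root_positive.
have aE : Defs.act X (refl a) m = Defs.act X s (Defs.act X (refl a') m').
  by rewrite {1}mE; apply: eq_act => //; apply: simple_root_positive.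
rewrite aE mE (psi_act i l (Defs.act X (refl a') m')) (psi_act i l m') -rmorphB; set e := eroot _ _ (simple_root X i).
have [r rR rE] := ga l m'.
pose Y n := if removable X i (code X l) then psi (Defs.act X (simple_refl X i) l) n
  else - bt * psi l n.
have [r' rR' rE'] : exists2 r', R r' & Y (Defs.act X (refl a') m') - Y m' = eroot bt B a' * r'.
  rewrite /Y; case: ifP => _; first exact: ga.
  by exists (- bt * r); [apply: RM => //; apply: RN | rewrite -mulrBr rE; ring].
exists (sg i ((1 + bt * e) * r + e * r')).
  by apply: sg_R; apply: RD; apply: RM; try exact: Re; rewrite //; apply: RD => //; apply: RM; try exact: Re.
rewrite -ea -rmorphM -!/(Y _); congr (sg i _).
have -> : eroot bt B a' * ((1 + bt * e) * r + e * r') =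
  (1 + bt * e) * (eroot bt B a' * r) + e * (eroot bt B a' * r') by ring.
by rewrite -rE -rE'; ring.
Qed.

Lemma gkm_swap i a : (0 < i)%N -> positive_root X a ->
    positive_root X (map_root (swap i i.+1) a) ->
  gkm (map_root (swap i i.+1) a) -> gkm a.
Proof.
case: i => // i _ pa pa'; apply: (@gkm_conj i.+1) => // [z|].
  by apply: refl_conj_swap => //; apply: positive_root_proper pa.
have sE k : (0 < k)%N -> sg i.+1 (B (swap i.+1 i.+2 k)) = B k.
  move=> k0; rewrite sg_B [simple_refl _ _ _]refl_Posz ?swap_gt0 //.
  by rewrite /= -[in RHS](swapK i.+1 i.+2 k).
case: a pa {pa'} => [j|j|j h|j h] pa; have := positive_root_proper pa => /= p0.
- by rewrite fmorph_div rmorphB rmorph1 sg_bt sE.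
- by rewrite fmorph_div rmorphB rmorphXn rmorph1 sg_bt sE.
- case/andP: p0 => h0 hj; rewrite fmorph_div rmorphB fmorph_div rmorph1 sg_bt !sE //.
  exact: ltn_trans hj.
case/andP: p0 => h0 hj; rewrite fmorph_div rmorphB rmorphM rmorph1 sg_bt !sE //.
exact: ltn_trans hj.
Qed.

Lemma gkm_minus i j : (0 < i)%N -> (i < j)%N -> gkm (Rminus j i).
Proof.
move=> i0; elim: j => // j IHj; rewrite ltnS leq_eqVlt => /predU1P[<-|ij].
  by case: i i0 {IHj} => // i _; apply: (@gkm_simple i.+1).
have j0 : (0 < j)%N by apply: leq_ltn_trans ij.
have mE : map_root (swap j j.+1) (Rminus j.+1 i) = Rminus j i.
  by rewrite /= swap_r swap_out //; lia.
apply: (gkm_swap j0); rewrite ?mE /=; last exact: IHj.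
  by case: (X); rewrite i0 ltnS ltnW.
by case: (X); rewrite i0 ij.
Qed.

(** Lower j, then i, by exchanges down to t_2 + t_1. This is simple in type D, and conjugate to t_2
    - t_1 under s_0 in types B and C. *)
Lemma gkm_plus i j : (0 < i)%N -> (i < j)%N -> gkm (Rplus j i).
Proof.
have pos h k : (0 < h)%N -> (h < k)%N -> positive_root X (Rplus k h).
  by move=> h0 hk; rewrite /=; case: (X); rewrite h0 hk.
elim: i j => // i IHi j _; elim: j => // j IHj; rewrite ltnS leq_eqVlt => /predU1P[<-|ij]; last first.
  have j0 : (0 < j)%N by apply: leq_ltn_trans ij.
  have mE : map_root (swap j j.+1) (Rplus j.+1 i.+1) = Rplus j i.+1.
    by rewrite /= swap_r swap_out //; lia.
  by apply: (gkm_swap j0); rewrite ?mE ?pos //; [lia | exact: IHj].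
case: i IHi {IHj} => [|i] IHi.
  case D : (typeD X).
    by have := gkm_simple 0; case: (X) D.
  have pm : positive_root X (Rminus 2 1) by case: (X).
  apply: (@gkm_conj 0 _ (Rminus 2 1)) => //.
  - by move=> z; case: (X) D => // _; case: z => [[|[|[|k]]]|[|[|k]]].
  - have sB : sg 0 (B 1%N) = (B 1%N)^-1 by rewrite sg_B; case: (X) D.
    have sB2 : sg 0 (B 2%N) = B 2%N by rewrite sg_B; case: (X) D.
    by rewrite /= !(fmorph_div, rmorphB) /= rmorph1 sg_bt sB sB2 invrK.
  exact: gkm_minus.
have mE : map_root (swap i.+1 i.+2) (Rplus i.+3 i.+2) = Rplus i.+3 i.+1.
  by rewrite /= swap_r swap_out //; lia.
by apply: (@gkm_swap i.+1); rewrite ?mE ?pos //; apply: IHi.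
Qed.

Lemma gkm_positive a : positive_root X a -> gkm a.
Proof.
case: a => [i|i|j i|j i] pa.
- elim: i pa => [|[|i] IHi] pa; first by case: (X) pa.
    by have := gkm_simple 0; case: (X) pa.
  have pi : positive_root X (Rt i.+1) by case: (X) pa.
  have mE : map_root (swap i.+1 i.+2) (Rt i.+2) = Rt i.+1 by rewrite /= swap_r.
  by apply: (@gkm_swap i.+1); rewrite ?mE //; apply: IHi.
- elim: i pa => [|[|i] IHi] pa; first by case: (X) pa.
    by have := gkm_simple 0; case: (X) pa.
  have pi : positive_root X (Rtt i.+1) by case: (X) pa.
  have mE : map_root (swap i.+1 i.+2) (Rtt i.+2) = Rtt i.+1 by rewrite /= swap_r.
  by apply: (@gkm_swap i.+1); rewrite ?mE //; apply: IHi.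
- by have /andP[i0 ij] := positive_root_proper pa; apply: gkm_minus.
by have /andP[i0 ij] := positive_root_proper pa; apply: gkm_plus.
Qed.

End GKM.

(** * Factorial functions and their values at b_mu *)

Section FactorialFunctions.

Variables (F : fieldType) (bt : F) (b : nat -> F).

Definition oplusX (c : F) : {poly F} := 'X + c%:P + bt *: (c *: 'X).

Definition xfac (X : cartan) (m : nat) : {poly F} :=
  match X with
  | TypeB => \prod_(1 <= k < m.+1) oplusX (if k == 1%N then 0 else b k.-1)
  | TypeC => ('X + 'X + bt *: ('X * 'X)) * \prod_(1 <= k < m) oplusX (b k)
  | TypeD => \prod_(1 <= k < m.+1) oplusX (b k)
  end.

(** h is only a function here, so that [GX] is an instance by conversion, with h the embedding
    [constK]. *)
Definition gx (E : fieldType) (h : F -> E) (X : cartan) (l : seq nat) n (x : 'I_n -> E) : E :=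
  match X with
  | TypeB => GP (h bt) (fun k => if k == 1%N then 0 else h (b k.-1)) l x
  | TypeC => GQ (h bt) (fun k => h (b k)) l x
  | TypeD => GP (h bt) (fun k => h (b k)) l x
  end.

Lemma map_oplusX (E : fieldType) (h : {rmorphism F -> E}) c y :
  (map_poly h (oplusX c)).[y] = oplus (h bt) y (h c).
Proof.
rewrite /oplusX !rmorphD /= !map_polyZ map_polyX map_polyC /= !(hornerD, hornerZ, hornerX, hornerC).
by rewrite /oplus mulrA; ring.
Qed.

Lemma gxE (E : fieldType) (h : {rmorphism F -> E}) X l n (x : 'I_n -> E) :
  gx h X l x = symmetrized (h bt) (fun y m => (map_poly h (xfac X m)).[y]) l x.
Proof.
case: X; apply: eq_symmetrized => // y m; rewrite /xfac.
- rewrite rmorph_prod horner_prod; apply: eq_bigr => k _.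
  by rewrite map_oplusX; case: ifP; rewrite ?rmorph0.
- rewrite rmorphM rmorph_prod hornerM horner_prod; congr (_ * _); last first.
    by apply: eq_bigr => k _; rewrite map_oplusX.
  rewrite !rmorphD /= map_polyZ rmorphM /= !map_polyX.
  by rewrite !(hornerD, hornerZ, hornerX, hornerM) /oplus mulrA.
rewrite rmorph_prod horner_prod; apply: eq_bigr => k _.
by rewrite map_oplusX.
Qed.

Lemma gx_poly X l n : (size l <= n)%N -> exists P : {mpoly F[n]},
  forall (E : fieldType) (h : {rmorphism {mpoly F[n]} -> E}), injective (fun i => h 'X_i) ->
    h P = gx (h \o @mpolyC n F) X l (fun i => h 'X_i).
Proof.
move=> le_ln; have [P PE] := symmetrized_poly bt (xfac X) le_ln.
by exists P => E h h_inj; rewrite (PE E h h_inj) gxE.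
Qed.

Hypothesis char0 : forall m, m.+1%:R != 0 :> F.
Hypothesis bt0 : bt != 0.

Variable B : nat -> F.
Hypothesis BE : forall k, B k = 1 + bt * b k.

Lemma horner_oplusX c y : (oplusX c).[(y - 1) / bt] = (y * (1 + bt * c) - 1) / bt.
Proof. by rewrite !(hornerD, hornerZ, hornerX, hornerC); field. Qed.

Lemma horner_gfac X y : (gfac bt X).[y] =
  match X with TypeB => (y - 1) / bt | TypeC => (y ^+ 2 - 1) / bt | TypeD => 1 end.
Proof.
by case: X; rewrite /= ?horner_1 // !(hornerZ, hornerD, hornerN, hornerXn, horner_1) mulrC ?expr1.
Qed.

(** In type B the first parameter 0 produces the factor (y - 1)/bt and the others shift by one; in
    type D the shift is in s instead. *)
Lemma horner_xfac X s y : (typeD X = false -> 0 < s)%N ->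
  (xfac X s).[(y - 1) / bt] = fac bt (horner (gfac bt X)) B (typeD X + s) y.
Proof.
rewrite /fac horner_gfac; case: X => [/(_ erefl)|/(_ erefl)|_]; rewrite ?add0n ?add1n /xfac.
- case: s => // s _; rewrite big_nat_recl //= big_add1 /= hornerM horner_oplusX mulr0 addr0 mulr1.
  rewrite horner_prod big_add1 /=; congr (_ * _); apply: eq_bigr => k _.
  by rewrite horner_oplusX BE.
- move=> s0; rewrite hornerM horner_prod; congr (_ * _); last first.
    by apply: eq_bigr => k _; rewrite horner_oplusX BE.
  by rewrite !(hornerD, hornerZ, hornerX, hornerM); field.
rewrite mul1r horner_prod; apply: eq_bigr => k _.
by rewrite horner_oplusX BE.
Qed.

Lemma gsum_map_index f (g : nat -> nat) l (ys : seq F) :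
  gsum f [seq g s | s <- l] ys = gsum (fun s => f (g s)) l ys.
Proof.
by elim: l ys => //= s l IHl ys; apply: eq_bigr => y _; rewrite IHl.
Qed.

(** For an odd number of parts in type D the code has one more element 1, which [fval_rcons1] drops
    because the number of points is even. *)
Lemma gsum_xfac X (l : SP) (ys : seq F) : uniq ([:: 0; 1; -1] ++ ys) -> parity_ok X (size ys) ->
  gsum (fun s y => (xfac X s).[(y - 1) / bt]) l ys =
  fval char0 bt0 (gfac bt X) B (code X l) ys.
Proof.
move=> u par; have uys : uniq ys by move: u; rewrite cat_uniq => /and3P[].
have l0 : 0%N \notin (l : seq nat) by case/andP: (partsP l).
rewrite (eq_gsum (f' := fun s => fac bt (horner (gfac bt X)) B (typeD X + s)%N)); last first.
  move=> s sl y _; apply: horner_xfac => _; rewrite lt0n.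
  by apply: contraNneq l0 => <-.
case: X par => par; try by rewrite fvalE.
rewrite /code; case: ifP => ol; last by rewrite fvalE // gsum_map_index.
by rewrite fval_rcons1 ?size_map ?ol ?(negbTE par) // fvalE // gsum_map_index.
Qed.

Lemma meval_gx X (l : SP) n (P : {mpoly F[n]}) : (size l <= n)%N ->
    (forall (E : fieldType) (h : {rmorphism {mpoly F[n]} -> E}),
      injective (fun i => h 'X_i) -> h P = gx (h \o @mpolyC n F) X l (fun i => h 'X_i)) ->
    parity_ok X n -> forall ys, size ys = n ->
  P.@[point bt ys] = fval char0 bt0 (gfac bt X) B (code X l) ys.
Proof.
move=> le_ln PE par.
apply: (@sep_poly_eq _ char0 n [:: 0; 1; -1] (fun ys => P.@[@point _ bt n ys])) => //.
- exact: uniq_01N1.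
- exact: sep_poly_meval.
- exact: sep_poly_gbar.
move=> ys szys u; rewrite -gsum_xfac // ?szys //.
have uys : uniq ys by move: u; rewrite cat_uniq => /and3P[].
apply: (symmetrized_point char0 bt0 le_ln _ szys uys) => E h h_inj.
by rewrite (PE E h h_inj) gxE.
Qed.

Lemma fval_pad X l (ys : seq F) k : parity_ok X k ->
  fval char0 bt0 (gfac bt X) B l (ys ++ nseq k 1) = fval char0 bt0 (gfac bt X) B l ys.
Proof.
move=> par; rewrite (fval_perm char0 bt0 _ _ _ (permEl (perm_catC _ _))).
case D : (typeD X).
  have -> : gfac bt X = 1 by case: (X) D.
  have ev : ~~ odd k by case: (X) D par.
  rewrite -(odd_double_half k) (negbTE ev) add0n.
  by elim: k./2 => //= d IHd; rewrite fval_cons11.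
have g1 : (gfac bt X).[1] = 0.
  by rewrite horner_gfac; case: (X) D; rewrite ?expr1n ?subrr ?mul0r.
by elim: k {par} => //= k IHk; rewrite fval_cons1.
Qed.

Hypothesis B_neq0 : forall k, B k != 0.

Lemma meval_gx_code X (l m : SP) n (P : {mpoly F[n]}) : (size l <= n)%N ->
    (forall (E : fieldType) (h : {rmorphism {mpoly F[n]} -> E}),
      injective (fun i => h 'X_i) -> h P = gx (h \o @mpolyC n F) X l (fun i => h 'X_i)) ->
    parity_ok X n -> (size (code X m) <= n)%N ->
  P.@[fun i : 'I_n => nth 0 [seq ominus bt 0 (b k) | k <- code X m] i] =
  vpsi B char0 bt0 X l m.
Proof.
move=> le_ln PE par le_mn; set T := code X m in le_mn *.
have par' : parity_ok X (n - size T).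
  have ev : typeD X -> ~~ odd (size T) := @code_even X m.
  move: ev par; rewrite /parity_ok; case: (X) => // /(_ isT) /negbTE ev /negbTE par.
  by rewrite oddB // par ev.
rewrite /vpsi -/T -(fval_pad _ _ par').
have sz : size (inv_values B T ++ nseq (n - size T) 1) = n.
  by rewrite size_cat size_map size_nseq subnKC.
rewrite -(meval_gx le_ln PE par sz); apply: meval_eq => i; rewrite /point nth_cat size_map.
have [lt_i|le_i] := ltnP i (size T).
  by rewrite !(nth_map 0%N) // [LHS](addK_div bt0) BE ominus0E // -BE.
rewrite nth_default ?size_map // nth_nseq; case: ifP; first by rewrite subrr mul0r.
by rewrite ltn_sub2r ?(leq_ltn_trans le_i).
Qed.

(** The list of points is empty, so a nonempty code finds too few of them. *)
Lemma vpsi_empty X (l : SP) : vpsi B char0 bt0 X l emptySP = (l == emptySP)%:R.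
Proof.
rewrite /vpsi; have -> : inv_values B (code X emptySP) = [::] by case: X.
have [->|/eqP l0] := eqVneq; first by case: X; rewrite /= fval_nil.
rewrite fval_small // lt0n size_eq0; apply/eqP => S0; apply: l0.
by apply: (@code_inj X); rewrite S0; case: X {S0}.
Qed.

End FactorialFunctions.

(** * Simple roots and the subring R in the coordinates B *)

Section SimpleRootCoordinates.

Variables (F : fieldType) (bt : F) (B : nat -> F) (X : cartan) (R : F -> Prop).
Hypotheses (bt0 : bt != 0) (B_neq0 : forall k, B k != 0).
Hypotheses (R0 : R 0) (RD : forall f g, R f -> R g -> R (f + g)).
Hypotheses (RN : forall f, R f -> R (- f)) (RM : forall f g, R f -> R g -> R (f * g)).
Hypotheses (R1 : R 1) (RB : forall k, R (B k)) (RV : forall k, R (B k)^-1).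
Hypothesis Rb : forall k, R ((B k - 1) / bt).

Let e i := eroot bt B (simple_root X i).
Let Bz (z : int) : F := match z with Posz k => B k | Negz k => (B k.+1)^-1 end.

Lemma coord_eroot i : R (e i).
Proof.
rewrite /e; case: i => [|i].
  case: X => /=.
  - exact: Rb.
  - have -> : (B 1%N ^+ 2 - 1) / bt = (B 1%N - 1) / bt * (B 1%N + 1) by field.
    by apply: RM; [apply: Rb | apply: RD; [apply: RB|apply: R1]].
  have -> : (B 2%N * B 1%N - 1) / bt = (B 2%N - 1) / bt * B 1%N + (B 1%N - 1) / bt by field.
  by apply: RD; [apply: RM; [apply: Rb|apply: RB] | apply: Rb].
have -> : eroot bt B (simple_root X i.+1) = ((B i.+2 - 1) / bt - (B i.+1 - 1) / bt) * (B i.+1)^-1.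
  have Bi := B_neq0 i.+1; rewrite /eroot [simple_root _ _]/=.
  by move: (B i.+1) (B i.+2) Bi => x y x0; field; rewrite x0 bt0.
apply: RM; last exact: RV.
by apply: RD; [|apply: RN]; apply: Rb.
Qed.

Lemma coord_eroot1V i : R (1 + bt * e i)^-1.
Proof.
rewrite /e; case: i => [|i].
  case: X; rewrite /= eroot1 //.
    by rewrite -exprVn; apply: RM; apply: RV.
  by rewrite invfM; apply: RM; apply: RV.
by rewrite /= eroot1 // invfM invrK; apply: RM; [apply: RV|apply: RB].
Qed.

(** The condition on generators for [sigma_sub_mul]: s_i b_k - b_k is divisible by e(alpha_i). *)
Lemma coord_simple i (k : nat) : exists2 r, R r &
  (Bz (simple_refl X i k) - 1) / bt - (B k - 1) / bt = e i * r.
Proof.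
have fix_case : simple_refl X i k = k -> exists2 r, R r &
    (Bz (simple_refl X i k) - 1) / bt - (B k - 1) / bt = e i * r.
  by move=> ->; exists 0; [exact: R0 | rewrite subrr mulr0].
have inv_case j : simple_refl X i k = Negz j ->
    (exists2 r, R r & ((B j.+1)^-1 - B k) / bt = e i * r) -> exists2 r, R r &
    (Bz (simple_refl X i k) - 1) / bt - (B k - 1) / bt = e i * r.
  move=> wk [r rR rE]; exists r => //; rewrite -rE wk /=.
  by rewrite -mulrBl opprB addrA subrK.
have RNV j : R (- (B j)^-1) by apply: RN; apply: RV.
have B1 := B_neq0 1%N; have B2 := B_neq0 2%N; rewrite /e in fix_case inv_case *.
case: i fix_case inv_case => [|i] fix_case inv_case.
  case: k fix_case inv_case => [|[|k]] fix_case inv_case.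
  - by apply: fix_case; apply: refl0; apply: simple_root_proper.
  - case: (X) fix_case inv_case => fix_case inv_case.
    + apply: (inv_case 0%N) => //; exists (- (B 1%N)^-1 * (B 1%N + 1)).
        by apply: RM => //; apply: RD; [apply: RB|apply: R1].
      by rewrite /=; move: (B 1%N) B1 => x x0; field; rewrite x0 bt0.
    + apply: (inv_case 0%N) => //; exists (- (B 1%N)^-1) => //.
      by rewrite /=; move: (B 1%N) B1 => x x0; field; rewrite x0 bt0.
    apply: (inv_case 1%N) => //; exists (- (B 2%N)^-1) => //.
    by rewrite /=; move: (B 1%N) (B 2%N) B1 B2 => x y x0 y0; field; rewrite y0 bt0.
  case: (X) fix_case inv_case => fix_case inv_case; try exact: fix_case.
  case: k fix_case inv_case => [|k] fix_case inv_case; last exact: fix_case.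
  apply: (inv_case 0%N) => //; exists (- (B 1%N)^-1) => //.
  by rewrite /=; move: (B 1%N) (B 2%N) B1 B2 => x y x0 y0; field; rewrite x0 bt0.
have [k0|k0] := posnP k.
  by apply: fix_case; rewrite k0; apply: refl0; apply: simple_root_proper.
have wE : simple_refl X i.+1 k = Posz (swap i.+1 i.+2 k) by apply: refl_Posz.
have [ki|ki] := eqVneq k i.+1.
  exists (B i.+1); first exact: RB.
  rewrite wE ki swap_l /=; have := B_neq0 i.+1.
  by move: (B i.+1) (B i.+2) => x y x0; field; rewrite x0 bt0.
have [kj|kj] := eqVneq k i.+2.
  exists (- B i.+1); first by apply: RN; apply: RB.
  rewrite wE kj swap_r /=; have := B_neq0 i.+1.
  by move: (B i.+1) (B i.+2) => x y x0; field; rewrite x0 bt0.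
by apply: fix_case; rewrite wE swap_out.
Qed.

End SimpleRootCoordinates.

(** * Integrality and divisibility over an abstract polynomial ring *)

Section SchubertClasses.

Variables (A : idomainType) (pc : {rmorphism {poly int} -> A}) (pv : nat -> A).
Hypothesis A_ind : forall Q : A -> Prop,
  (forall c, Q (pc c)) -> (forall k, Q (pv k)) ->
  (forall p q, Q p -> Q q -> Q (p + q)) -> (forall p q, Q p -> Q q -> Q (p * q)) ->
  forall p, Q p.

Notation F := {fraction A}.
Notation bt := (genbeta pc).
Notation b := (genb pv).
Notation B := (genB pc pv).
Notation R := (genR pc pv).

Hypothesis char0 : forall m, m.+1%:R != 0 :> F.
Hypotheses (bt0 : bt != 0) (B_neq0 : forall k, B k != 0).
Hypothesis u12 : uniq [:: 0; 1; -1; B 1%N; B 2%N].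

Variables (X : cartan) (phi : nat -> {rmorphism A -> F}).
Hypothesis phiC : forall i c, phi i (pc c) = @FracField.tofrac A (pc c).
Hypothesis phiX : forall i k, phi i (pv k) = genbz pc pv (simple_refl X i k.+1).

Let e i := eroot bt B (simple_root X i).

Definition simple_sigma i : {rmorphism F -> F} :=
  sigma A_ind bt0 B_neq0 (simple_involutive X i) (refl_odd (simple_root X i))
    (phiC i) (phiX i).

Lemma genB_coord k : b k = (B k - 1) / bt.
Proof. exact: addK_div. Qed.

Lemma genR_beta : R bt.
Proof. exact: genR_tofrac. Qed.

Lemma genR_genB k : R (B k).
Proof. exact: (genR_Bz pc pv (Posz k)). Qed.

Lemma genR_genb k : R (b k).
Proof. exact: (genR_bz pc pv (Posz k)). Qed.

Lemma genR0 : R 0.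
Proof. by rewrite -tofrac0; apply: genR_tofrac. Qed.

Let RD : forall f g, R f -> R g -> R (f + g) := @genRD A pc pv B_neq0.
Let RN : forall f, R f -> R (- f) := @genRN A pc pv.
Let RM : forall f g, R f -> R g -> R (f * g) := @genRM A pc pv.
Let R1 : R 1 := genR1 pc pv.
Let RV : forall k, R (B k)^-1 := genR_invB pc pv.

Lemma genR_eroot i : R (e i).
Proof.
apply: (@coord_eroot F bt B X R bt0 B_neq0 RD RN RM R1 genR_genB RV) => k.
by rewrite -genB_coord; apply: genR_genb.
Qed.

Lemma genR_eroot1V i : R (1 + bt * e i)^-1.
Proof. exact: (@coord_eroot1V F bt B X R bt0 RM genR_genB RV). Qed.

Lemma genbz_simple i (k : nat) : exists2 r, R r &
  genbz pc pv (simple_refl X i k) - b k = e i * r.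
Proof.
rewrite (genbzE bt0 B_neq0) genB_coord.
exact: (@coord_simple F bt B X R bt0 B_neq0 genR0 RD RN RM R1 genR_genB RV).
Qed.

Lemma simple_sigma_sub i f : R f ->
  exists2 r, R r & simple_sigma i f - f = e i * r.
Proof. exact: (sigma_sub_mul _ _ _ _ _ _ _ (genbz_simple i)). Qed.

Lemma simple_sigma_B i (k : nat) : simple_sigma i (B k) =
  match simple_refl X i k with Posz k => B k | Negz k => (B k.+1)^-1 end.
Proof. exact: (sigma_Bz A_ind bt0 B_neq0 _ _ (phiC i) (phiX i) (Posz k)). Qed.

Lemma simple_sigmaK i : involutive (simple_sigma i).
Proof. exact: sigmaK. Qed.

Lemma simple_sigma_beta i : simple_sigma i bt = bt.
Proof. exact: sigma_beta. Qed.

Lemma simple_sigma_genR i f : R f -> R (simple_sigma i f).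
Proof. exact: genR_sigma. Qed.

Let psi l m : F := vpsi B char0 bt0 X l m.

Lemma vpsi_rec i l m : simple_sigma i (psi l (Defs.act X (simple_refl X i) m)) =
  (1 + bt * e i) * psi l m +
  e i * (if removable X i (code X l) then psi (Defs.act X (simple_refl X i) l) m
         else - bt * psi l m).
Proof.
have sK := simple_sigmaK i; have sb := simple_sigma_beta i; have sB := simple_sigma_B i.
case: i sK sb sB => [|i] sK sb sB; last exact: vpsi_rec_succ.
case D : (typeD X); last exact: vpsi_rec_zeroBC.
rewrite /psi /e; move: (simple_sigma 0) sK sb sB; case: (X) D => // _ sg sK sb sB.
exact: vpsi_rec_zeroD.
Qed.

Lemma vpsi_empty_genR l : R (psi l emptySP).
Proof.
rewrite /psi vpsi_empty.
by case: eqVneq => _; [apply: genR1|apply: genR0].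
Qed.

Lemma vpsi_genR l m : R (psi l m).
Proof.
exact: (@psi_R F bt B X bt0 R simple_sigma psi RD RN RM R1 genR_beta genR_eroot
  simple_sigmaK simple_sigma_genR vpsi_empty_genR vpsi_rec).
Qed.

Lemma vpsi_gkm a : positive_root X a -> forall l m, exists2 r, R r &
  psi l (Defs.act X (refl a) m) - psi l m = eroot bt B a * r.
Proof.
exact: (@gkm_positive F bt B X bt0 B_neq0 R simple_sigma psi RD RN RM R1 genR_beta
  genR_eroot genR_eroot1V simple_sigmaK simple_sigma_beta simple_sigma_genR
  simple_sigma_sub simple_sigma_B vpsi_empty_genR vpsi_rec).
Qed.

End SchubertClasses.

Section Coordinates.

Variables (F : fieldType) (bt : F).
Hypothesis bt0 : bt != 0.

Lemma oplus_coord x y : oplus bt x y = ((1 + bt * x) * (1 + bt * y) - 1) / bt.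
Proof. by rewrite -oplusE; apply: addK_div. Qed.

Lemma ominus_coord x y : 1 + bt * y != 0 ->
  ominus bt x y = ((1 + bt * x) / (1 + bt * y) - 1) / bt.
Proof. by move=> y0; rewrite -ominusE //; apply: addK_div. Qed.

Lemma coord_neq0 u : u != 1 -> (u - 1) / bt != 0.
Proof. by move=> u1; rewrite mulf_neq0 ?invr_eq0 ?subr_eq0. Qed.

Lemma addKl_div (e u v y : F) : e != 0 -> u = v + e * y -> (u - v) / e = y.
Proof. by move=> e0 ->; rewrite addrC addKr mulrC mulKf. Qed.

Lemma mpolyX_inj n : injective (fun i : 'I_n => 'X_i : {mpoly F[n]}).
Proof.
move=> i j /(congr1 (meval (fun k => (k == i)%:R))); rewrite !mevalXU eqxx.
by case: eqVneq => // _ /eqP; rewrite oner_eq0.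
Qed.

(** The same P represents the rational function and has the prescribed values at b_m, where its
    defining formula may have vanishing denominators. *)
Lemma gx_fraction (b B : nat -> F) (char0 : forall m, m.+1%:R != 0 :> F) X (l : SP) n :
    (forall k, B k = 1 + bt * b k) -> (forall k, B k != 0) -> (size l <= n)%N ->
  exists2 P : {mpoly F[n]},
    FracField.tofrac P = gx bt b (fun c => FracField.tofrac c%:MP) X l
      (fun i : 'I_n => FracField.tofrac 'X_i) &
    parity_ok X n -> forall m, (size (code X m) <= n)%N ->
      P.@[fun i : 'I_n => nth 0 [seq ominus bt 0 (b k) | k <- code X m] i] =
      vpsi B char0 bt0 X l m.
Proof.
move=> BE B_neq0 le_ln; have [P PE] := gx_poly bt b X le_ln; exists P.
  apply: PE => i j /eqP; rewrite /= tofrac_eq => /eqP; exact: mpolyX_inj.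
by move=> par m le_mn; apply: meval_gx_code.
Qed.

End Coordinates.

Lemma epsilon_tofrac (R : idomainType) (f : {fraction R}) (P : R) :
  FracField.tofrac P = f ->
  epsilon (inhabits 0) (fun Q : R => FracField.tofrac Q = f) = P.
Proof.
move=> Pf; have Ef := epsilon_spec (inhabits 0) (fun Q : R => FracField.tofrac Q = f).
by apply/eqP; rewrite -tofrac_eq Ef ?Pf //; exists P.
Qed.

Lemma genb_pvar k : genb pvar k = b k.
Proof. by case: k. Qed.

Lemma genB_K k : genB pconst pvar k = B k.
Proof. by rewrite BE /genB genb_pvar. Qed.

Lemma genB_K_neq0 k : genB pconst pvar k != 0.
Proof. by rewrite genB_K B_neq0. Qed.

Lemma uniq_genB12 : uniq [:: 0; 1; -1; genB pconst pvar 1%N; genB pconst pvar 2%N].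
Proof. by rewrite !genB_K; apply: uniq_B12. Qed.

(** * Return to [K] and to the functions [GX] *)

Section Classes.

Variables (X : cartan).

Definition simple_phi (i : nat) : {rmorphism poly_ring -> K} :=
  poly_ev (fun k => bz (simple_refl X i k.+1)) Defs.coefK.

Lemma simple_phiC i c : simple_phi i (pconst c) = @FracField.tofrac poly_ring (pconst c).
Proof. exact: poly_evC. Qed.

Lemma simple_phiX i k : simple_phi i (pvar k) = genbz pconst pvar (simple_refl X i k.+1).
Proof. exact: poly_evX. Qed.

Lemma wact_frac_ext i f : wact (simple_refl X i) f = frac_ext (simple_phi i) f.
Proof. exact: erefl. Qed.

(** Makes no reference to N; that [GXval] agrees with it for every admissible N gives the
    independence of N. *)
Definition Kpsi (l m : SP) : K := vpsi (genB pconst pvar) K_char0 beta_neq0 X l m.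

Lemma Kpsi_inR l m : inR (Kpsi l m).
Proof. exact: (vpsi_genR poly_ring_ind K_char0 beta_neq0 genB_K_neq0 uniq_genB12 simple_phiC simple_phiX). Qed.

Lemma e_eroot a : e a = eroot beta (genB pconst pvar) a.
Proof.
case: a => [i|i|j i|j i].
- by rewrite /e /eroot genB_K BE; apply: (addK_div beta_neq0).
- by rewrite /e /eroot genB_K BE expr2; apply: (oplus_coord beta_neq0).
- rewrite /e /eroot !genB_K !BE; apply: (ominus_coord beta_neq0).
  by rewrite -BE B_neq0.
by rewrite /e /eroot !genB_K !BE; apply: (oplus_coord beta_neq0).
Qed.

Lemma Kpsi_gkm l m a : positive_root X a ->
  exists2 r, inR r & Kpsi l (Defs.act X (refl a) m) - Kpsi l m = e a * r.
Proof.
rewrite e_eroot => pa.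
exact: (vpsi_gkm poly_ring_ind K_char0 beta_neq0 genB_K_neq0 uniq_genB12 simple_phiC simple_phiX pa).
Qed.

Lemma Kpsi_rec i l m : let e := e (simple_root X i) in
  wact (simple_refl X i) (Kpsi l (Defs.act X (simple_refl X i) m)) =
  (1 + beta * e) * Kpsi l m +
  e * (if removable X i (code X l) then Kpsi (Defs.act X (simple_refl X i) l) m
       else - beta * Kpsi l m).
Proof.
rewrite wact_frac_ext e_eroot.
rewrite -(sigmaE poly_ring_ind beta_neq0 genB_K_neq0 (simple_involutive X i)
  (refl_odd (simple_root X i)) (simple_phiC i) (simple_phiX i)).
exact: (vpsi_rec poly_ring_ind K_char0 beta_neq0 genB_K_neq0 uniq_genB12 simple_phiC simple_phiX).
Qed.

Lemma e_simple_neq0 i : e (simple_root X i) != 0.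
Proof.
rewrite e_eroot; case: i => [|i].
  case: (X); apply: (coord_neq0 beta_neq0).
  - by rewrite genB_K -B0; apply/negP => /eqP /B_inj.
  - by rewrite genB_K; apply: B_mul_neq1.
  by rewrite !genB_K; apply: B_mul_neq1.
apply: (coord_neq0 beta_neq0); rewrite !genB_K.
apply/negP => /eqP /(divr1_eq) /B_inj /eqP.
by rewrite eqSS eqn_leq ltnn.
Qed.

Lemma GX_gx N l : GX X N l = gx beta b (constK N) X l
  (fun i : 'I_N => FracField.tofrac 'X_i).
Proof. by case: X; exact: erefl. Qed.

Lemma genBE_b k : genB pconst pvar k = 1 + beta * b k.
Proof. by rewrite genB_K BE. Qed.

Lemma GX_Kpsi N (l m : SP) : (size l <= N)%N -> (size (bvec X m) <= N)%N -> parity_ok X N ->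
  GXval X N l m = Kpsi l m.
Proof.
move=> le_lN; rewrite size_map => le_mN par.
have [P PE PV] := gx_fraction beta_neq0 K_char0 X genBE_b genB_K_neq0 le_lN.
have -> : GXval X N l m = P.@[fun i : 'I_N => nth 0 (bvec X m) i].
  rewrite /GXval /to_poly (@epsilon_tofrac _ _ P) // GX_gx; exact: PE.
exact: PV.
Qed.

Lemma psi_Kpsi l m : psi X l m = Kpsi l m.
Proof.
apply: GX_Kpsi; rewrite /least_N size_map; set n := maxn _ _.
- have le_n : (n <= if X is TypeD then n + odd n else n)%N by case: (X); rewrite ?leq_addr.
  by apply: leq_trans le_n; rewrite leq_maxl.
- have le_n : (n <= if X is TypeD then n + odd n else n)%N by case: (X); rewrite ?leq_addr.
  by apply: leq_trans le_n; rewrite leq_maxr.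
by case: (X); rewrite //= oddD oddb addbb.
Qed.

Lemma psi_divdiff i l m : divdiff X i (psi X l) m =
  if removable X i (code X l) then psi X (Defs.act X (simple_refl X i) l) m
  else - beta * psi X l m.
Proof.
have e0 := e_simple_neq0 i; have rec := Kpsi_rec i l m.
rewrite /divdiff !psi_Kpsi; exact: (addKl_div e0 rec).
Qed.

End Classes.

Theorem theorem7p6 (X : cartan) :
  [/\ forall (l : SP) (N : nat), (size l <= N)%N -> parity_ok X N ->
        is_polynomial (GX X N l),
      forall (l m : SP) (N : nat),
        (size l <= N)%N -> (size (bvec X m) <= N)%N -> parity_ok X N ->
        GXval X N l m = psi X l m
    & schubert_classes X (psi X)].
Proof.
split=> [l N le_lN _|l m N le_lN le_mN par|].
- have [P PE _] := gx_fraction beta_neq0 K_char0 X genBE_b genB_K_neq0 le_lN.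
  by exists P; rewrite GX_gx; exact: PE.
- by rewrite psi_Kpsi GX_Kpsi.
split=> [l|i l|l].
- split=> [m|m a pa]; first by rewrite psi_Kpsi; apply: Kpsi_inR.
  by rewrite !psi_Kpsi; apply: Kpsi_gkm.
- split=> [/ltSP_removable|/leSP_not_removable/negbTE] H m.
    by rewrite psi_divdiff H.
  by rewrite psi_divdiff H.
rewrite psi_Kpsi; exact: vpsi_empty.
Qed.
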